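(* Let $d\ge1$ be an integer and let $x=(x_1,\dots,x_n)\in(\mathbb{S}^d)^n$, where $n=\pi_L$, be $n$ points drawn from the harmonic ensemble. Then, as $L\to\infty$, \[ \mathbb{E}_{x\in(\mathbb{S}^d)^n}(E_0(x))=n^2V_{\log}(\mathbb{S}^d)-\frac1d\,n\log n+C_d\,n+o(n), \] where \[ C_d=\frac1d\log\frac2{d!}+\log2+\psi_0\left(\frac d2\right)+\frac1d. \] In particular, for $d=2$, $C_2=\frac12+\log2-\gamma\approx0.6159$, where $\gamma$ is the Euler–Mascheroni constant.
   Context: $\mathbb{S}^d$ is the unit sphere in $\mathbb{R}^{d+1}$ and $\mu$ its normalized (probability) surface measure. $E_0(x)=\sum_{i\ne j}\log\frac1{\|x_i-x_j\|}$ (sum over ordered pairs), and $\psi_0=(\log\Gamma)'$ is the digamma function. The continuous logarithmic energy is \[ V_{\log}(\mathbb{S}^d)=\int_{\mathbb{S}^d}\int_{\mathbb{S}^d}\log\frac1{\|x-y\|}\,d\mu(x)\,d\mu(y)=\tfrac12\left(\psi_0(d)-\psi_0(d/2)\right)-\log2. \] $\Pi_L$ is the space of restrictions to $\mathbb{S}^d$ of polynomials of degree at most $L$ in $d+1$ variables, $\pi_L=\dim\Pi_L=\frac{2L+d}{d}\binom{d+L-1}{L}$, and $K_L(x,y)$ is the reproducing kernel of $\Pi_L$ in $L^2(\mu)$. The harmonic ensemble is the determinantal point process on $\mathbb{S}^d$ with kernel $K_L$ with respect to $\mu$; it has $n=\pi_L$ points a.s., and $x=(x_1,\dots,x_n)$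 drawn from it is the random vector in $(\mathbb{S}^d)^n$ with density $\frac1{n!}\det(K_L(x_i,x_j))_{1\le i,j\le n}$ with respect to $\mu^{\otimes n}$. *)

(* Defs.v *)
From HB Require Import structures.
From mathcomp Require Import all_boot all_order all_algebra.
From mathcomp Require Import all_classical all_reals all_analysis.
From mathcomp Require Import measurable_realfun.
From mathcomp Require mpoly.

Set Implicit Arguments.
Unset Strict Implicit.
Unset Printing Implicit Defensive.

Import Order.TTheory GRing.Theory Num.Theory.
Import numFieldNormedType.Exports.

Local Open Scope classical_set_scope.
Local Open Scope ring_scope.

(* Powers of a sigma-finite measure on n-tuples, whose sigma-algebra is      *)
(* generated by the coordinates: m^(n+1) is the image of m \x m^n by cons.   *)
Section tuple_measure.
Context d (T : measurableType d) (R : realType).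

Definition tuple_cons n (p : T * n.-tuple T) : n.+1.-tuple T :=
  [tuple of p.1 :: p.2].

Lemma measurable_tuple_cons n : measurable_fun setT (@tuple_cons n).
Proof. exact: measurable_cons. Qed.

Section cons.
Variables (m : {sigma_finite_measure set T -> \bar R}) (n : nat).
Variable mn : {sigma_finite_measure set (n.-tuple T) -> \bar R}.

Definition cons_measure : set (n.+1.-tuple T) -> \bar R :=
  pushforward (m \x mn)%E (@tuple_cons n).

Let cons_measure0 : cons_measure set0 = 0%E.
Proof. by rewrite /cons_measure /pushforward preimage_set0 measure0. Qed.

Let cons_measure_ge0 A : (0 <= cons_measure A)%E.
Proof. by rewrite /cons_measure /pushforward measure_ge0. Qed.

Let mcons := @measurable_tuple_cons n.

Let cons_measure_sigma_additive : semi_sigma_additive cons_measure.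
Proof.
move=> F mF tF mUF; rewrite /cons_measure /pushforward preimage_bigcup.
apply: measure_semi_sigma_additive.
- by move=> k; rewrite -[X in measurable X]setTI; exact: mcons.
- apply/trivIsetP => /= i j _ _ ij; rewrite -preimage_setI.
  by move/trivIsetP : tF => /(_ _ _ _ _ ij) ->//; rewrite preimage_set0.
- by rewrite -preimage_bigcup -[X in measurable X]setTI; exact: mcons.
Qed.

HB.instance Definition _ := isMeasure.Build _ _ _ cons_measure
  cons_measure0 cons_measure_ge0 cons_measure_sigma_additive.

Let split (x : n.+1.-tuple T) : T * n.-tuple T := (thead x, [tuple of behead x]).

Let splitK : cancel split (@tuple_cons n).
Proof. by move=> x; rewrite /tuple_cons/= [RHS]tuple_eta; exact: val_inj. Qed.

Let consK : cancel (@tuple_cons n) split.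
Proof.
by move=> [x t]; rewrite /split/tuple_cons/= theadE; congr pair; exact: val_inj.
Qed.

Let msplit : measurable_fun setT split.
Proof.
apply: measurable_fun_pair; [exact: measurable_tnth|exact: measurable_behead].
Qed.

Let cons_measure_sigma_finite : sigma_finite setT cons_measure.
Proof.
have [F [TF ndF Foo]] := (sigma_finiteP _ _).1 (sigma_finiteT m).
have [G [TG ndG Goo]] := (sigma_finiteP _ _).1 (sigma_finiteT mn).
exists (fun k => split @^-1` (F k `*` G k)).
  rewrite -preimage_bigcup (_ : \bigcup_k _ = setT) ?preimage_setT//.
  apply/seteqP; split => // -[x y] _.
  have [i _ Fix] : (\bigcup_i F i) x by rewrite -TF.
  have [j _ Gjy] : (\bigcup_i G i) y by rewrite -TG.
  exists (maxn i j) => //; split => /=.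
    by move: x Fix; exact/subsetPset/ndF/leq_maxl.
  by move: y Gjy; exact/subsetPset/ndG/leq_maxr.
move=> k; have [mFk Fkoo] := Foo k; have [mGk Gkoo] := Goo k; split.
  by rewrite -[X in measurable X]setTI; apply: msplit => //; exact: measurableX.
rewrite /cons_measure /pushforward -comp_preimage.
rewrite (_ : split \o _ = id) ?preimage_id; last first.
  by apply/funext => x /=; rewrite consK.
by rewrite product_measure1E// lte_mul_pinfty// ge0_fin_numE.
Qed.

HB.instance Definition _ := Measure_isSigmaFinite.Build _ _ _ cons_measure
  cons_measure_sigma_finite.

End cons.

Fixpoint tuple_measure (m : {sigma_finite_measure set T -> \bar R}) (n : nat) :
    {sigma_finite_measure set (n.-tuple T) -> \bar R} :=
  match n with
  | 0 => dirac [tuple]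
  | n'.+1 => cons_measure m (tuple_measure m n')
  end.

End tuple_measure.

Section euclid.
Context (R : realType).

(* The reals as carrier of lebesgue_measure: R itself, with its Borel sets.  *)
Local Notation RT := (measurableTypeR R).

Definition enorm n (x : n.-tuple R) : R :=
  Num.sqrt (\sum_(i < n) tnth x i ^+ 2).

Definition edist n (x y : n.-tuple R) : R :=
  enorm [tuple tnth x i - tnth y i | i < n].

Lemma measurable_coord n (i : 'I_n) :
  measurable_fun setT (fun x : n.-tuple RT => tnth x i : R).
Proof. exact: (@measurable_tnth _ RT). Qed.

Lemma measurable_enorm n :
  measurable_fun setT (fun x : n.-tuple RT => enorm (x : n.-tuple R)).
Proof.
apply: (measurableT_comp (continuous_measurable_fun (@sqrt_continuous R))).
by apply: measurable_sum => i; apply: measurable_funX; exact: measurable_coord.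
Qed.

Definition unit_ball n : set (n.-tuple RT) :=
  [set x : n.-tuple RT | enorm (x : n.-tuple R) <= 1].

Lemma measurable_unit_ball n : measurable (@unit_ball n).
Proof.
rewrite (_ : @unit_ball n = (fun x : n.-tuple RT => enorm (x : n.-tuple R)) @^-1` `]-oo, 1]); last first.
  by apply/seteqP; split => x; rewrite /unit_ball/= in_itv.
rewrite -[X in measurable X]setTI; apply: measurable_enorm => //.
Qed.

Definition sphere d : Type := {x : d.+1.-tuple R | enorm x == 1}.

HB.instance Definition _ d := SubType.on (sphere d).
HB.instance Definition _ d := Choice.on (sphere d).

Definition sphere_pole_tuple d : d.+1.-tuple R :=
  [tuple (i == ord0)%:R | i < d.+1].

Lemma sphere_pole_subproof d : enorm (sphere_pole_tuple d) == 1.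
Proof.
rewrite /enorm big_ord_recl big1 => [|i _]; rewrite tnth_mktuple.
  by rewrite eqxx expr1n addr0 sqrtr1.
by rewrite expr0n.
Qed.

Definition sphere_pole d : sphere d := 
  @exist _ (fun x => enorm x == 1) _ (sphere_pole_subproof d).

HB.instance Definition _ d := isPointed.Build (sphere d) (sphere_pole d).

(* The Borel sets of the sphere are the traces of those of the space. *)
Definition sphere_measurable d : set (set (sphere d)) :=
  preimage_set_system setT (val : sphere d -> d.+1.-tuple RT) measurable.

Let sphere_measurable_sa d : sigma_algebra setT (@sphere_measurable d).
Proof. exact/sigma_algebra_preimage/sigma_algebra_measurable. Qed.

Let sphere_measurable0 d : @sphere_measurable d set0.
Proof. by case: (sphere_measurable_sa d). Qed.

Let sphere_measurableC d A :
  @sphere_measurable d A -> @sphere_measurable d (~` A).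
Proof. by rewrite -setTD; case: (sphere_measurable_sa d) => _ + _; exact. Qed.

Let sphere_measurable_bigcup d (F : (set (sphere d))^nat) :
  (forall i, sphere_measurable (F i)) -> sphere_measurable (\bigcup_i F i).
Proof. by case: (sphere_measurable_sa d) => _ _; exact. Qed.

HB.instance Definition _ d := @isMeasurable.Build default_measure_display
  (sphere d) (@sphere_measurable d) (@sphere_measurable0 d)
  (@sphere_measurableC d) (@sphere_measurable_bigcup d).

(* Radial projection x |-> x / |x|; the origin, which carries no mass below, *)
(* is sent to an arbitrary point.                                           *)
Definition to_sphere d (x : d.+1.-tuple R) : sphere d :=
  insubd (sphere_pole d) [tuple tnth x i / enorm x | i < d.+1].

Lemma val_to_sphere d (x : d.+1.-tuple R) :
  val (to_sphere x) = if enorm x == 0 then sphere_pole_tuple d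
                      else [tuple tnth x i / enorm x | i < d.+1].
Proof.
have n0 : 0 <= enorm x by exact: sqrtr_ge0.
have e2 : enorm x ^+ 2 = \sum_(i < d.+1) tnth x i ^+ 2.
  by rewrite sqr_sqrtr// sumr_ge0// => i _; exact: sqr_ge0.
have e : enorm [tuple tnth x i / enorm x | i < d.+1] =
         Num.sqrt (enorm x ^+ 2 / enorm x ^+ 2).
  rewrite {1}e2 mulr_suml; congr (Num.sqrt _); apply: eq_bigr => i _.
  by rewrite tnth_mktuple expr_div_n.
rewrite val_insubd e; case: (eqVneq (enorm x) 0) => [x0|x0].
  by rewrite x0 expr0n/= mul0r sqrtr0 [0 == 1]eq_sym oner_eq0.
by rewrite divff ?sqrf_eq0// sqrtr1 eqxx.
Qed.

Lemma measurable_to_sphere d :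
  measurable_fun setT (@to_sphere d : d.+1.-tuple RT -> sphere d).
Proof.
suff mval : measurable_fun setT
    (fun x : d.+1.-tuple RT => val (to_sphere x) : d.+1.-tuple RT).
  by move=> _ A [B mB <-]; rewrite setTI -comp_preimage; exact: mval.
rewrite (funext (@val_to_sphere d)); apply: measurable_fun_ifT.
- by apply: measurable_fun_eqr; [exact: measurable_enorm|exact: measurable_cst].
- exact: measurable_cst.
- apply/measurable_fun_tnthP => i.
  rewrite (_ : _ \o _ = (fun x => tnth x i * (enorm x `^ (-1)))); last first.
    by apply/funext => x /=; rewrite tnth_mktuple powR_inv1// sqrtr_ge0.
  apply: measurable_funM; first exact: measurable_tnth.
  apply: (@measurableT_comp _ _ _ _ _ _ (@powR R ^~ (-1))) (@measurable_enorm _).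
  exact: measurable_powR.
Qed.

End euclid.

Section surface_measure.
Context (R : realType) (d : nat).

Local Notation RT := (measurableTypeR R).

(* Uniform distribution on the closed unit ball of R^(d+1). The second       *)
(* argument of mnormalize is a default for normalizing a measure of mass 0   *)
(* or +oo, which the volume of the ball is not.                              *)
Definition uniform_ball : probability (d.+1.-tuple RT) R :=
  mnormalize (mrestr (tuple_measure (@lebesgue_measure R) d.+1)
                     (@measurable_unit_ball R d.+1))
             point.

Definition radial : d.+1.-tuple RT -> sphere R d := @to_sphere R d.

HB.instance Definition _ :=
  isMeasurableFun.Build _ _ _ _ radial (@measurable_to_sphere R d).

(* Normalized surface measure: the surface measure of A is (d+1) times the   *)
(* volume of the cone {t x | x in A, 0 < t <= 1}, hence the normalized one is *)
(* the proportion of the ball lying above A.                                 *)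
Definition sphere_measure : probability (sphere R d) R :=
  distribution uniform_ball radial.

End surface_measure.

Section harmonic_ensemble.
Context (R : realType) (d : nat).

Local Notation S := (sphere R d).
Local Notation mu := (sphere_measure R d).

(* log (1 / |x - y|), with value +oo on the diagonal.                        *)
Definition log_kernel (x y : S) : \bar R :=
  lne ((edist (val x) (val y))%:E^-1)%E.

Definition log_energy n (x : n.-tuple S) : \bar R :=
  (\sum_(p : 'I_n * 'I_n | p.1 != p.2)
     log_kernel (tnth x p.1) (tnth x p.2))%E.

Definition V_log : \bar R :=
  (\int[mu]_x \int[mu]_y log_kernel x y)%E.

Definition sphere_poly (L : nat) : set (S -> R) :=
  [set f | exists2 p : mpoly.mpoly d.+1 R,
     all (fun m => mpoly.mdeg m <= L)%N (mpoly.msupp p) &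
     forall x : S, f x = mpoly.meval (tnth (val x)) p].

Definition has_dim (V : set (S -> R)) (n : nat) : Prop :=
  exists b : 'I_n -> S -> R,
    (forall f : S -> R, V f <->
       exists c : 'I_n -> R, forall x, f x = \sum_(i < n) c i * b i x) /\
    (forall c : 'I_n -> R,
       (forall x, \sum_(i < n) c i * b i x = 0) -> forall i, c i = 0).

Definition sphere_poly_dim (L : nat) : nat :=
  xget 0%N [set n | has_dim (sphere_poly L) n].

(* For the inner product of L^2(mu); such a K is unique.                     *)
Definition is_reproducing_kernel (V : set (S -> R)) (K : S -> S -> R) : Prop :=
  (forall x, V (K x)) /\
  (forall f, V f -> forall x, f x = \int[mu]_y (f y * K x y)).

Definition sphere_kernel (L : nat) : S -> S -> R :=
  xget (fun _ _ => 0) [set K | is_reproducing_kernel (sphere_poly L) K].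

Definition harmonic_density (L : nat)
    (x : (sphere_poly_dim L).-tuple S) : R :=
  ((sphere_poly_dim L)`!%:R)^-1 *
  \det (\matrix_(i, j) sphere_kernel L (tnth x i) (tnth x j)).

(* P is the law of the random vector: it has the above density with respect  *)
(* to the n-th power of mu, n being the dimension.                           *)
Definition harmonic_ensemble (L : nat)
    (P : probability ((sphere_poly_dim L).-tuple S) R) : Prop :=
  forall A, measurable A ->
    P A = (\int[tuple_measure mu (sphere_poly_dim L)]_(x in A)
             (harmonic_density x)%:E)%E.

End harmonic_ensemble.

Section constants.
Context (R : realType).

Definition Gamma (x : R) : R :=
  \int[lebesgue_measure]_(t in `]0, +oo[) (t `^ (x - 1) * expR (- t)).

Definition digamma : R -> R := derive1 (fun x => ln (Gamma x)).

Definition euler_gamma : R :=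
  limn (fun n => \sum_(1 <= k < n.+1) k%:R^-1 - ln n%:R).

Definition harmonic_const (d : nat) : R :=
  d%:R^-1 * ln (2 / d`!%:R) + ln 2 + digamma (d%:R / 2) + d%:R^-1.

End constants.

(* Main.v *)
(* The kernel of the harmonic ensemble is an orthogonal projection, so its    *)

(* For a function phi of the inner product, the expected sum over ordered pairs is the double
   integral of phi(<x,y>) (K(x,x) K(y,y) - K(x,y)^2) ([Rint_pairs_det_kernel],
   [harmonic_expectation_pairs]). Here log(1/|x - y|) = -(ln 2 + ln(1 - <x,y>))/2. The product
   K(x,x) K(y,y) = n^2 contributes n^2 V_log. By rotation invariance the square contributes half of
   n ln 2 plus half of the integral of K(e,y)^2 ln(1 - t), since K(e,y)^2 integrates to K(e,e) = n
   ([harmonic_expectation]). Bounded truncations increasing to the logarithm handle its infinite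
   value on the diagonal.

   What remains concerns two functionals on polynomials in t: L0 p, the integral of p, and Ll p, the
   integral of p ln(1 - t). Integration by parts gives L0((1 - t^2) p' - d t p) = 0, and Ll of the
   same polynomial equals L0((1 + t) p). On Gegenbauer polynomials p_k this yields two-step
   recurrences for L0 p_k and Ll p_k; symmetry of multiplication by t then reaches every L0(p_j p_k)
   and Ll(p_j p_k). For k < n, Ll(p_n p_k) = -(2n + d - 1) / (h_n (n - k)(n + k + d - 1))
   ([Ll_gegen_lt]). On the diagonal the recurrences leave Ll 1 undetermined. It is fixed
   asymptotically: the average of ln(1 - t) for the weight (1 - t)^m tends to ln 2, the mass
   concentrating at t = -1, and therefore h_k Ll(p_k^2) tends to -ln 2 ([cvg_diag]).

   Adding h_n p_n to the kernel changes Ll(K^2) by h_n (h_n Ll(p_n^2) - 2 [cross_sum] n), and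
   [cross_sum] n = ln n - psi(d/2) - ln 2 + o(1) ([cvg_cross_sum]), by raising d in steps of 2 from
   the explicit cases d = 1 and d = 2. Summation by parts removes ln n and leaves a mean, with
   weights h_k, of a sequence with limit ln 2 + 2 psi(d/2) + 2/d. Since ln(dim) = d ln L + ln(2/d!)
   + o(1), this gives the constant ([cvg_kernel_log_energy]). *)
(* two-point intensity is K(x,x) K(y,y) - K(x,y)^2 and the expected energy is *)
(* n^2 V_log plus the integral of K(x,y)^2 log|x - y|. By rotation invariance *)
(* K(x,y) = sum_(k <= L) h_k p_k(<x,y>), with p_k the Gegenbauer polynomial   *)
(* such that p_k(1) = 1 and h_k the dimension of the harmonics of degree k.   *)
(* Invariance under infinitesimal rotations gives integrations by parts in    *)
(* t = <e,y>, e the pole, for polynomials and for their products with         *)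
(* ln(1 - t). They determine the integrals of p_j p_k and p_j p_k ln(1 - t)   *)
(* in closed form, and turn the integral of K(e,y)^2 ln(1 - t) into a sum     *)
(* over k <= L of h_k times partial harmonic sums. Its asymptotics follow by  *)
(* a weighted Cesaro argument, psi(d/2) being the Euler limit of              *)
(* ln m - sum_(i < m) 1/(d/2 + i).                                            *)
From HB Require Import structures.
Require Import Defs.
From mathcomp Require Import all_boot all_order all_algebra.
From mathcomp Require Import all_classical all_reals all_analysis.
From mathcomp Require Import measurable_realfun.
From mathcomp Require mpoly fingroup perm.
From mathcomp Require Import ring lra zify.
Set Implicit Arguments.
Unset Strict Implicit.
Unset Printing Implicit Defensive.
Import Order.TTheory GRing.Theory Num.Theory.
Import numFieldNormedType.Exports.
Local Open Scope classical_set_scope.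
Local Open Scope ring_scope.

(** * Numerical bounds and averages *)

Section calculus.
Context {R : realType}.
Implicit Types (f df : R -> R) (a b : R).

Lemma le_of_derive_ge0 f df a b : a <= b ->
  (forall x, a <= x <= b -> is_derive x 1 f (df x)) ->
  (forall x, a <= x <= b -> 0 <= df x) -> f a <= f b.
Proof.
move=> ab fdf df0.
have [||c cab E] := @MVT_segment R f df a b ab.
- by move=> x; rewrite in_itv/= => /andP[? ?]; apply: fdf; rewrite !ltW.
- apply: derivable_within_continuous => x; rewrite in_itv/= => xab.
  by have [] := fdf x xab.
- rewrite -subr_ge0 E mulr_ge0 ?subr_ge0//; apply: df0.
  by move: cab; rewrite in_itv.
Qed.

Lemma is_derive_ln1D (y : R) : -1 < y -> is_derive y 1 (fun x => ln (1 + x)) (1 + y)^-1.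
Proof.
move=> y1; have y0 : 0 < 1 + y by lra.
have ? := is_derive1_ln y0.
rewrite -[X in is_derive _ _ _ X]mulr1.
apply: (@is_derive1_comp _ (@ln R) (fun x => 1 + x)).
by rewrite -[X in is_derive _ _ _ X]add0r; apply: is_deriveD.
Qed.

Lemma is_derive_ln1B (y : R) : y < 1 -> is_derive y 1 (fun x => ln (1 - x)) (- (1 - y)^-1).
Proof.
move=> y1; have y0 : 0 < 1 - y by lra.
have ? := is_derive1_ln y0.
rewrite -[X in is_derive _ _ _ X]mulrN1.
apply: (@is_derive1_comp _ (@ln R) (fun x => 1 - x)).
by rewrite -[X in is_derive _ _ _ X]add0r; apply: is_deriveD.
Qed.

(** Truncation of the series 2 (y + y^3/3 + y^5/5 + ...): the difference vanishes at 0 and has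
    derivative 2 x^4 / (1 - x^2). *)
Lemma ln_atanh_ge (y : R) : 0 <= y < 1 ->
  2 * y + 2 / 3 * y ^+ 3 <= ln ((1 + y) / (1 - y)).
Proof.
move=> /andP[y0 y1].
rewrite ln_div ?posrE; try lra.
rewrite -subr_ge0.
pose f (x : R) := ln (1 + x) - ln (1 - x) - (2 * x + 2 / 3 * x ^+ 3).
have -> : 0 = f 0 by rewrite /f addr0 subr0 ln1; lra.
pose df (x : R) := (1 + x)^-1 - (- (1 - x)^-1) - (2 + 2 / 3 * (3 * x ^+ 2)).
rewrite -[X in _ <= X]/(f y); apply: (@le_of_derive_ge0 f df 0 y y0).
- move=> x /andP[x0 xy].
  have ? := @is_derive_ln1D x _. have ? := @is_derive_ln1B x _.
  apply: is_deriveB; last first.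
    apply: is_derive_eq; rewrite /GRing.scale/=; ring.
  by apply: is_deriveB; [apply: is_derive_ln1D|apply: is_derive_ln1B]; lra.
- move=> x /andP[x0 xy].
  suff -> : df x = 2 * x ^+ 4 / ((1 + x) * (1 - x)).
    by rewrite divr_ge0 ?mulr_ge0 ?exprn_ge0//; lra.
  rewrite /df; field; lra.
Qed.

(** The last term majorizes the tail of the same series by a geometric one of ratio y^2. *)
Lemma ln_atanh_le (y : R) : 0 <= y < 1 ->
  ln ((1 + y) / (1 - y)) <=
  2 * y + 2 / 3 * y ^+ 3 + 2 / 5 * (y ^+ 5 / ((1 - y) * (1 + y))).
Proof.
move=> /andP[y0 y1].
rewrite ln_div ?posrE; try lra.
rewrite -subr_ge0.
pose f (x : R) := (2 * x + 2 / 3 * x ^+ 3 + 2 / 5 * (x ^+ 5 * ((1 - x) * (1 + x))^-1))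
  - (ln (1 + x) - ln (1 - x)).
have -> : 0 = f 0 by rewrite /f addr0 subr0 ln1; lra.
pose df (x : R) := 2 + 2 * x ^+ 2 + 2 / 5 * (5 * x ^+ 4 * ((1 - x) * (1 + x))^-1
    + x ^+ 5 * (((1 - x) * (1 + x)) ^- 2 * (2 * x))) -
  ((1 + x)^-1 - (- (1 - x)^-1)).
rewrite -[X in _ <= X]/(f y); apply: (@le_of_derive_ge0 f df 0 y y0).
- move=> x /andP[x0 xy].
  apply: is_deriveB; last first.
    by apply: is_deriveB; [apply: is_derive_ln1D|apply: is_derive_ln1B]; lra.
  have n0 : (1 - x) * (1 + x) != 0 by apply: mulf_neq0; lra.
  have D : is_derive x 1 (fun x => ((1 - x) * (1 + x))^-1) (((1 - x) * (1 + x)) ^- 2 * (2 * x)).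
    have D1 : is_derive x 1 (fun x : R => (1 - x) * (1 + x)) (- (2 * x)).
      apply: is_derive_eq; rewrite /GRing.scale/=; ring.
    have H := @is_deriveV R (fun x : R => (1 - x) * (1 + x)) x _ 1 n0 D1.
    apply: is_derive_eq H _.
    rewrite /GRing.scale/=; ring.
  have D5 : is_derive x 1 (fun x : R => x ^+ 5) (5 * x ^+ 4).
    apply: is_derive_eq; rewrite /GRing.scale/=; ring.
  have D2 : is_derive x 1 (fun x : R => 2 * x + 2 / 3 * x ^+ 3) (2 + 2 * x ^+ 2).
    apply: is_derive_eq; rewrite /GRing.scale/=; lra.
  have D3 := is_deriveD D2 (is_deriveM (is_derive_cst (2 / 5 : R) x 1) (is_deriveM D5 D)).
  apply: (is_derive_eq D3); rewrite /GRing.scale/=; ring.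
- move=> x /andP[x0 xy].
  suff -> : df x = 4 / 5 * x ^+ 6 / ((1 - x) * (1 + x)) ^+ 2.
    by rewrite divr_ge0 ?mulr_ge0 ?exprn_ge0// ?mulr_ge0; lra.
  rewrite /df; field; lra.
Qed.
End calculus.

(** * Enclosures of the Euler constant and of ln 2 *)

Section euler_constant.
Context {R : realType}.
Implicit Types (x : R) (n : nat).

Definition harmonic_sum n : R := \sum_(1 <= k < n.+1) k%:R^-1.

Lemma harmonic_sum0 : harmonic_sum 0 = 0.
Proof. by rewrite /harmonic_sum big_geq. Qed.

Lemma harmonic_sumS n : harmonic_sum n.+1 = harmonic_sum n + n.+1%:R^-1.
Proof. by rewrite /harmonic_sum big_nat_recr. Qed.

(** Euler-Maclaurin for the integral of 1/t over [x, x + 1]: the trapezoid rule with one end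
    correction is a lower bound, and one more correction ([ln_succ_le]) makes it an upper bound. The
    substitution y = 1/(2x + 1) reduces both to the series above. *)
Lemma ln_succ_ge x : 0 < x ->
  (x^-1 + (x + 1)^-1) / 2 - (x ^- 2 - (x + 1) ^- 2) / 12 <= ln ((x + 1) / x).
Proof.
move=> x0; pose y := (2 * x + 1)^-1.
have y0 : 0 < y by rewrite invr_gt0; lra.
have y1 : y < 1 by rewrite invf_lt1; lra.
have -> : (x + 1) / x = (1 + y) / (1 - y) by rewrite /y; field; lra.
apply: le_trans (ln_atanh_ge _); last by rewrite ltW.
rewrite -subr_ge0.
have -> : x = (1 - y) / (2 * y) by rewrite /y; field; lra.
have [a b] : 1 - y != 0 /\ 1 + y != 0 by split; lra.
rewrite (_ : _ - _ = 2 / 3 * y ^+ 5 * (1 + y ^+ 2) / ((1 - y) * (1 + y)) ^+ 2).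
  rewrite divr_ge0 ?sqr_ge0// mulr_ge0//; last by rewrite addr_ge0 ?sqr_ge0.
  by rewrite mulr_ge0 ?exprn_ge0//; lra.
field; lra.
Qed.

Lemma ln_succ_le x : 0 < x ->
  ln ((x + 1) / x) <= (x^-1 + (x + 1)^-1) / 2 - (x ^- 2 - (x + 1) ^- 2) / 12
    + (x ^- 4 - (x + 1) ^- 4) / 120.
Proof.
move=> x0; pose y := (2 * x + 1)^-1.
have y0 : 0 < y by rewrite invr_gt0; lra.
have y1 : y < 1 by rewrite invf_lt1; lra.
have -> : (x + 1) / x = (1 + y) / (1 - y) by rewrite /y; field; lra.
apply: le_trans (ln_atanh_le _) _; first by rewrite ltW.
rewrite -subr_ge0.
have -> : x = (1 - y) / (2 * y) by rewrite /y; field; lra.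
have [a b] : 1 - y != 0 /\ 1 + y != 0 by split; lra.
rewrite (_ : _ - _ = y ^+ 7 * (44 / 15 - 8 / 15 * y ^+ 2 - 4 / 15 * y ^+ 4)
   / ((1 - y) * (1 + y)) ^+ 4).
  rewrite divr_ge0 ?mulr_ge0 ?exprn_ge0// ?mulr_ge0//; try lra.
  have : y ^+ 2 <= 1 by rewrite exprn_ile1//; lra.
  have : y ^+ 4 <= 1 by rewrite exprn_ile1//; lra.
  lra.
field; lra.
Qed.

Lemma cvgn_eq_lim (v : nat -> R) (a b : R) : a = b -> v n @[n --> \oo] --> a ->
  v n @[n --> \oo] --> b.
Proof. by move=> ->. Qed.

(** Asymptotic expansion of the harmonic numbers: [u] decreases by [ln_succ_ge] and [l] increases by
    [ln_succ_le], so each pair of terms encloses the Euler constant. *)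
Let u n : R := harmonic_sum n.+1 - ln n.+1%:R - (2 * n.+1%:R)^-1 + (12 * n.+1%:R ^+ 2)^-1.
Let l n : R := u n - (120 * n.+1%:R ^+ 4)^-1.

Let lnS n : ln n.+2%:R - ln n.+1%:R = ln ((n.+1%:R + 1) / n.+1%:R) :> R.
Proof. by rewrite ln_div ?posrE ?addr_gt0// -natr1. Qed.

Let u_noninc : nonincreasing_seq u.
Proof.
apply/nonincreasing_seqP => n; rewrite -subr_ge0 /u (harmonic_sumS n.+1).
have := @ln_succ_ge n.+1%:R ltac:(by []); rewrite -lnS -(natr1 n.+1).
have : n.+1%:R != 0 :> R by [].
have : n.+1%:R + 1 != 0 :> R by rewrite natr1.
move: (n.+1%:R : R) => x x1 x0.
rewrite (invfM 2) (invfM 2) !(invfM 12) ?(invfM 120); lra.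
Qed.

Let l_nondec : nondecreasing_seq l.
Proof.
apply/nondecreasing_seqP => n; rewrite -subr_ge0 /l /u (harmonic_sumS n.+1).
have := @ln_succ_le n.+1%:R ltac:(by []); rewrite -lnS -(natr1 n.+1).
have : n.+1%:R != 0 :> R by [].
have : n.+1%:R + 1 != 0 :> R by rewrite natr1.
move: (n.+1%:R : R) => x x1 x0.
rewrite (invfM 2) (invfM 2) !(invfM 12) ?(invfM 120); lra.
Qed.

Lemma cvg_invn : (n%:R^-1 : R) @[n --> \oo] --> (0 : R).
Proof. by rewrite -(cvg_shiftS _ (nbhs (0 : R))); exact: cvg_harmonic. Qed.

Lemma cvg_invSn : (n.+1%:R^-1 : R) @[n --> \oo] --> (0 : R).
Proof. exact: cvg_harmonic. Qed.

Lemma cvg_invSXn k : (n.+1%:R^-1 ^+ k.+1 : R) @[n --> \oo] --> (0 : R).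
Proof.
elim: k => [|k ih]; first exact: cvg_invSn.
rewrite -[X in _ --> X](mulr0 (0 : R)).
under eq_fun do rewrite exprS.
by apply: cvgM; [exact: cvg_invSn|exact: ih].
Qed.

Let ul0 : u - l @ \oo --> (0 : R).
Proof.
rewrite [X in X @ _ --> _](_ : _ = (fun n => 120^-1 * (n.+1%:R)^-1 ^+ 4)); last first.
  apply/funext => n; rewrite /l; fold u.
  rewrite !fctE opprB addrC subrK (invfM 120) exprVn//.
rewrite -[X in _ --> X](mulr0 (120^-1 : R)).
by apply: cvgM; [exact: cvg_cst|exact: cvg_invSXn].
Qed.

Let cvgu : u @ \oo --> limn u.
Proof. by have [] := adjacent_seq l_nondec u_noninc ul0. Qed.

Let cvg_gamma : (harmonic_sum n - ln n%:R) @[n --> \oo] --> limn u.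
Proof.
rewrite -(cvg_shiftS _ (nbhs (limn u : R))) /=.
rewrite [X in X @ _ --> _](_ : _ = (fun n => u n + (2^-1 * n.+1%:R^-1 - 12^-1 * n.+1%:R^-1 ^+ 2))); last first.
  apply/funext => n; rewrite /u (invfM 2) (invfM 12) exprVn.
  ring.
have E : limn u + (2^-1 * 0 - 12^-1 * 0) = limn u :> R by lra.
apply: (cvgn_eq_lim E).
apply: cvgD => //; apply: cvgB.
- by apply: cvgM; [exact: cvg_cst|exact: cvg_invSn].
- by apply: cvgM; [exact: cvg_cst|exact: cvg_invSXn].
Qed.

Let gammaE : euler_gamma R = limn u.
Proof. exact: cvg_lim cvg_gamma. Qed.

Lemma cvg_harmonic_ln : (harmonic_sum n - ln n%:R) @[n --> \oo] --> euler_gamma R.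
Proof. by rewrite gammaE. Qed.

Lemma euler_gamma_bounds n :
  harmonic_sum n.+1 - ln n.+1%:R - (2 * n.+1%:R)^-1 + (12 * n.+1%:R ^+ 2)^-1
    - (120 * n.+1%:R ^+ 4)^-1 <= euler_gamma R
  <= harmonic_sum n.+1 - ln n.+1%:R - (2 * n.+1%:R)^-1 + (12 * n.+1%:R ^+ 2)^-1.
Proof.
have [E cl cu] := adjacent_seq l_nondec u_noninc ul0.
by rewrite gammaE (nonincreasing_cvgn_ge u_noninc cu) E (nondecreasing_cvgn_le l_nondec cl).
Qed.

(* Machin-like formula: 2 = (16/15)^7 (25/24)^5 (81/80)^3. *)
Lemma ln2_decomp : ln 2 = 7 * ln (16 / 15) + 5 * ln (25 / 24) + 3 * ln (81 / 80) :> R.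
Proof.
have -> : (2 : R) = (16 / 15) ^+ 7 * (25 / 24) ^+ 5 * (81 / 80) ^+ 3 by lra.
rewrite lnM ?posrE ?mulr_gt0 ?exprn_gt0 ?divr_gt0//.
rewrite lnM ?posrE ?exprn_gt0 ?divr_gt0//.
by rewrite !lnXn ?divr_gt0// !mulr_natl.
Qed.

Lemma ln2_bounds : 6931 / 10 ^+ 4 + 470 / 10 ^+ 7 <= ln (2 : R) <= 6931 / 10 ^+ 4 + 474 / 10 ^+ 7.
Proof.
(* For y at most 1/4, the factor 2/5 / (1 - y^2) of the remainder is below 1/2. *)
have bd (q y : R) : 0 <= y <= 4^-1 -> q * (1 - y) = 1 + y ->
    2 * y + 2 / 3 * y ^+ 3 <= ln q <= 2 * y + 2 / 3 * y ^+ 3 + y ^+ 5 / 2.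
  move=> yb qy; have y1 : 0 <= y < 1 by lra.
  have -> : q = (1 + y) / (1 - y) by rewrite -qy mulfK//; lra.
  rewrite ln_atanh_ge//= (le_trans (ln_atanh_le y1))// lerD2l.
  have y4 : y ^+ 2 <= 16^-1.
    by rewrite (_ : 16^-1 = 4^-1 ^+ 2) ?ler_pXn2r ?nnegrE//; lra.
  have y5 : 0 <= y ^+ 5 by rewrite exprn_ge0//; lra.
  have p0 : 0 < (1 - y) * (1 + y) by apply: mulr_gt0; lra.
  rewrite mulrA ler_pdivrMr//.
  have : y ^+ 5 * (15 / 16) <= y ^+ 5 * ((1 - y) * (1 + y)) by rewrite ler_wpM2l//; lra.
  lra.
have /andP[? ?] := bd (16 / 15) (31^-1) ltac:(lra) ltac:(lra).
have /andP[? ?] := bd (25 / 24) (49^-1) ltac:(lra) ltac:(lra).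
have /andP[? ?] := bd (81 / 80) (161^-1) ltac:(lra) ltac:(lra).
rewrite ln2_decomp; lra.
Qed.

Lemma ln2_sub_euler_gamma_bounds :
  1159 / 10 ^+ 4 + 2 / 10 ^+ 5 <= ln 2 - euler_gamma R <= 1159 / 10 ^+ 4 + 45 / 10 ^+ 6.
Proof.
(* Index 7 brings in ln 8, a multiple of ln 2, and an enclosure of width 1/(120 * 8^4), about 2 *
   10^-6. *)
have /andP[lo hi] := euler_gamma_bounds 7.
have /andP[l2 h2] := ln2_bounds.
have H8 : harmonic_sum 8 = 761 / 280.
  by rewrite !harmonic_sumS harmonic_sum0; lra.
have ln8 : ln 8 = 3 * ln 2 :> R.
  by rewrite (_ : 8 = 2 ^+ 3) ?lnXn// ?mulr_natl//; lra.
rewrite H8 ln8 in lo hi; lra.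
Qed.

End euler_constant.

(** * Weighted Cesaro means *)

Section weighted_means.
Context {R : realType}.

(** Weights at least 1 have divergent sum, so the finitely many terms far from the limit become
    negligible. *)
Lemma weighted_cesaro (h c : nat -> R) (l : R) : (forall k, 1 <= h k) ->
  c @ \oo --> l ->
  (\sum_(k < n.+1) h k * c k) / (\sum_(k < n.+1) h k) @[n --> \oo] --> l.
Proof.
move=> h1 cl; have h0 k : 0 < h k by rewrite (lt_le_trans _ (h1 k)).
have Hn n : n.+1%:R <= \sum_(k < n.+1) h k.
  by rewrite -[n.+1 in leLHS]card_ord -sumr_const ler_sum.
have H0 n : 0 < \sum_(k < n.+1) h k by rewrite (lt_le_trans _ (Hn n)).
apply/cvgrPdist_le => e e0.
have e20 : 0 < e / 2 by rewrite divr_gt0.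
have /cvgrPdist_le /(_ _ e20)[N _ cN] := cl.
pose A := \sum_(k < N) h k * `|c k - l|.
have A0 : 0 <= A by apply: sumr_ge0 => k _; rewrite mulr_ge0// ltW.
(* Beyond N the terms are within e/2 of the limit; the second bound makes A at most e/2 times n + 1,
   hence at most e/2 times the total weight. *)
exists (maxn N (Num.truncn (A / (e / 2))).+1) => // n /=; rewrite geq_max => /andP[Nn An].
rewrite -normrN opprB -(ler_pM2r (H0 n)) -[X in _ * X <= _]ger0_norm ?(ltW (H0 n))//.
rewrite -normrM mulrBl divfK ?(gt_eqF (H0 n))// mulr_sumr -sumrB.
apply: le_trans (ler_norm_sum _ _ _) _.
have -> : e * \sum_(k < n.+1) h k = e / 2 * \sum_(k < n.+1) h k + e / 2 * \sum_(k < n.+1) h k.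
  by rewrite -mulrDl -splitr.
have E k : `|h k * c k - l * h k| = h k * `|c k - l|.
  by rewrite (mulrC l) -mulrBr normrM gtr0_norm.
under eq_bigr do rewrite E.
rewrite -(big_mkord xpredT (fun k => h k * `|c k - l|)).
rewrite (@big_cat_nat _ _ _ N) //=; last by rewrite leqW.
apply: lerD.
- rewrite big_mkord -/A (@le_trans _ _ (e / 2 * n.+1%:R))//; last by rewrite ler_pM2l.
  rewrite mulrC -ler_pdivrMr// (le_trans (ltW (truncnS_gt _)))//.
  by rewrite ler_nat leqW.
- rewrite -(big_mkord xpredT h) (@big_cat_nat _ _ _ N 0) //=; last by rewrite leqW.
  rewrite mulrDr ler_wpDl//; first by apply: mulr_ge0; [exact: ltW|apply: sumr_ge0 => k _; exact: ltW].
  rewrite mulr_sumr !big_nat ler_sum// => k /andP[Nk _].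
  by rewrite mulrC ler_pM2r// distrC cN.
Qed.

End weighted_means.

(** * Log-convex solutions of the Gamma recurrence *)

Ltac lra_inv := repeat match goal with
  | |- context [GRing.inv ?x] => generalize (GRing.inv x); intro
  end; lra.

Section log_convex_recurrence.
Context {R : realType}.
Implicit Types x y h : R.

Definition digamma_seq (x : R) (m : nat) : R :=
  ln (x + m%:R) - \sum_(i < m) (x + i%:R)^-1.

(** Subtracting 1/(x + m) turns this decreasing sequence into an increasing one with the same limit;
    both monotonicities come from ln(1 + z) <= z. *)
Lemma digamma_seq_bounds x : 0 < x -> cvgn (digamma_seq x) /\
  forall m, limn (digamma_seq x) <= digamma_seq x m <= limn (digamma_seq x) + (x + m%:R)^-1.
Proof.
move=> x0; have xi i : 0 < x + i%:R by rewrite ltr_wpDr.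
pose l m := digamma_seq x m - (x + m%:R)^-1.
have r m : (x + m.+1%:R) / (x + m%:R) = 1 + (x + m%:R)^-1.
  by rewrite -natr1 addrA mulrDl mul1r divff// gt_eqF.
have u_dec : nonincreasing_seq (digamma_seq x).
  apply/nonincreasing_seqP => m; rewrite /digamma_seq big_ord_recr/=.
  have : ln ((x + m.+1%:R) / (x + m%:R)) <= (x + m%:R)^-1.
    by rewrite r le_ln1Dx// (@lt_le_trans _ _ 0)// invr_ge0 ltW.
  rewrite ln_div ?posrE//; lra.
have l_inc : nondecreasing_seq l.
  apply/nondecreasing_seqP => m; rewrite /l /digamma_seq big_ord_recr/=.
  have : ln ((x + m%:R) / (x + m.+1%:R)) <= - (x + m.+1%:R)^-1.
    rewrite (_ : _ / _ = 1 + (- (x + m.+1%:R)^-1)); last first.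
      by rewrite -natr1; have ? := xi m; field; lra.
    by rewrite le_ln1Dx// ltrN2 invf_lt1// -natr1; have := xi m; lra.
  rewrite ln_div ?posrE//; lra.
have [] // := adjacent_seq l_inc u_dec.
  rewrite (_ : _ - _ = (fun m => (x + m%:R)^-1)); last first.
    by apply/funext => m; rewrite !fctE /l opprB addrC subrK.
  apply: (@squeeze_cvgr _ _ _ _ (cst 0) (fun m => m%:R^-1)).
  - exists 1%N => //= m /= m0; rewrite invr_ge0 ltW//= lef_pV2 ?posrE ?ltr0n// lerDr ltW//.
  - exact: cvg_cst.
  - exact: cvg_invn.
move=> E cl cu; split => // m; rewrite nonincreasing_cvgn_ge//= -lerBlDr E.
exact: (nondecreasing_cvgn_le l_inc cl m).
Qed.

Lemma sum_inv_sqr_le x m : 0 < x ->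
  \sum_(i < m) (x + i%:R) ^- 2 <= x ^- 2 + x^-1.
Proof.
move=> x0; case: m => [|m].
  by rewrite big_ord0 addr_ge0 ?invr_ge0 ?exprn_ge0// ltW.
suff : \sum_(i < m.+1) (x + i%:R) ^- 2 <= x ^- 2 + x^-1 - (x + m%:R)^-1.
  by move=> /le_trans; apply; rewrite gerBl invr_ge0 addr_ge0// ltW.
elim: m => [|m ih]; first by rewrite big_ord1 !addr0 addrK.
rewrite big_ord_recr/=; apply: le_trans (lerD ih (lexx _)) _.
rewrite -addrA lerD2l -natr1 addrA.
have : 0 < x + m%:R by rewrite ltr_wpDr.
move: (x + m%:R) => z z0.
rewrite -subr_ge0 (_ : _ - _ = (z * (z + 1) ^+ 2)^-1).
  by rewrite invr_ge0 mulr_ge0 ?exprn_ge0 ?ltW// ltr_wpDr.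
by field; lra.
Qed.

Lemma le_archimedean (a b c : R) : 0 <= c -> (forall m : nat, a <= b + c / m.+1%:R) -> a <= b.
Proof.
move=> c0 H; apply/ler_addgt0Pr => e e0.
apply: le_trans (H (Num.truncn (c / e))) _; rewrite lerD2l.
by rewrite ler_pdivrMr// mulrC -ler_pdivrMr// ltW// truncnS_gt.
Qed.

Lemma ln1D_ge x : 0 <= x -> x - x ^+ 2 <= ln (1 + x).
Proof.
move=> x0; have x1 : 0 < 1 + x by rewrite ltr_wpDr.
have : ln (1 + x)^-1 <= (1 + x)^-1 - 1.
  rewrite -[X in ln X](_ : 1 + ((1 + x)^-1 - 1) = _); last by rewrite addrC subrK.
  by apply: le_ln1Dx; rewrite ltrBDr addNr invr_gt0.
rewrite lnV ?posrE// => H.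
suff : x - x ^+ 2 <= 1 - (1 + x)^-1 by lra.
rewrite -subr_ge0 (_ : _ - _ = x ^+ 3 / (1 + x)).
  by rewrite divr_ge0 ?exprn_ge0// ltW.
by field; lra.
Qed.

Variable f : R -> R.
(** To be applied to f = ln Gamma. [f_le] is the form of convexity needed: the slope of f on
    [x, x + h] is at most its slope ln x on [x, x + 1]. *)
Hypothesis fS : forall x, 0 < x -> f (x + 1) = f x + ln x.
Hypothesis f_le : forall x h, 0 < x -> 0 <= h <= 1 -> f (x + h) <= f x + h * ln x.

Let fSn x m : 0 < x -> f (x + m%:R) = f x + \sum_(i < m) ln (x + i%:R).
Proof.
move=> x0; elim: m => [|m ih]; first by rewrite big_ord0 !addr0.
by rewrite big_ord_recr/= -natr1 addrA fS ?ltr_wpDr// ih addrA.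
Qed.

(** This is [f_le] for the complementary step from x + h to x + 1, combined with the recurrence. *)
Let f_ge x h : 0 < x -> 0 <= h <= 1 -> f x + h * ln x - h / x <= f (x + h).
Proof.
move=> x0 /andP[h0 h1].
have xh : 0 < x + h by rewrite ltr_wpDr.
have := @f_le (x + h) (1 - h) xh ltac:(lra).
rewrite (_ : x + h + (1 - h) = x + 1); last lra.
rewrite fS// => H.
have L : ln (x + h) <= ln x + h / x.
  rewrite -lerBlDl -ln_div ?posrE// mulrDl divff ?gt_eqF//.
  by rewrite le_ln1Dx// (@lt_le_trans _ _ 0)// divr_ge0// ltW.
have : (1 - h) * ln (x + h) <= (1 - h) * (ln x + h / x) by rewrite ler_wpM2l//; lra.
have : 0 <= h * (h / x) by rewrite mulr_ge0// divr_ge0// ltW.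
lra.
Qed.

(** The recurrence carries the increment of f to the far point x + m, where [f_le] and [f_ge] pin it
    to h ln(x + m) within h/(x + m). *)
Let diffE x h m : 0 < x -> 0 <= h -> f (x + h) - f x =
  f (x + m%:R + h) - f (x + m%:R) - \sum_(i < m) ln (1 + h / (x + i%:R)).
Proof.
move=> x0 h0; rewrite (addrAC x) !fSn ?ltr_wpDr//.
rewrite (_ : \sum_(i < m) ln (x + h + i%:R) =
  \sum_(i < m) ln (x + i%:R) + \sum_(i < m) ln (1 + h / (x + i%:R))); first lra.
rewrite -big_split/=; apply: eq_bigr => i _.
have xi : 0 < x + i%:R by rewrite ltr_wpDr.
rewrite -lnM ?posrE//; last by rewrite ltr_wpDr// divr_ge0// ltW.
congr ln; field; lra.
Qed.

Let psi x := limn (digamma_seq x).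
Let S x := x ^- 2 + x^-1.

Let S_ge0 x : 0 < x -> 0 <= S x.
Proof. by move=> x0; rewrite addr_ge0 ?invr_ge0 ?exprn_ge0// ltW. Qed.

Let inv_shift_le x m : 0 < x -> (x + m.+1%:R)^-1 <= m.+1%:R^-1.
Proof. by move=> x0; rewrite lef_pV2 ?posrE// ?addr_gt0// lerDr ltW. Qed.

(** Replacing ln(1 + h/(x + i)) by h/(x + i) costs at most h^2/(x + i)^2, and these errors sum to at
    most h^2 [S x]; then m tends to infinity. *)
Let right_bound x h : 0 < x -> 0 <= h <= 1 ->
  h * psi x <= f (x + h) - f x <= h * psi x + h ^+ 2 * S x.
Proof.
move=> x0 h01; have /andP[h0 h1] := h01.
have [_ B] := digamma_seq_bounds x0.
have xi i : 0 < x + i%:R by rewrite ltr_wpDr.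
apply/andP; split; apply: (@le_archimedean _ _ h) => // m.
- have /andP[B1 _] := B m.+1.
  rewrite (diffE m.+1)//; have := f_ge (xi m.+1) h01.
  have : \sum_(i < m.+1) ln (1 + h / (x + i%:R)) <= h * \sum_(i < m.+1) (x + i%:R)^-1.
    rewrite mulr_sumr ler_sum// => i _.
    by rewrite le_ln1Dx// (@lt_le_trans _ _ 0)// divr_ge0// ltW.
  have : h / (x + m.+1%:R) <= h / m.+1%:R by rewrite ler_wpM2l// inv_shift_le.
  have : h * psi x <= h * digamma_seq x m.+1 by rewrite ler_wpM2l.
  rewrite /digamma_seq; lra_inv.
- have /andP[_ B1] := B m.+1.
  rewrite (diffE m.+1)//; have := f_le (xi m.+1) h01.
  have : h * \sum_(i < m.+1) (x + i%:R)^-1 - h ^+ 2 * \sum_(i < m.+1) (x + i%:R) ^- 2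
     <= \sum_(i < m.+1) ln (1 + h / (x + i%:R)).
    rewrite !mulr_sumr -sumrB ler_sum// => i _.
    by rewrite -exprVn -exprMn ln1D_ge// divr_ge0// ltW.
  have : h / (x + m.+1%:R) <= h / m.+1%:R by rewrite ler_wpM2l// inv_shift_le.
  have : h ^+ 2 * \sum_(i < m.+1) (x + i%:R) ^- 2 <= h ^+ 2 * S x.
    by rewrite ler_wpM2l ?sqr_ge0// sum_inv_sqr_le.
  have : h * digamma_seq x m.+1 <= h * (psi x + (x + m.+1%:R)^-1) by rewrite ler_wpM2l.
  rewrite /digamma_seq; lra_inv.
Qed.

(** Mirror image of [right_bound], starting from x - h. The condition 2h <= x gives h/(x - h + i) <=
    h/(x + i) + 2 h^2/(x + i)^2. *)
Let left_bound x h : 0 < x -> 0 <= h <= 1 -> 2 * h <= x ->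
  h * psi x - 2 * h ^+ 2 * S x <= f x - f (x - h) <= h * psi x.
Proof.
move=> x0 h01 hx; have /andP[h0 h1] := h01.
have [_ B] := digamma_seq_bounds x0.
have xi i : 0 < x + i%:R by rewrite ltr_wpDr.
have y0 : 0 < x - h by lra.
have yi i : 0 < x - h + i%:R by rewrite ltr_wpDr.
have E m : f x - f (x - h) = f (x - h + m%:R + h) - f (x - h + m%:R)
  - \sum_(i < m) ln (1 + h / (x - h + i%:R)).
  by rewrite -diffE// subrK.
apply/andP; split.
- apply: (@le_archimedean _ _ (2 * h)); first by rewrite mulr_ge0.
  move=> m; have /andP[B1 _] := B m.+1.
  rewrite (E m.+1)//; have := f_ge (yi m.+1) h01.
  have : \sum_(i < m.+1) ln (1 + h / (x - h + i%:R)) <=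
      h * \sum_(i < m.+1) (x + i%:R)^-1 + 2 * h ^+ 2 * \sum_(i < m.+1) (x + i%:R) ^- 2.
    rewrite !mulr_sumr -big_split/= ler_sum// => i _.
    apply: (@le_trans _ _ (h / (x - h + i%:R))).
      by rewrite le_ln1Dx// (@lt_le_trans _ _ 0)// divr_ge0// ltW.
    have := yi i; have : 2 * h <= x + i%:R by rewrite (le_trans hx)// lerDl.
    rewrite [x - h + _]addrAC; move: (xi i); move: (x + i%:R) => z z0 hz zh.
    rewrite -subr_ge0 (_ : _ - _ = h ^+ 2 * (z - 2 * h) / (z ^+ 2 * (z - h))).
      by rewrite divr_ge0 ?mulr_ge0 ?sqr_ge0 ?subr_ge0// ltW// -subr_gt0.
    by field; lra.
  have : h / (x - h + m.+1%:R) <= h / m.+1%:R by rewrite ler_wpM2l// inv_shift_le.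
  have : 2 * h ^+ 2 * \sum_(i < m.+1) (x + i%:R) ^- 2 <= 2 * h ^+ 2 * S x.
    by rewrite ler_wpM2l ?mulr_ge0 ?sqr_ge0// sum_inv_sqr_le.
  have : h * psi x <= h * digamma_seq x m.+1 by rewrite ler_wpM2l.
  have L : ln (x + m.+1%:R) <= ln (x - h + m.+1%:R) + (x - h + m.+1%:R)^-1.
    rewrite -lerBlDl -ln_div ?posrE//.
    rewrite (_ : _ / _ = 1 + h / (x - h + m.+1%:R)); last first.
      by have ? := yi m.+1; field; lra.
    apply: le_trans (le_ln1Dx _) _; first by rewrite (@lt_le_trans _ _ 0)// divr_ge0// ltW.
    by rewrite ler_piMl// invr_ge0 ltW.
  have : h * ln (x + m.+1%:R) <= h * (ln (x - h + m.+1%:R) + (x - h + m.+1%:R)^-1).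
    by rewrite ler_wpM2l.
  rewrite /digamma_seq; lra_inv.
- apply: (@le_archimedean _ _ h) => // m; have /andP[_ B1] := B m.+1.
  rewrite (E m.+1)//; have := f_le (yi m.+1) h01.
  have : h * \sum_(i < m.+1) (x + i%:R)^-1 <= \sum_(i < m.+1) ln (1 + h / (x - h + i%:R)).
    rewrite mulr_sumr ler_sum// => i _.
    have : ln (1 + (- h / (x + i%:R))) <= - h / (x + i%:R).
      apply: le_ln1Dx; rewrite ltr_pdivlMr// mulN1r ltrN2.
      by have := yi i; lra.
    rewrite (_ : 1 + h / (x - h + i%:R) = (1 + - h / (x + i%:R))^-1); last first.
      have := yi i; have := xi i; rewrite [x - h + _]addrAC; move: (x + i%:R) => z z0 zh.
      by field; lra.
    rewrite lnV ?posrE; first lra.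
    have ? := xi i; rewrite mulNr subr_gt0 ltr_pdivrMr// mul1r.
    by have := yi i; lra.
  have : h / (x + m.+1%:R) <= h / m.+1%:R by rewrite ler_wpM2l// inv_shift_le.
  have : h * digamma_seq x m.+1 <= h * (psi x + (x + m.+1%:R)^-1) by rewrite ler_wpM2l.
  have : h * ln (x - h + m.+1%:R) <= h * ln (x + m.+1%:R).
    by rewrite ler_wpM2l// ler_ln ?posrE// lerD2r; lra.
  rewrite /digamma_seq; lra_inv.
Qed.

(* Bohr-Mollerup: recurrence and log-convexity force the Euler limit. *)
Lemma derive1_log_convex x : 0 < x -> derive1 f x = limn (digamma_seq x).
Proof.
move=> x0; rewrite -/(psi x); apply: cvg_lim => //.
apply/cvgrPdist_le => e e0 /=.
pose M := 2 * S x + 1.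
have M0 : 0 < M by rewrite /M; have := S_ge0 x0; lra.
exists (Num.min 1 (Num.min (x / 2) (e / M))) => /=.
  by rewrite !lt_min ltr01 !divr_gt0.
move=> h /=; rewrite sub0r normrN !lt_min => /and3P[h1 hx he] hn0.
have {}he : `|h| * M <= e by rewrite -ler_pdivlMr// ltW.
have nh0 : 0 < `|h| by rewrite normr_gt0.
have S0 := S_ge0 x0.
suff H : `|h * psi x - (f (h + x) - f x)| <= `|h| * e.
  rewrite -(ler_pM2l nh0) -normrM mulrBr /GRing.scale/= mulrA divff// mul1r.
  exact: H.
apply: (@le_trans _ _ (2 * `|h| ^+ 2 * S x)); last first.
  rewrite -mulrA mulrC expr2 -!mulrA ler_wpM2l//.
  apply: le_trans he; rewrite ler_wpM2l// /M mulrC; lra.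
have [hp|hneg] := ltrP 0 h.
- rewrite (gtr0_norm hp) in h1 *.
  have /andP := @right_bound x h x0 ltac:(lra).
  have : 0 <= h ^+ 2 * S x by rewrite mulr_ge0 ?sqr_ge0.
  rewrite (addrC h) ler_norml; lra.
- have {}hneg : h < 0 by rewrite lt_neqAle hneg andbT.
  rewrite (ltr0_norm hneg) in h1 hx *.
  have /andP := @left_bound x (- h) x0 ltac:(lra) ltac:(lra).
  have : 0 <= h ^+ 2 * S x by rewrite mulr_ge0 ?sqr_ge0.
  rewrite opprK sqrrN (addrC h) ler_norml; lra.
Qed.

End log_convex_recurrence.

(** * Gamma and digamma *)

Section gamma_function.
Context {R : realType}.
Implicit Types x h t : R.
Local Notation mu := (@lebesgue_measure R).

Let g x t : R := t `^ (x - 1) * expR (- t).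

Let g_ge0 x t : 0 <= g x t.
Proof. by rewrite mulr_ge0 ?powR_ge0 ?expR_ge0. Qed.

Let measurable_g x (D : set R) : measurable D -> measurable_fun D (EFin \o g x).
Proof.
move=> mD; apply/measurable_EFinP; apply: (measurable_funS measurableT) => //.
apply: measurable_funM; first exact: measurable_powR.
by apply: measurableT_comp => //; exact: measurable_funN.
Qed.

Let I x : \bar R := (\int[mu]_(t in `]0%R, +oo[) (g x t)%:E)%E.

Let is_derive_powR x t : 0 < t -> is_derive t 1 (fun t => t `^ x) (x * t `^ (x - 1)).
Proof. exact: is_derive1_powR. Qed.

Let is_derive_expRN t : is_derive t 1 (fun t => - expR (- t)) (expR (- t)).
Proof.
have D : is_derive t 1 (fun t => expR (- t)) (expR (- t) * -1).
  by apply: (@is_derive1_comp _ expR -%R).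
have := is_deriveN D; rewrite mulrN1 opprK; exact.
Qed.

Let continuous_powR x t : 0 < t -> {for t, continuous (fun t => t `^ x)}.
Proof.
move=> t0; have [D _] := @is_derive_powR x _ t0.
by apply/differentiable_continuous/derivable1_diffP.
Qed.

Let continuous_expRN : continuous (fun t => expR (- t)).
Proof. by move=> t; apply: continuous_comp; [exact: continuousN|exact: continuous_expR]. Qed.

Let integrable_g x (a b : R) : 0 < a -> mu.-integrable `[a, b] (EFin \o g x).
Proof.
move=> a0; apply: continuous_compact_integrable; first exact: segment_compact.
apply: continuous_in_subspaceT => t; rewrite inE/= in_itv/= => /andP[at_ _].
apply: cvgM; first by apply: continuous_powR; rewrite (lt_le_trans a0).
exact: continuous_expRN.
Qed.

Let F x t : R := t `^ x * expR (- t).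

Let g_by_parts x (a b : R) : 0 < a -> a < b ->
  x * (\int[mu]_(t in `[a, b]) g x t)%R =
  (\int[mu]_(t in `[a, b]) g (x + 1) t)%R + (F x b - F x a).
Proof.
move=> a0 ab.
have mab : measurable (`[a, b]%classic : set R) by [].
have D t : t \in `]a, b[ -> 0 < t by rewrite in_itv/= => /andP[at_ _]; rewrite (lt_trans a0).
have := @Rintegration_by_parts R (fun t => t `^ x) (fun t => - expR (- t))
  (fun t => x * t `^ (x - 1)) (fun t => expR (- t)) a b ab.
have -> : (\int[mu]_(t in `[a, b]) (t `^ x * expR (- t)))%R =
          (\int[mu]_(t in `[a, b]) g (x + 1) t)%R.
  by apply: eq_Rintegral => t _; rewrite /g addrK.
have -> : (\int[mu]_(t in `[a, b]) (x * t `^ (x - 1) * - expR (- t)))%R =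
          - x * (\int[mu]_(t in `[a, b]) g x t)%R.
  rewrite -RintegralZl//; last exact: integrable_g.
  by apply: eq_Rintegral => t _; rewrite /g; ring.
move=> ->; first by rewrite /F; ring.
- apply: continuous_in_subspaceT => t; rewrite inE/= in_itv/= => /andP[at_ _].
  apply: cvgM; first exact: cvg_cst.
  by apply: continuous_powR; rewrite (lt_le_trans a0).
- split.
  + by move=> t /D t0; have [] := @is_derive_powR x _ t0.
  + by apply: cvg_at_right_filter; apply: continuous_powR.
  + by apply: cvg_at_left_filter; apply: continuous_powR; exact: lt_trans ab.
- by move=> t /D t0; rewrite derive1E; have [_ ->] := @is_derive_powR x _ t0.
- exact/continuous_subspaceT/continuous_expRN.
- split.
  + by move=> t _; have [] := is_derive_expRN t.
  + by apply: cvg_at_right_filter; apply: cvgN; exact: continuous_expRN.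
  + by apply: cvg_at_left_filter; apply: cvgN; exact: continuous_expRN.
- by move=> t _; rewrite derive1E; have [_ ->] := is_derive_expRN t.
Qed.

(** Compact intervals exhausting the half-line: integration by parts holds on each, and the boundary
    terms vanish in the limit. *)
Let A n : set R := `[n.+2%:R^-1, n.+2%:R]%classic.

Let A_bigcup : \bigcup_n A n = `]0, +oo[%classic.
Proof.
apply/seteqP; split => t /=.
  move=> [n _]; rewrite /A/= !in_itv/= andbT => /andP[nt _].
  by rewrite (lt_le_trans _ nt)// invr_gt0.
rewrite in_itv/= andbT => t0.
pose n := maxn (Num.truncn t) (Num.truncn t^-1).
have tn (y : R) : 0 < y -> (Num.truncn y <= n)%N -> y <= n.+2%:R.
  move=> y0 yn; apply: (le_trans (ltW (truncnS_gt y))); rewrite ler_nat.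
  by rewrite ltnS (leq_trans yn).
exists n => //; rewrite /A/= in_itv/= tn ?leq_maxl// andbT.
by rewrite -[t in leRHS]invrK lef_pV2 ?posrE ?invr_gt0// tn ?invr_gt0 ?leq_maxr.
Qed.

Let A_nd : nondecreasing_seq A.
Proof.
apply/nondecreasing_seqP => n; apply/subsetPset => t; rewrite /A/= !in_itv/=.
move=> /andP[a b]; rewrite (le_trans b) ?ler_nat// andbT (le_trans _ a)//.
by rewrite lef_pV2 ?posrE// ler_nat.
Qed.

Let cvg_I x : (\int[mu]_(t in A n) (g x t)%:E)%E @[n --> \oo] --> I x.
Proof.
rewrite /I -A_bigcup; apply: ge0_nondecreasing_set_cvg_integral => //.
- by move=> n; exact: measurable_itv.
- by move=> n; apply: (@measurable_g x (A n)); exact: measurable_itv.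
- by move=> n t _; rewrite lee_fin.
Qed.

Let powR_le_expR x : 0 <= x -> exists2 C : R, 0 <= C & forall t, 0 < t -> t `^ x <= C * expR (t / 2).
Proof.
move=> x0; pose N := (Num.truncn x).+1.
have xN : x <= N%:R by rewrite ltW// truncnS_gt.
exists (1 + 2 ^+ N * N`!%:R) => [|t t0]; first by rewrite addr_ge0// mulr_ge0.
have e0 := expR_ge0 (t / 2).
have [t1|t1] := leP t 1.
  apply: (@le_trans _ _ 1).
    have E1 : (1 : R) `^ x = 1 by rewrite powR1.
    by rewrite -[leRHS]E1 ge0_ler_powR// ?nnegrE// ltW.
  rewrite -[leLHS]mulr1 ler_pM// ?lerDl ?mulr_ge0//.
  by rewrite -expR0 ler_expR divr_ge0// ltW.
apply: (@le_trans _ _ (t ^+ N)).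
  by rewrite -powR_mulrn ?(ltW t0)// ler_powR// ltW.
have := @expR_ge1Dxn R (t / 2) (Num.truncn x) ltac:(by rewrite divr_ge0 // ltW).
rewrite -/N => H.
have {}H : (t / 2) ^+ N <= N`!%:R * expR (t / 2).
  rewrite -ler_pdivrMl// mulrC; apply: le_trans H; by rewrite lerDr.
rewrite mulrDl mul1r ler_wpDl// -mulrA -ler_pdivrMl// ?exprn_gt0//.
by rewrite mulrC -expr_div_n.
Qed.

Let cvg_F0 x : 0 < x -> F x n.+2%:R^-1 @[n --> \oo] --> (0 : R).
Proof.
move=> x0; apply: (@squeeze_cvgr _ _ _ _ (cst 0) (fun n => n.+2%:R^-1 `^ x)).
- near=> n; rewrite /= /F mulr_ge0 ?powR_ge0 ?expR_ge0//=.
  rewrite ler_piMr ?powR_ge0// -expR0 ler_expR oppr_le0 invr_ge0//.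
- exact: cvg_cst.
- have /cvg_at_rightP := powR_cvg0 x0; apply; split => //.
  by have := @cvg_invSn R; rewrite -(cvg_shiftS _ (nbhs (0 : R))).
Unshelve. all: by end_near. Qed.

Let cvg_Foo x : 0 < x -> F x n.+2%:R @[n --> \oo] --> (0 : R).
Proof.
move=> /ltW /powR_le_expR[C C0 HC].
apply: (@squeeze_cvgr _ _ _ _ (cst 0) (fun n => 2 * C * n.+2%:R^-1)).
- near=> n; rewrite /= /F mulr_ge0 ?powR_ge0 ?expR_ge0//=.
  apply: (@le_trans _ _ (C * expR (n.+2%:R / 2) * expR (- n.+2%:R))).
    by rewrite ler_wpM2r ?expR_ge0// HC.
  rewrite -mulrA -expRD (_ : _ + _ = - (n.+2%:R / 2)); last lra.
  rewrite expRN (_ : 2 * C / _ = C * (n.+2%:R / 2)^-1); last by rewrite invf_div; ring.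
  rewrite ler_wpM2l//.
  rewrite lef_pV2 ?posrE ?expR_gt0 ?divr_gt0//.
  by apply: le_trans (expR_ge1Dx _); rewrite lerDr.
- exact: cvg_cst.
- rewrite -[X in _ --> X](mulr0 (2 * C)); apply: cvgM; first exact: cvg_cst.
  by have := @cvg_invSn R; rewrite -(cvg_shiftS _ (nbhs (0 : R))).
Unshelve. all: by end_near. Qed.

Let IS x : 0 < x -> (x%:E * I x = I (x + 1))%E.
Proof.
move=> x0.
have H1 : (x%:E * \int[mu]_(t in A n) (g x t)%:E)%E @[n --> \oo] --> (x%:E * I x)%E.
  by apply: cvgeZl => //; exact: cvg_I.
have H2 : (\int[mu]_(t in A n) (g (x + 1) t)%:E + (F x n.+2%:R - F x n.+2%:R^-1)%:E)%E
    @[n --> \oo] --> (I (x + 1) + 0%:E)%E.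
  apply: cvgeD; [exact: fin_num_adde_defl|exact: cvg_I|].
  apply: cvg_EFin; first by apply: nearW.
  rewrite -[X in _ --> X](subr0 (0 : R)).
  by apply: cvgB; [exact: cvg_Foo|exact: cvg_F0].
rewrite adde0 in H2; rewrite -(cvg_lim _ H1)// -(cvg_lim _ H2)//.
congr (limn _); apply/funext => n.
have a0 : 0 < n.+2%:R^-1 :> R by rewrite invr_gt0.
have fE y : (\int[mu]_(t in A n) (g y t)%:E = (\int[mu]_(t in A n) g y t)%R%:E)%E.
  by rewrite /Rintegral fineK//; apply: integrable_fin_num; [exact: measurable_itv|exact: (@integrable_g y _ _ a0)].
rewrite !fE -EFinM -EFinD g_by_parts//.
by rewrite (@lt_le_trans _ _ 1) ?ler1n// invf_lt1 ?ltr1n.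
Qed.

(** Half of the decay of exp(-t) absorbs the power, so a multiple of the exponential density of rate
    1/2 dominates the integrand. *)
Let I_lty1 x : 1 <= x -> (I x < +oo)%E.
Proof.
move=> x1; have [C C0 HC] := @powR_le_expR (x - 1) ltac:(lra).
have : (\int[mu]_(t in `]0%R, +oo[) ((2 * C)%:E * (exponential_pdf 2^-1 t)%:E) < +oo)%E.
  rewrite ge0_integralZl//=; last first.
  - by rewrite lee_fin mulr_ge0.
  - by move=> t _; rewrite lee_fin exponential_pdf_ge0.
  - apply/measurable_EFinP; apply: (measurable_funS measurableT) => //.
    exact: measurable_exponential_pdf.
  rewrite lte_mul_pinfty ?lee_fin ?mulr_ge0//.
  apply: (@le_lt_trans _ _ (\int[mu]_t (exponential_pdf (2^-1 : R) t)%:E)%E).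
    apply: ge0_subset_integral => //.
    - by apply/measurable_EFinP; exact: measurable_exponential_pdf.
    - by move=> t _; rewrite lee_fin exponential_pdf_ge0.
  by rewrite integral_exponential_pdf// ltry.
apply: le_lt_trans; apply: ge0_le_integral => //.
- by move=> t _; rewrite lee_fin.
- exact: measurable_g.
- apply/measurable_EFinP; apply: measurable_funM => //.
  apply: (measurable_funS measurableT) => //.
  exact: measurable_exponential_pdf.
- move=> t; rewrite /= in_itv/= andbT => t0.
  rewrite -EFinM lee_fin exponential_pdfE ?(ltW t0)// /g.
  apply: (@le_trans _ _ (C * expR (t / 2) * expR (- t))).
    by rewrite ler_wpM2r ?expR_ge0// HC.
  rewrite -mulrA -expRD (_ : t / 2 + - t = - 2^-1 * t); last lra.
  by rewrite (_ : 2 * C * _ = C * expR (- 2^-1 * t))//; field.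
Qed.

Let I_gt01 x : 1 <= x -> (0 < I x)%E.
Proof.
move=> x1.
apply: (@lt_le_trans _ _ (\int[mu]_(t in `]1%R, 2%R[) (expR (- 2))%:E)%E).
  rewrite integral_cst//= lebesgue_measure_itv/= lte_fin ltr1n -EFinB -EFinM lte_fin.
  by rewrite mulr_gt0 ?expR_gt0//; lra.
apply: (@le_trans _ _ (\int[mu]_(t in `]1%R, 2%R[) (g x t)%:E)%E).
  apply: ge0_le_integral => //.
  - exact: measurable_g.
  - move=> t; rewrite /= in_itv/= => /andP[t1 t2].
    rewrite lee_fin /g -[leLHS]mul1r ler_pM// ?expR_ge0//.
      have x10 : 0 <= x - 1 by lra.
      by have := ler_powR (ltW t1) x10; rewrite powRr0.
    by rewrite ler_expR lerN2 ltW.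
apply: ge0_subset_integral => //.
- exact: measurable_g.
- by move=> t _; rewrite lee_fin.
- by move=> t /=; rewrite !in_itv/= andbT => /andP[t1 _]; rewrite (lt_trans _ t1).
Qed.

(** The recurrence transfers finiteness and positivity from x + 1, where they are known, to x, which
    may be below 1. *)
Let I_fin x : 0 < x -> (0 < I x < +oo)%E.
Proof.
move=> x0; have x1 : 1 <= x + 1 by lra.
have E := IS x0; have := I_gt01 x1; have := I_lty1 x1; rewrite -E.
case: (I x) => [r| |].
- by rewrite -EFinM !lte_fin => _; rewrite pmulr_rgt0// => ->; rewrite ltry.
- by rewrite gt0_muley.
- by rewrite gt0_muleNy.
Qed.

Lemma Gamma_gt0 x : 0 < x -> 0 < Gamma x.
Proof. by move=> /I_fin; exact: fine_gt0. Qed.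

Let GammaE x : 0 < x -> (Gamma x)%:E = I x.
Proof. by move=> /I_fin /andP[I0 Ioo]; rewrite fineK// ge0_fin_numE ?ltW. Qed.

Lemma GammaS x : 0 < x -> Gamma (x + 1) = x * Gamma x.
Proof.
by move=> x0; apply: EFin_inj; rewrite EFinM !GammaE ?IS// addr_gt0.
Qed.

(** Weighted arithmetic-geometric inequality for 1 and t, from the tangents of exp at the point h ln
    t. *)
Let bernoulli_powR h t : 0 <= h <= 1 -> 0 < t -> t `^ h <= 1 - h + h * t.
Proof.
move=> /andP[h0 h1] t0; pose v := ln t.
have -> : t = expR v by rewrite /v lnK// posrE.
rewrite -expRM; pose w := expR (v * h).
have w0 : 0 < w by exact: expR_gt0.
have H1 : w * (1 - v * h) <= 1.
  by rewrite -[leRHS](expRxMexpNx_1 (v * h)) ler_wpM2l ?(ltW w0)// expR_ge1Dx.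
have H2 : w * (1 + v * (1 - h)) <= expR v.
  rewrite (_ : v = v * h + v * (1 - h)); last lra.
  rewrite expRD; rewrite (_ : v * h + v * (1 - h) = v); last lra.
  by rewrite ler_wpM2l ?(ltW w0)// expR_ge1Dx.
have : (1 - h) * (w * (1 - v * h)) <= (1 - h) * 1 by rewrite ler_wpM2l//; lra.
have : h * (w * (1 + v * (1 - h))) <= h * expR v by rewrite ler_wpM2l.
rewrite -/w; lra.
Qed.

(** Integrating (t/x)^h <= 1 - h + h t/x against t^(x-1) exp(-t) bounds Gamma(x + h) by x^h ((1 - h)
    Gamma(x) + (h/x) Gamma(x + 1)), which is x^h Gamma(x). *)
Lemma Gamma_le x h : 0 < x -> 0 <= h <= 1 -> Gamma (x + h) <= x `^ h * Gamma x.
Proof.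
move=> x0 h01; have /andP[h0 h1] := h01.
have xh : 0 < x + h by lra.
have x10 : 0 < x + 1 by lra.
suff H : Gamma (x + h) <= x `^ h * (1 - h) * Gamma x + x `^ h * h / x * Gamma (x + 1).
  apply: le_trans H _; rewrite GammaS// -subr_ge0 (_ : _ - _ = 0)//; field; lra.
rewrite -lee_fin EFinD !EFinM !GammaE// -!EFinM /I.
have p0 := powR_ge0 x h.
have c1 : 0 <= x `^ h * (1 - h) by rewrite mulr_ge0//; lra.
have c2 : 0 <= x `^ h * h / x by rewrite divr_ge0 ?mulr_ge0// ltW.
have Z y c : 0 <= c -> (c%:E * \int[mu]_(t in `]0%R, +oo[) (g y t)%:E =
    \int[mu]_(t in `]0%R, +oo[) (c%:E * (g y t)%:E))%E.
  move=> c0; apply/esym/ge0_integralZl => //; first exact: measurable_g.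
  by move=> t _; rewrite lee_fin.
rewrite !Z//.
rewrite -ge0_integralD//; last 4 first.
- by move=> t _; rewrite -EFinM lee_fin mulr_ge0.
- by apply: measurable_funeM; exact: measurable_g.
- by move=> t _; rewrite -EFinM lee_fin mulr_ge0.
- by apply: measurable_funeM; exact: measurable_g.
apply: ge0_le_integral => //.
- by move=> t _; rewrite lee_fin.
- exact: measurable_g.
- apply: emeasurable_funD; by apply: measurable_funeM; exact: measurable_g.
move=> t /=; rewrite in_itv/= andbT => t0.
rewrite -!EFinM -EFinD lee_fin /g.
have tn0 : t != 0 by rewrite gt_eqF.
rewrite (_ : x + h - 1 = (x - 1) + h); last lra.
rewrite (_ : x + 1 - 1 = (x - 1) + 1); last lra.
rewrite (@powRD _ t (x - 1) h) ?tn0 ?implybT// (@powRD _ t (x - 1) 1) ?tn0 ?implybT//.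
rewrite powRr1 ?(ltW t0)//.
have tx : 0 < t / x by rewrite divr_gt0.
have := @bernoulli_powR h (t / x) h01 tx.
rewrite powRM ?(ltW t0) ?invr_ge0 ?(ltW x0)// => H.
have {}H : t `^ h <= x `^ h * (1 - h + h * (t / x)).
  apply: le_trans (_ : x `^ h * (t `^ h * x^-1 `^ h) <= _); last by rewrite ler_wpM2l.
  by rewrite mulrCA -powRM ?invr_ge0 ?(ltW x0)// divff ?(gt_eqF x0)// powR1 mulr1.
have : t `^ (x - 1) * expR (- t) * t `^ h <=
       t `^ (x - 1) * expR (- t) * (x `^ h * (1 - h + h * (t / x))).
  by apply: ler_wpM2l => //; rewrite mulr_ge0 ?powR_ge0 ?expR_ge0.
lra.
Qed.

Lemma cvg_digamma_seq x : 0 < x -> digamma_seq x m @[m --> \oo] --> digamma x.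
Proof.
move=> x0; have [c _] := digamma_seq_bounds x0.
rewrite /digamma (@derive1_log_convex _ (fun y => ln (Gamma y)))//.
- move=> y y0; rewrite GammaS// lnM ?posrE ?Gamma_gt0// addrC//.
- move=> y h y0 h01; have /andP[h0 h1] := h01.
  have yh : 0 < y + h by lra.
  rewrite -ln_powR addrC -lnM ?posrE ?Gamma_gt0 ?powR_gt0//.
  rewrite ?(addrC h) [in leRHS]mulrC.
  by rewrite ler_ln ?posrE ?mulr_gt0 ?powR_gt0 ?Gamma_gt0 ?Gamma_le.
Qed.


End gamma_function.

(** * Recurrence and special values of digamma; the constant for d = 2 *)

Section digamma_values.
Context {R : realType}.
Implicit Types x : R.

Let digamma_seqS x m : digamma_seq (x + 1) m = digamma_seq x m.+1 + x^-1.
Proof.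
rewrite /digamma_seq big_ord_recl/= addr0 -(natr1 m) (addrC m%:R) addrA.
under eq_bigr => i _ do rewrite -addrA (addrC 1) natr1.
by rewrite opprD addrA addrAC subrK.
Qed.

Lemma digammaS x : 0 < x -> digamma (x + 1) = digamma x + x^-1.
Proof.
move=> x0; have c1 : 0 < x + 1 by lra.
apply: (cvg_unique _ (cvg_digamma_seq c1)) => //.
rewrite (funext (digamma_seqS x)); apply: cvgD; last exact: cvg_cst.
by have := cvg_digamma_seq x0; rewrite -(cvg_shiftS _ (nbhs (digamma x : R))).
Qed.

Lemma digamma1 : digamma (1 : R) = - euler_gamma R.
Proof.
apply: (cvg_unique _ (cvg_digamma_seq ltr01)) => //.
have H : (- (harmonic_sum m.+1 - ln m.+1%:R) + m.+1%:R^-1) @[m --> \oo] --> - euler_gamma R + 0.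
  apply: cvgD; last exact: cvg_invSn.
  apply: cvgN; have := @cvg_harmonic_ln R.
  by rewrite -(cvg_shiftS _ (nbhs (euler_gamma R : R))).
rewrite addr0 in H; rewrite (_ : digamma_seq 1 = (fun m => - (harmonic_sum m.+1 - ln m.+1%:R) + m.+1%:R^-1))//.
apply/funext => m; rewrite /digamma_seq harmonic_sumS /harmonic_sum big_add1/= big_mkord.
under eq_bigr => i _ do rewrite addrC natr1.
rewrite (addrC 1) natr1; ring.
Qed.

Let sum_odd_inv m : \sum_(i < m) (2^-1 + i%:R : R)^-1 = 2 * harmonic_sum (2 * m) - harmonic_sum m.
Proof.
elim: m => [|m ih]; first by rewrite big_ord0 muln0 !harmonic_sum0; ring.
rewrite big_ord_recr/= ih (_ : (2 * m.+1 = (2 * m).+2)%N); last by rewrite mulnS.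
rewrite (harmonic_sumS (2 * m).+1) (harmonic_sumS (2 * m)) (harmonic_sumS m).
have a : (2 * m).+1%:R != 0 :> R by [].
have b : m.+1%:R != 0 :> R by [].
rewrite (_ : (2 * m).+2%:R = 2 * m.+1%:R); last by rewrite -natrM mulnS.
rewrite (_ : 2^-1 + m%:R = (2 * m).+1%:R / 2); last by rewrite -(natr1 (2 * m)) natrM; lra.
by move: ((2 * m).+1%:R) (m.+1%:R) a b => p q a b; field; rewrite a b.
Qed.

Lemma cvg_mul2n (u : nat -> R) (l : R) : u @ \oo --> l -> u (2 * n)%N @[n --> \oo] --> l.
Proof.
move=> /cvgrPdist_le ul; apply/cvgrPdist_le => e /ul[N _ HN]; exists N => // n /= Nn.
by apply: HN => /=; rewrite (leq_trans Nn)// leq_pmull.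
Qed.

(** The sum of 1/(i + 1/2) is twice a sum of reciprocals of odd numbers, hence 2 H(2m) - H(m); the
    factor 2 in front of H(2m) produces 2 ln 2. *)
Lemma digamma_half : digamma (2^-1 : R) = - euler_gamma R - 2 * ln 2.
Proof.
have h0 : 0 < 2^-1 :> R by [].
apply: (cvg_unique _ (cvg_digamma_seq h0)) => //.
have H1 := @cvg_harmonic_ln R.
have H2 := cvg_mul2n H1.
have E : \forall m \near \oo, (ln (2^-1 + m%:R) - ln m%:R) - 2 * (harmonic_sum (2 * m) - ln (2 * m)%:R)
   + (harmonic_sum m - ln m%:R) - 2 * ln 2 = digamma_seq (2^-1 : R) m.
  exists 1%N => // m /= m0.
  rewrite /digamma_seq sum_odd_inv natrM lnM ?posrE ?ltr0n//; ring.
apply: cvg_trans (near_eq_cvg E) _.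
rewrite (_ : - euler_gamma R - 2 * ln 2 = 0 - 2 * euler_gamma R + euler_gamma R - 2 * ln 2); last ring.
apply: cvgB; last exact: cvg_cst.
apply: cvgD => //; apply: cvgB; last by apply: cvgM => //; exact: cvg_cst.
apply: (@squeeze_cvgr _ _ _ _ (cst 0) (fun m => m%:R^-1)).
- exists 1%N => // m /= m0; have m0' : 0 < m%:R :> R by rewrite ltr0n.
  rewrite -ln_div ?posrE ?addr_gt0//.
  rewrite (_ : (2^-1 + m%:R) / m%:R = 1 + 2^-1 * m%:R^-1); last by field; rewrite gt_eqF.
  have i0 : 0 < m%:R^-1 :> R by rewrite invr_gt0.
  rewrite ln_ge0 ?lerDl ?mulr_ge0 ?(ltW i0)//=.
  apply: le_trans (le_ln1Dx _) _; lra.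
- exact: cvg_cst.
- exact: cvg_invn.
Qed.

Lemma harmonic_const2 : harmonic_const R 2 = 2^-1 + ln 2 - euler_gamma R.
Proof.
rewrite /harmonic_const (_ : 2 / 2`!%:R = 1); last by rewrite divff.
by rewrite ln1 mulr0 add0r digamma1; ring.
Qed.

Lemma harmonic_const2_approx :
  `| harmonic_const R 2 - (61 / 10 ^+ 2 + 59 / 10 ^+ 4) | < 2^-1 / 10 ^+ 4.
Proof.
have /andP[lo hi] := @ln2_sub_euler_gamma_bounds R.
rewrite harmonic_const2 ltr_norml; lra.
Qed.

End digamma_values.

(** * Gegenbauer polynomials *)

Section gegenbauer.
Context {R : realType}.
Variable d : nat.
Hypothesis d_gt0 : (0 < d)%N.
Implicit Types (j k m : nat) (p q : {poly R}).

Let d0 : 0 < d%:R :> R. Proof. by rewrite ltr0n. Qed.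

(* Ultraspherical polynomials normalized by their value 1 at 1. *)
Fixpoint gegen k : {poly R} :=
  match k with
  | 0 => 1
  | k'.+1 => match k' with
    | 0 => 'X
    | k''.+1 => ((2 * k''%:R + d%:R + 1) / (k''%:R + d%:R)) *: ('X * gegen k')
                - ((k''%:R + 1) / (k''%:R + d%:R)) *: gegen k''
    end
  end.

(** With [gegen_down], the coefficients of multiplication by t in the basis [gegen]. The value at 0
    is set apart because the general fraction (k + d - 1)/(2k + d - 1) reads 0/0 there when d =
    1. *)
Definition gegen_up k : R :=
  if k is k'.+1 then (k'%:R + d%:R) / (2 * k'%:R + d%:R + 1) else 1.
Definition gegen_down k : R :=
  if k is k'.+1 then (k'%:R + 1) / (2 * k'%:R + d%:R + 1) else 0.

(* Dimension of the space of spherical harmonics of degree k. *)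
Fixpoint harm_dim k : R :=
  if k is k'.+1 then harm_dim k' * (gegen_up k' / gegen_down k) else 1.

Lemma gegenSS k : gegen k.+2 =
  ((2 * k%:R + d%:R + 1) / (k%:R + d%:R)) *: ('X * gegen k.+1)
  - ((k%:R + 1) / (k%:R + d%:R)) *: gegen k.
Proof. by []. Qed.

Let den1 k : 0 < k%:R + d%:R :> R.
Proof. by rewrite ltr_wpDl. Qed.
Let den2 k : 0 < 2 * k%:R + d%:R + 1 :> R.
Proof. by rewrite ltr_wpDr// ltr_wpDl// mulr_ge0. Qed.

Lemma gegen_up_gt0 k : 0 < gegen_up k.
Proof. by case: k => [|k] //=; rewrite divr_gt0. Qed.

Lemma gegen_downS_gt0 k : 0 < gegen_down k.+1.
Proof. by rewrite /= divr_gt0// ltr_wpDl. Qed.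

Lemma mulX_gegen k : 'X * gegen k = gegen_up k *: gegen k.+1 + gegen_down k *: gegen k.-1.
Proof.
case: k => [|k]; first by rewrite /= scale1r scale0r addr0 mulr1.
rewrite gegenSS scalerBr !scalerA /= -addrA.
have a := gt_eqF (den1 k); have b := gt_eqF (den2 k).
rewrite [X in X *: ('X * _)](_ : _ = 1); last by field; rewrite a b.
rewrite scale1r [X in - (X *: _)](_ : _ = (k%:R + 1) / (2 * k%:R + d%:R + 1)); last by field; rewrite a b.
by rewrite addNr addr0.
Qed.

Lemma gegen_recurrence k : (k%:R + d%:R) * gegen k.+2 =
  (2 * k%:R + d%:R + 1) * ('X * gegen k.+1) - (k%:R + 1) * gegen k.
Proof.
have a := gt_eqF (den1 k).
have -> : k%:R + d%:R = (k%:R + d%:R)%:P :> {poly R} by rewrite polyCD !polyC_natr.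
have -> : 2 * k%:R + d%:R + 1 = (2 * k%:R + d%:R + 1)%:P :> {poly R}.
  by rewrite !polyCD polyCM !polyC_natr.
have -> : k%:R + 1 = (k%:R + 1)%:P :> {poly R} by rewrite polyCD !polyC_natr.
rewrite !mul_polyC gegenSS scalerBr !scalerA.
by congr (_ *: _ - _ *: _); field; rewrite a.
Qed.

Lemma horner_gegen k : (gegen k).[1] = 1.
Proof.
elim/ltn_ind: k => -[|[|k]] ih; [by rewrite hornerC|by rewrite hornerX|].
rewrite gegenSS hornerD hornerN !hornerZ hornerM hornerX !ih//.
by have a := gt_eqF (den1 k); field; rewrite a.
Qed.

Lemma size_gegen k : (size (gegen k) <= k.+1)%N.
Proof.
elim/ltn_ind: k => -[|[|k]] ih; rewrite ?size_poly1 ?size_polyX//.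
rewrite gegenSS (leq_trans (size_polyD _ _))// size_polyN geq_max.
rewrite !(leq_trans (size_scale_leq _ _))//.
  by rewrite (leq_trans (ih k _))// ltnW.
by rewrite (leq_trans (size_polyMleq _ _))// size_polyX add2n -pred_Sn ltnS ih.
Qed.

Definition gegen_spanned m q := exists a : nat -> R, q = \sum_(k < m.+1) a k *: gegen k.

Let spannedD m p q : gegen_spanned m p -> gegen_spanned m q -> gegen_spanned m (p + q).
Proof.
move=> [a ->] [b ->]; exists (fun k => a k + b k); rewrite -big_split/=.
by apply: eq_bigr => k _; rewrite scalerDl.
Qed.

Let spannedZ m c p : gegen_spanned m p -> gegen_spanned m (c *: p).
Proof.
move=> [a ->]; exists (fun k => c * a k); rewrite scaler_sumr.
by apply: eq_bigr => k _; rewrite scalerA.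
Qed.

Let spanned_gegen m k : (k <= m)%N -> gegen_spanned m (gegen k).
Proof.
move=> km; exists (fun i => (i == k)%:R); have km1 : (k < m.+1)%N by [].
rewrite (bigD1 (Ordinal km1))//= eqxx scale1r big1 ?addr0// => i ik.
by rewrite (_ : (i == k :> nat) = false) ?scale0r//; apply: contraNF ik => /eqP ik; exact/eqP/val_inj.
Qed.

Lemma size_gegen_spanned m q : (size q <= m.+1)%N -> gegen_spanned m q.
Proof.
have C m' c : gegen_spanned m' c%:P.
  by rewrite -[c%:P]alg_polyC; apply/spannedZ/(@spanned_gegen m' 0).
elim/poly_ind: q m => [|p c ih] m.
  by move=> _; rewrite -(scale0r (gegen 0)); exact/spannedZ/spanned_gegen.
rewrite size_MXaddC; have [->|p0] := eqVneq p 0; first by rewrite mul0r add0r.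
rewrite andFb; case: m => [|m] sp.
  by move: sp; rewrite ltnS leqn0 size_poly_eq0 (negPf p0).
have [a ->] := ih m sp; apply: spannedD => //; rewrite mulr_suml.
apply: (big_ind (gegen_spanned m.+1)) => [||k _].
- by rewrite -(scale0r (gegen 0)); exact/spannedZ/spanned_gegen.
- exact: spannedD.
- rewrite -scalerAl mulrC mulX_gegen; apply/spannedZ/spannedD/spannedZ/spanned_gegen.
    by apply/spannedZ/spanned_gegen; rewrite ltnS -ltnS.
  by rewrite (leq_trans (leq_pred _))// ltnW// ltnW// ltnS.
Qed.

(** The two relations are proved together: the second at k is the first at k + 1 up to the
    three-term recurrence, and differentiating that recurrence gives the next second one. *)
Lemma gegen_ladder k :
  (1 - 'X ^+ 2) * (gegen k)^`() = (k%:R + d%:R - 1) * ('X * gegen k - gegen k.+1) /\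
  (1 - 'X ^+ 2) * (gegen k.+1)^`() = (k%:R + 1) * (gegen k - 'X * gegen k.+1).
Proof.
elim: k => [|k [ih1 ih2]].
  by rewrite /= derivC derivX !mulr1 mulr0 subrr mulr0 expr2; split => //; ring.
have rec := gegen_recurrence k.
split.
  rewrite ih2.
  have -> : (k.+1%:R + d%:R - 1) * ('X * gegen k.+1 - gegen k.+2) =
    (k%:R + d%:R) * ('X * gegen k.+1) - (k%:R + d%:R) * gegen k.+2 by rewrite -natr1; ring.
  by rewrite rec; ring.
have nz : k%:R + d%:R != 0 :> {poly R}.
  by rewrite -natrD -polyC_natr polyC_eq0 natrD gt_eqF.
apply: (mulfI nz).
have drec : (k%:R + d%:R) * (gegen k.+2)^`() =
  (2 * k%:R + d%:R + 1) * (gegen k.+1 + 'X * (gegen k.+1)^`()) - (k%:R + 1) * (gegen k)^`().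
  have e (n : nat) (f : {poly R}) : (n%:R * f)^`() = n%:R * f^`().
    by rewrite derivM -polyC_natr derivC mul0r add0r.
  have E1 : 2 * k%:R + d%:R + 1 = (2 * k + d + 1)%:R :> {poly R} by rewrite natrD natrD natrM.
  have E2 : k%:R + 1 = (k + 1)%:R :> {poly R} by rewrite natrD.
  have E3 : k%:R + d%:R = (k + d)%:R :> {poly R} by rewrite natrD.
  move: (congr1 (@deriv R) rec); rewrite E1 E2 E3 derivB !e derivM derivX mul1r.
  exact.
rewrite mulrCA drec mulrBr mulrCA mulrDr (mulrCA _ 'X) ih2 (mulrCA (1 - _)) ih1.
have -> : (k%:R + d%:R) * ((k.+1%:R + 1) * (gegen k.+1 - 'X * gegen k.+2)) =
  (k.+1%:R + 1) * ((k%:R + d%:R) * gegen k.+1 - 'X * ((k%:R + d%:R) * gegen k.+2)) by ring.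
rewrite rec -natr1.
have -> : (k%:R + 1) * ((k%:R + d%:R - 1) * ('X * gegen k - gegen k.+1)) =
   (k%:R + d%:R - 1) * ((k%:R + 1) * ('X * gegen k - gegen k.+1)) by ring.
ring.
Qed.


(** The left-hand operator is the one in the integration by parts formulas, so applying a functional
    gives a two-step recurrence on its values at the [gegen]. *)
Lemma gegen_ode k :
  (2 * k%:R + d%:R + 1) * ((1 - 'X ^+ 2) * (gegen k.+1)^`() - d%:R * ('X * gegen k.+1)) =
  k%:R * (k%:R + 1) * gegen k - (k%:R + d%:R) * (k%:R + d%:R + 1) * gegen k.+2.
Proof.
have [_ ->] := gegen_ladder k.
have -> : k%:R * (k%:R + 1) * gegen k - (k%:R + d%:R) * (k%:R + d%:R + 1) * gegen k.+2 =
  k%:R * (k%:R + 1) * gegen k - (k%:R + d%:R + 1) * ((k%:R + d%:R) * gegen k.+2) by ring.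
by rewrite gegen_recurrence; ring.
Qed.

Definition kernel_poly n : {poly R} := \sum_(k < n.+1) harm_dim k *: gegen k.
Definition dim_sum n : R := \sum_(k < n.+1) harm_dim k.
(** By [Ll_gegen_lt], this is minus the logarithmic functional of p_n times the sum of h_k p_k over
    k < n. *)
Definition cross_sum n : R := (2 * n%:R + d%:R - 1) / harm_dim n *
  \sum_(k < n) harm_dim k / ((n%:R - k%:R) * (n%:R + k%:R + d%:R - 1)).

Lemma horner_kernel_poly n : (kernel_poly n).[1] = dim_sum n.
Proof.
rewrite /kernel_poly horner_sum; apply: eq_bigr => k _.
by rewrite hornerZ horner_gegen mulr1.
Qed.

Section functionals.
(* [L0 p] and [Ll p] stand for the integrals of [p t] and [p t * ln (1 - t)]  *)
(* over the sphere, [t] being the inner product with the pole.               *)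
Variables L0 Ll : {poly R} -> R.
Hypothesis L0_lin : forall a p q, L0 (a *: p + q) = a * L0 p + L0 q.
Hypothesis Ll_lin : forall a p q, Ll (a *: p + q) = a * Ll p + Ll q.
Hypothesis L0_1 : L0 1 = 1.
Hypothesis L0_parts : forall p, L0 ((1 - 'X ^+ 2) * p^`() - d%:R * ('X * p)) = 0.
Hypothesis Ll_parts : forall p,
  Ll ((1 - 'X ^+ 2) * p^`() - d%:R * ('X * p)) = L0 ((1 + 'X) * p).

Section linearity.
Variable L : {poly R} -> R.
Hypothesis L_lin : forall a p q, L (a *: p + q) = a * L p + L q.
Let functional0 : L 0 = 0.
Proof.
have := L_lin (-1) 0 0; rewrite scaler0 addr0 mulN1r addNr; exact. Qed.
Lemma functionalD p q : L (p + q) = L p + L q.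
Proof. by rewrite -{1}(scale1r p) L_lin mul1r. Qed.
Lemma functionalZ a p : L (a *: p) = a * L p.
Proof. by rewrite -[a *: p]addr0 L_lin functional0 addr0. Qed.
Lemma functionalB p q : L (p - q) = L p - L q.
Proof. by rewrite -scaleN1r functionalD functionalZ mulN1r. Qed.
Lemma functional_nat n p : L (n%:R * p) = n%:R * L p.
Proof. by rewrite mulr_natl -scaler_nat functionalZ. Qed.
Lemma functional_sum I (r : seq I) (P : pred I) (F : I -> {poly R}) :
  L (\sum_(i <- r | P i) F i) = \sum_(i <- r | P i) L (F i).
Proof. exact: (big_morph L functionalD functional0). Qed.
End linearity.

Let L0D := functionalD L0_lin. Let L0Z := functionalZ L0_lin.
Let L0B := functionalB L0_lin. Let L0n := functional_nat L0_lin.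
Let LlD := functionalD Ll_lin. Let LlZ := functionalZ Ll_lin.
Let LlB := functionalB Ll_lin. Let Lln := functional_nat Ll_lin.

Let ode_nat k :
  (2 * k + d + 1)%:R * ((1 - 'X ^+ 2) * (gegen k.+1)^`() - d%:R * ('X * gegen k.+1)) =
  (k * (k + 1))%:R * gegen k - ((k + d) * (k + d + 1))%:R * gegen k.+2 :> {poly R}.
Proof. by rewrite !(natrM, natrD) gegen_ode. Qed.

(** In the recurrence from [gegen_ode], the coefficient k (k + 1) vanishes at k = 0, so the value L0
    1 = 1 does not propagate to even degrees. *)
Lemma L0_gegen k : L0 (gegen k) = (k == 0)%:R.
Proof.
elim/ltn_ind: k => -[|[|k]] ih; first by rewrite L0_1.
  have := L0_parts 1; rewrite derivC mulr0 add0r mulr1.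
  rewrite -[- _]mulN1r -polyC1 -polyCN mul_polyC L0Z L0n mulN1r => /eqP.
  by rewrite oppr_eq0 mulf_eq0 (gt_eqF d0) /= => /eqP.
have := L0_parts (gegen k.+1) => /(congr1 ( *%R (2 * k + d + 1)%:R)).
rewrite -L0n ode_nat L0B !L0n mulr0 => /eqP; rewrite subr_eq0 (ih k)// => /eqP E.
have {}E : 0 = ((k + d) * (k + d + 1))%:R * L0 (gegen k.+2).
  by rewrite -E; case: (k) => [|k']; rewrite ?mul0n ?mul0r ?mulr0.
move/eqP: E; rewrite eq_sym mulf_eq0 pnatr_eq0 muln_eq0 !addn_eq0 andbF orbF.
by rewrite (gtn_eqF d_gt0) andbF /= => /eqP.
Qed.


Lemma Ll_gegen1 : Ll (gegen 1) = - d%:R^-1.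
Proof.
have := Ll_parts 1; rewrite derivC mulr0 add0r !mulr1.
rewrite -[- _]mulN1r -polyC1 -polyCN mul_polyC LlZ Lln mulN1r L0D L0_1.
have -> : L0 'X = 0 by exact: (L0_gegen 1).
rewrite addr0 => E; apply: (mulfI (lt0r_neq0 d0)).
rewrite mulrN divff ?(gt_eqF d0)//.
by move/eqP: E; rewrite eqr_oppLR => /eqP E; exact: E.
Qed.

(** The source L0((1 + t) p_(k+1)) only sees the p_0 component, present only when k = 0. *)
Lemma Ll_gegenSS k : (k%:R + d%:R) * (k%:R + d%:R + 1) * Ll (gegen k.+2) =
  k%:R * (k%:R + 1) * Ll (gegen k) - (k == 0)%:R.
Proof.
have := Ll_parts (gegen k.+1) => /(congr1 ( *%R (2 * k + d + 1)%:R)).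
rewrite -Lln ode_nat LlB !Lln.
have -> : (2 * k + d + 1)%:R * L0 ((1 + 'X) * gegen k.+1) = (k == 0)%:R.
  have den := gt_eqF (den2 k).
  rewrite mulrDl mul1r mulX_gegen L0D L0_gegen add0r L0D !L0Z !L0_gegen /= mulr0 add0r.
  case: (k) => [|k'] /=; last by rewrite !mulr0.
  have d1 : d%:R + 1 != 0 :> R by rewrite gt_eqF// ltr_wpDr.
  by rewrite muln0 add0n natrD; field; rewrite d1.
rewrite !(natrM, natrD) => <-; ring.
Qed.

(* Matrix coefficients are determined by their first column, multiplication *)
(* by 'X being symmetric.                                                   *)
Let symX (L : {poly R} -> R) (linL : forall a p q, L (a *: p + q) = a * L p + L q) j k :
  gegen_up k * L (gegen j * gegen k.+1) + gegen_down k * L (gegen j * gegen k.-1) =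
  gegen_up j * L (gegen j.+1 * gegen k) + gegen_down j * L (gegen j.-1 * gegen k).
Proof.
have : L (gegen j * ('X * gegen k)) = L (('X * gegen j) * gegen k) by congr L; ring.
by rewrite !mulX_gegen mulrDr mulrDl -!scalerAr -!scalerAl !(functionalD linL) !(functionalZ linL).
Qed.

Lemma harm_dim_gt0 k : 0 < harm_dim k.
Proof.
by elim: k => [|k ih] //=; rewrite mulr_gt0// divr_gt0// ?gegen_up_gt0// divr_gt0// ltr_wpDl.
Qed.

Let up_dim k : gegen_up k * harm_dim k = gegen_down k.+1 * harm_dim k.+1.
Proof. by rewrite [harm_dim k.+1]/= mulrCA [_ * (_ / _)]mulrC divfK ?gt_eqF// ?gegen_downS_gt0// mulrC. Qed.

Lemma L0_gegen_gt k m : L0 (gegen (k + m.+1) * gegen k) = 0.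
Proof.
elim/ltn_ind: k m => -[|k] ih m; first by rewrite mulr1 L0_gegen.
apply: (mulfI (lt0r_neq0 (gegen_up_gt0 k))).
have := symX L0_lin (k.+1 + m.+1) k => /eqP; rewrite eq_sym -subr_eq => /eqP <-.
rewrite mulr0 (_ : (k.+1 + m.+1).+1 = k + m.+3)%N; last by lia.
rewrite (_ : (k.+1 + m.+1).-1 = k + m.+1)%N; last by lia.
rewrite !ih// !mulr0 addr0 sub0r; case: k ih => [|k] ih; first by rewrite mul0r oppr0.
by rewrite [k.+1.-1]/= (_ : (k.+2 + m.+1) = k + m.+3)%N ?ih ?mulr0 ?oppr0//; lia.
Qed.

(** By orthogonality [symX] reduces to up_k L0(p_(k+1)^2) = down_(k+1) L0(p_k^2), the recurrence of
    1/[harm_dim]. *)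
Lemma L0_gegen_sqr k : L0 (gegen k * gegen k) = (harm_dim k)^-1.
Proof.
elim: k => [|k ih]; first by rewrite mulr1 L0_1 invr1.
apply: (mulfI (lt0r_neq0 (gegen_up_gt0 k))).
have := symX L0_lin k.+1 k => /eqP; rewrite eq_sym -subr_eq => /eqP <-.
rewrite [k.+1.-1]/= ih (_ : k.+2 = k + 2)%N; last by lia.
rewrite L0_gegen_gt mulr0 add0r.
have -> : gegen_down k * L0 (gegen k.+1 * gegen k.-1) = 0.
  by case: (k) => [|k']; rewrite ?mul0r// [k'.+1.-1]/= (_ : k'.+2 = k' + 2)%N ?L0_gegen_gt ?mulr0//; lia.
rewrite subr0; apply/eqP; rewrite eqr_div ?(gt_eqF (harm_dim_gt0 _))//.
by apply/eqP; rewrite up_dim.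
Qed.

Let up_addn k m : gegen_up (k + m.+1) =
  (k%:R + m%:R + d%:R) / (2 * (k%:R + m%:R) + d%:R + 1).
Proof. by rewrite addnS /= natrD. Qed.

Let down_addn k m : gegen_down (k + m.+1) =
  (k%:R + m%:R + 1) / (2 * (k%:R + m%:R) + d%:R + 1).
Proof. by rewrite addnS /= natrD. Qed.

Let dim_addn k m : harm_dim (k + m.+1) = harm_dim (k + m) *
  (gegen_up (k + m) / gegen_down (k + m.+1)).
Proof. by rewrite addnS. Qed.

Lemma Ll_gegen0 m : Ll (gegen m.+1) =
  - (2 * m%:R + d%:R + 1) / (harm_dim m.+1 * (m.+1%:R * (m%:R + d%:R))).
Proof.
have D0 := d0; elim/ltn_ind: m => -[|[|m]] ihm.
- rewrite Ll_gegen1 /harm_dim /gegen_up /gegen_down; field; lra.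
- have := Ll_gegenSS 0; rewrite (_ : (0%N == 0%N)%:R = 1 :> R)// !mul0r sub0r !add0r => E.
  apply: (mulfI (x := d%:R * (d%:R + 1))); first by rewrite mulf_neq0; lra.
  rewrite E /harm_dim /gegen_up /gegen_down; field; lra.
- have := Ll_gegenSS m.+1; rewrite [(m.+1 == 0)%:R]/= subr0 (ihm m)// => E.
  apply: (mulfI (x := (m.+1%:R + d%:R) * (m.+1%:R + d%:R + 1))).
    by rewrite mulf_neq0//; have := den1 m.+1; lra.
  rewrite E (dim_addn 0 m.+2) (dim_addn 0 m.+1) (up_addn 0 m.+1) (down_addn 0 m.+2).
  rewrite (up_addn 0 m) (down_addn 0 m.+1) !add0n.
  have := harm_dim_gt0 m.+1; move: (harm_dim m.+1) => h h0.
  have : 0 <= m%:R :> R by [].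
  rewrite -!natr1; move: (m%:R) (d%:R) D0 => x D D0 x0.
  field; lra.
Qed.

(** Induction on the lower index: [symX] expresses a column through the two preceding ones, starting
    from the first column [Ll_gegen0]. *)
Lemma Ll_gegen_gt k m : Ll (gegen (k + m.+1) * gegen k) =
  - (2 * (k%:R + m%:R) + d%:R + 1) / (harm_dim (k + m.+1) * (m.+1%:R * (2 * k%:R + m%:R + d%:R))).
Proof.
have D0 := d0; elim/ltn_ind: k m => -[|k] ih m.
  by rewrite mulr1 !add0n mulr0 !add0r Ll_gegen0.
apply: (mulfI (lt0r_neq0 (gegen_up_gt0 k))).
have := symX Ll_lin (k.+1 + m.+1) k => /eqP; rewrite eq_sym -subr_eq => /eqP <-.
rewrite (_ : (k.+1 + m.+1).+1 = k + m.+3)%N; last by lia.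
rewrite (_ : (k.+1 + m.+1).-1 = k + m.+1)%N; last by lia.
rewrite !(ih k)//.
have -> : gegen_down k * Ll (gegen (k.+1 + m.+1) * gegen k.-1) =
  gegen_down k * (- (2 * (k%:R + m%:R) + d%:R + 3) / (harm_dim (k + m.+2) *
    ((m%:R + 3) * (2 * k%:R + m%:R + d%:R)))).
  case: k ih => [|k] ih; first by rewrite !mul0r.
  rewrite [k.+1.-1]/= (_ : k.+2 + m.+1 = k + m.+3)%N ?ih//; last by lia.
  rewrite (_ : k.+1 + m.+2 = k + m.+3)%N; last by lia.
  by congr (_ * (_ / (_ * (_ * _)))); rewrite -!natr1; ring.
have -> : (k.+1 + m.+1 = k + m.+2)%N by lia.
rewrite (dim_addn k m.+2) (down_addn k m.+2) (up_addn k m.+1).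
have -> : harm_dim (k + m.+1) = harm_dim (k + m.+2) * (gegen_down (k + m.+2) / gegen_up (k + m.+1)).
  have u := gt_eqF (gegen_up_gt0 (k + m.+1)).
  have w : gegen_down (k + m.+2) == 0 = false by rewrite addnS gt_eqF// gegen_downS_gt0.
  by rewrite (dim_addn k m.+1); field; rewrite u w.
rewrite (down_addn k m.+1) (up_addn k m).
have := harm_dim_gt0 (k + m.+2); move: (harm_dim _) => h h0.
have m0 : 0 <= m%:R :> R by [].
case: k {ih} => [|k].
  rewrite /gegen_up /gegen_down -!natr1; move: (m%:R) (d%:R) D0 m0 => x D D0 x0.
  field; lra.
have k0 : 0 <= k%:R :> R by [].
rewrite /gegen_up /gegen_down -!natr1; move: (m%:R) (k%:R) (d%:R) D0 m0 k0 => x y D D0 x0 y0.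
field; lra.
Qed.

Let diag k := harm_dim k * Ll (gegen k * gegen k).

Lemma Ll_gegen_diag1 : diag 1 = Ll 1 - (d%:R + 1)^-1.
Proof.
have D0 := d0.
have := symX Ll_lin 1 0; rewrite /= mul1r mul0r addr0 !mulr1 => E.
rewrite /diag /harm_dim /gegen_up /gegen_down.
have -> : Ll (gegen 1 * gegen 1) = (0%:R + d%:R) / (2 * 0%:R + d%:R + 1) * Ll (gegen 2)
  + (0%:R + 1) / (2 * 0%:R + d%:R + 1) * Ll 1 by exact: E.
rewrite Ll_gegen0 /harm_dim /gegen_up /gegen_down; field; lra.
Qed.

(** [symX] ties consecutive diagonal entries through known off-diagonal ones; together with
    [Ll_gegen_diag1], only Ll 1 stays undetermined. *)
Lemma Ll_gegen_diagS k : diag k.+2 = diag k.+1 +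
  ((k%:R + d%:R)^-1 - (2 * k%:R + d%:R + 3)^-1 - (2 * k%:R + d%:R + 1)^-1).
Proof.
have D0 := d0; have k0 : 0 <= k%:R :> R by [].
have H0 := harm_dim_gt0 k.+1; have U0 := gegen_up_gt0 k.+1.
have E : Ll (gegen k.+2 * gegen k.+2) = (gegen_up k.+2 * Ll (gegen k.+3 * gegen k.+1)
  + gegen_down k.+2 * Ll (gegen k.+1 * gegen k.+1) - gegen_down k.+1 * Ll (gegen k.+2 * gegen k)) / gegen_up k.+1.
  have /eqP := symX Ll_lin k.+2 k.+1; rewrite eq_sym -subr_eq => /eqP ->.
  by rewrite [in RHS]mulrC mulKf// gt_eqF.
rewrite /diag E (_ : k.+3 = k.+1 + 2)%N; last by lia.
rewrite [in gegen k.+2](_ : k.+2 = k + 2)%N; last by lia.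
rewrite !Ll_gegen_gt.
rewrite (dim_addn k.+1 1) (_ : (k + 2)%N = k.+1.+1)%N; last by lia.
rewrite (_ : k.+1 + 1 = k.+2)%N; last by lia.
rewrite (_ : harm_dim k.+2 = harm_dim k.+1 * (gegen_up k.+1 / gegen_down k.+2))// !(down_addn k.+1).
move: (harm_dim k.+1) (Ll _) H0 => h l H0.
rewrite /gegen_up /gegen_down -!natr1; move: (k%:R) (d%:R) D0 k0 => x D D0 x0.
field; lra.
Qed.

(** Testing against p_k reads off the coefficient h_k. The value 1 is p_k(1): the condition says
    that q represents evaluation at the pole. *)
Lemma kernel_poly_unique n q : (size q <= n.+1)%N ->
  (forall k, (k <= n)%N -> L0 (gegen k * q) = 1) -> q = kernel_poly n.
Proof.
move=> /size_gegen_spanned[a ->] H; apply: eq_bigr => k _; congr (_ *: _).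
have := H k (ltn_ord k); rewrite mulr_sumr (functional_sum L0_lin) (bigD1 k)//= big1 => [|j jk].
  rewrite addr0 -scalerAr L0Z L0_gegen_sqr => E.
  apply: (mulIf (invr_neq0 (lt0r_neq0 (harm_dim_gt0 k)))).
  by rewrite E divff// gt_eqF// harm_dim_gt0.
rewrite -scalerAr L0Z; have /orP[kj|kj] : (j < k)%N || (k < j)%N by rewrite -neq_ltn.
  by rewrite -(subnKC kj) addSnnS L0_gegen_gt mulr0.
by rewrite [gegen k * _]mulrC -(subnKC kj) addSnnS L0_gegen_gt mulr0.
Qed.

(** The denominator (n - k)(n + k + d - 1) is the difference n (n + d - 1) - k (k + d - 1) of
    Laplace eigenvalues. *)
Lemma Ll_gegen_lt n k : (k < n)%N -> Ll (gegen n * gegen k) =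
  - ((2 * n%:R + d%:R - 1) / harm_dim n / ((n%:R - k%:R) * (n%:R + k%:R + d%:R - 1))).
Proof.
move=> kn; have -> : n = (k + (n - k.+1).+1)%N by lia.
rewrite Ll_gegen_gt; move: (n - k.+1)%N => m.
have -> : (k + m.+1)%:R - k%:R = m.+1%:R :> R by rewrite natrD; ring.
rewrite mulNr -[in RHS]mulrA -invfM; congr (- (_ / (_ * (_ * _))));
  by rewrite natrD -natr1; ring.
Qed.

(** Expansion of (K + h p)^2: the cross term is [cross_sum], the square is the diagonal entry. *)
Lemma Ll_kernel_polyS n : Ll (kernel_poly n.+1 ^+ 2) = Ll (kernel_poly n ^+ 2) +
  harm_dim n.+1 * (harm_dim n.+1 * Ll (gegen n.+1 * gegen n.+1) - 2 * cross_sum n.+1).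
Proof.
have -> : kernel_poly n.+1 = kernel_poly n + harm_dim n.+1 *: gegen n.+1.
  by rewrite /kernel_poly big_ord_recr.
set h := harm_dim n.+1; set K := kernel_poly n; set g := gegen n.+1.
have -> : (K + h *: g) ^+ 2 = K ^+ 2 + (h * h) *: (g * g) + (2 * h) *: (g * K).
  by rewrite -!mul_polyC !polyCM polyC_natr; ring.
rewrite !LlD !LlZ -addrA; congr (_ + _).
have -> : Ll (g * K) = - cross_sum n.+1.
  rewrite /K /kernel_poly mulr_sumr (functional_sum Ll_lin) /cross_sum -mulNr mulr_sumr.
  apply: eq_bigr => k _; rewrite -scalerAr LlZ Ll_gegen_lt//.
  by rewrite -/h; ring.
ring.
Qed.

Lemma Ll_kernel_poly0 : Ll (kernel_poly 0 ^+ 2) = Ll 1.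
Proof. by rewrite /kernel_poly big_ord1 /= scale1r expr1n. Qed.

End functionals.
End gegenbauer.

(** * Asymptotics of the logarithmic energy of the kernel *)

Section cross_sums.
Context {R : realType}.
Implicit Types (d n k : nat).
Local Notation H := (@harmonic_sum R).
Local Notation harm_dim := (@harm_dim R).
Local Notation cross_sum := (@cross_sum R).
Local Notation dim_sum := (@dim_sum R).

Let harm_dimS d k : harm_dim d k.+1 = harm_dim d k * (gegen_up d k / gegen_down d k.+1).
Proof. by []. Qed.

(** The factor (k + 1)(k + d) is the Laplace eigenvalue of degree k + 1, reflecting that
    differentiation sends Gegenbauer polynomials for d to those for d + 2. *)
Lemma harm_dim_shift d k : (0 < d)%N ->
  harm_dim d.+2 k = harm_dim d k.+1 * ((k%:R + 1) * (k%:R + d%:R)) / (d%:R * (d%:R + 1)).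
Proof.
move=> d0; have D0 : 0 < d%:R :> R by rewrite ltr0n.
elim: k => [|k ih].
  rewrite /harm_dim /gegen_up /gegen_down; field; lra.
have h0 := harm_dim_gt0 (R := R) d0 k.+1.
have k0 : 0 <= k%:R :> R by [].
rewrite harm_dimS ih (harm_dimS d k.+1); move: (harm_dim d k.+1) h0 => h h0.
case: k {ih} k0 => [|k] k0.
  rewrite /gegen_up /gegen_down -!natr1; field; lra.
have {}k0 : 0 <= k%:R :> R by [].
rewrite /gegen_up /gegen_down -!natr1; move: (k%:R) (d%:R) k0 D0 => x D x0 D0.
field; lra.
Qed.

Lemma dim_sumE d n : (0 < d)%N ->
  dim_sum d n = harm_dim d n.+1 * ((2 * n%:R + d%:R) * (n%:R + 1)) / (d%:R * (2 * n%:R + d%:R + 1)).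
Proof.
move=> d0; have D0 : 0 < d%:R :> R by rewrite ltr0n.
rewrite /dim_sum; elim: n => [|n ih].
  rewrite big_ord1 /harm_dim /gegen_up /gegen_down; field; lra.
rewrite (_ : \sum_(k < n.+2) _ = \sum_(k < n.+1) harm_dim d k + harm_dim d n.+1); last by rewrite big_ord_recr.
rewrite ih (harm_dimS d n.+1).
have h0 := harm_dim_gt0 (R := R) d0 n.+1.
have n0 : 0 <= n%:R :> R by [].
rewrite /gegen_up /gegen_down -!natr1; move: (harm_dim _ _) (n%:R) (d%:R) h0 n0 D0 => h x D h0 x0 D0.
field; lra.
Qed.

Lemma harm_dim_ge1 d k : (0 < d)%N -> 1 <= harm_dim d k.
Proof.
move=> d0; have D1 : 1 <= d%:R :> R by rewrite ler1n.
elim: k => [|k ih] //.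
rewrite harm_dimS -[leLHS]mulr1 ler_pM// {ih}; case: k => [|k].
  have -> : gegen_up d 0 / gegen_down d 1 = d%:R + 1 :> R.
    by rewrite /gegen_up /gegen_down; field; lra.
  by lra.
have k0 : 0 <= k%:R :> R by [].
rewrite /gegen_up /gegen_down -natr1 ler_pdivlMr; last by rewrite divr_gt0//; lra.
rewrite mul1r -subr_ge0 (_ : _ - _ = ((d%:R - 1) * (2 * k%:R + d%:R + 2)) / 
  ((2 * k%:R + d%:R + 1) * (2 * k%:R + d%:R + 3))); last by field; lra.
by rewrite divr_ge0 ?mulr_ge0//; lra.
Qed.

(** The correction tends to 2/d, which matches psi(x + 1) = psi(x) + 1/x at x = d/2. *)
Lemma cross_sum_shift d n : (0 < d)%N ->
  cross_sum d.+2 n = cross_sum d n.+1 - (2 * n%:R + d%:R) / (d%:R * (n%:R + d%:R)).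
Proof.
move=> d0; have D0 : 0 < d%:R :> R by rewrite ltr0n.
have n0 : 0 <= n%:R :> R by [].
have h0 := harm_dim_gt0 (R := R) d0 n.+1.
rewrite /cross_sum.
(* Uses (k + 1)(k + d) = (n + 1)(n + d) - (n - k)(n + k + d + 1), where the last product is the
   denominator. *)
have -> : \sum_(k < n) harm_dim d.+2 k / ((n%:R - k%:R) * (n%:R + k%:R + d.+2%:R - 1)) =
  ((n%:R + 1) * (n%:R + d%:R)) / (d%:R * (d%:R + 1)) *
   \sum_(k < n) harm_dim d k.+1 / ((n.+1%:R - k.+1%:R) * (n.+1%:R + k.+1%:R + d%:R - 1))
  - (d%:R * (d%:R + 1))^-1 * \sum_(k < n) harm_dim d k.+1.
  rewrite !mulr_sumr -sumrB; apply: eq_bigr => k _.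
  rewrite harm_dim_shift// -!natr1.
  have kn : k%:R < n%:R :> R by rewrite ltr_nat.
  have k0 : 0 <= k%:R :> R by [].
  move: (harm_dim _ _) (n%:R) (k%:R) (d%:R) kn k0 D0 => h x y D kn k0 D0.
  field; lra.
rewrite big_ord_recl.
have -> : \sum_(k < n) harm_dim d k.+1 = dim_sum d n - 1.
  by rewrite /dim_sum big_ord_recl addrC addKr.
rewrite dim_sumE// harm_dim_shift//.
under [in RHS]eq_bigr => k _ do rewrite /bump/=.
move: (\sum_(k < n) _) => s.
rewrite -!natr1 subr0 addr0 (_ : harm_dim d ord0 = 1)//.
move: (harm_dim _ _) (n%:R) (d%:R) n0 D0 h0 => h x D x0 D0 h0.
field; lra.
Qed.

Let sum_rev_inv n : \sum_(k < n) (n%:R - k%:R)^-1 = H n.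
Proof.
rewrite (reindex_inj rev_ord_inj)/= /harmonic_sum big_add1/= big_mkord.
by apply: eq_bigr => k _; rewrite natrB// opprB addrC subrK.
Qed.

Let sum_shift_inv a n : \sum_(k < n) (a%:R + k%:R + 1)^-1 = H (a + n) - H a.
Proof.
elim: n => [|n ih]; first by rewrite big_ord0 addn0 subrr.
by rewrite big_ord_recr/= ih addnS harmonic_sumS -natr1 natrD addrAC.
Qed.

(** For d = 1 the harmonic dimensions are 2 beyond degree 0, and 2/((n - k)(n + k)) splits into
    partial fractions. *)
Lemma cross_sum1 n : cross_sum 1 n.+1 = H (2 * n.+1).-1.
Proof.
have h1 k : harm_dim 1 k.+1 = 2.
  elim: k => [|k ih]; first by rewrite /harm_dim /gegen_up /gegen_down; field.
  have k0 : 0 <= k%:R :> R by [].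
  by rewrite harm_dimS ih /gegen_up /gegen_down -natr1; field; lra.
have n0 : 0 <= n%:R :> R by [].
rewrite /cross_sum h1 big_ord_recl (_ : harm_dim 1 ord0 = 1)//.
have -> : \sum_(i < n) harm_dim 1 (lift ord0 i) / ((n.+1%:R - (lift ord0 i)%:R) *
    (n.+1%:R + (lift ord0 i)%:R + 1%:R - 1)) =
  (n.+1%:R)^-1 * (\sum_(i < n) (n%:R - i%:R)^-1 + \sum_(i < n) (n.+1%:R + i%:R + 1)^-1).
  rewrite mulrDr !mulr_sumr -big_split; apply: eq_bigr => i _.
  rewrite [RHS]/= !lift0 h1 -!natr1.
  have kn : i%:R < n%:R :> R by rewrite ltr_nat.
  have k0 : 0 <= i%:R :> R by [].
  field; lra.
rewrite sum_rev_inv sum_shift_inv harmonic_sumS.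
rewrite (_ : (2 * n.+1).-1 = n.+1 + n)%N; last by lia.
rewrite -!natr1 subr0 addr0.
move: (H _) (H _) => a b; field; lra.
Qed.

(** For d = 2, (2k + 1)/((n - k)(n + k + 1)) = 1/(n - k) - 1/(n + k + 1). *)
Lemma cross_sum2 n : cross_sum 2 n = 2 * H n - H (2 * n).
Proof.
have h1 k : harm_dim 2 k = 2 * k%:R + 1.
  elim: k => [|k ih]; first by rewrite /harm_dim; ring.
  have k0 : 0 <= k%:R :> R by [].
  rewrite harm_dimS ih {ih}; case: k k0 => [|k] k0; first by rewrite /gegen_up /gegen_down; field; lra.
  have {}k0 : 0 <= k%:R :> R by [].
  by rewrite /gegen_up /gegen_down -!natr1; field; lra.
have n0 : 0 <= n%:R :> R by [].
rewrite /cross_sum h1.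
have -> : \sum_(k < n) harm_dim 2 k / ((n%:R - k%:R) * (n%:R + k%:R + 2%:R - 1)) =
   \sum_(k < n) (n%:R - k%:R)^-1 - \sum_(k < n) (n%:R + k%:R + 1)^-1.
  rewrite -sumrB; apply: eq_bigr => k _; rewrite h1.
  have kn : k%:R < n%:R :> R by rewrite ltr_nat.
  have k0 : 0 <= k%:R :> R by [].
  field; lra.
rewrite sum_rev_inv sum_shift_inv mul2n -addnn.
move: (H _) (H _) => a b; field; lra.
Qed.

Lemma cvg_ln_affine (a b : R) : 0 < a -> 0 <= b ->
  (ln (a * n%:R + b) - ln n%:R) @[n --> \oo] --> ln a.
Proof.
move=> a0 b0; apply/subr_cvg0.
apply: (@squeeze_cvgr _ _ _ _ (cst 0) (fun n => b / a * n%:R^-1)).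
- exists 1%N => // n /= n0; have n0' : 0 < n%:R :> R by rewrite ltr0n.
  have ba : 0 <= b / a * n%:R^-1 by rewrite mulr_ge0 ?invr_ge0 ?divr_ge0// ltW.
  have -> : ln (a * n%:R + b) - ln n%:R - ln a = ln (1 + b / a * n%:R^-1).
    rewrite (_ : a * n%:R + b = a * n%:R * (1 + b / a * n%:R^-1)); last by field; rewrite !gt_eqF.
    rewrite lnM ?posrE ?mulr_gt0//; last by rewrite ltr_wpDr.
    by rewrite (lnM (x := a)) ?posrE//; ring.
  rewrite ln_ge0 ?lerDl//= le_ln1Dx//; lra.
- exact: cvg_cst.
- by rewrite -[X in _ --> X](mulr0 (b / a)); apply: cvgM; [exact: cvg_cst|exact: cvg_invn].
Qed.

Lemma cvg_subseq (u : nat -> R) (f : nat -> nat) (l : R) : (forall n, (n <= f n)%N) ->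
  u n @[n --> \oo] --> l -> u (f n) @[n --> \oo] --> l.
Proof.
move=> fn /cvgrPdist_le ul; apply/cvgrPdist_le => e /ul[N _ HN]; exists N => // n /= Nn.
by apply: HN => /=; rewrite (leq_trans Nn).
Qed.

Lemma cvg_harmonic_affine a b : (0 < a)%N ->
  (H (a * n + b) - ln n%:R) @[n --> \oo] --> euler_gamma R + ln a%:R.
Proof.
move=> a0.
have fn n : (n <= a * n + b)%N by rewrite (leq_trans (leq_pmull n a0))// leq_addr.
have -> : (fun n => H (a * n + b) - ln n%:R) = (fun n => (H (a * n + b) - ln (a * n + b)%:R)
    + (ln (a%:R * n%:R + b%:R) - ln n%:R)).
  by apply/funext => n; rewrite natrD natrM addrA subrK.
apply: cvgD; last by apply: cvg_ln_affine; rewrite ?ltr0n.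
exact: (cvg_subseq fn (@cvg_harmonic_ln R)).
Qed.

(** Induction by steps of 2, using [cross_sum_shift] and [digammaS]; the bases d = 1 and d = 2 meet
    psi(1/2) and psi(1). *)
Lemma cvg_cross_sum d : (0 < d)%N ->
  (cross_sum d n - ln n%:R) @[n --> \oo] --> - digamma (d%:R / 2 : R) - ln 2.
Proof.
elim/ltn_ind: d => -[|[|[|d]]] // ih _.
- rewrite div1r digamma_half -(cvg_shiftS _ (nbhs (- (- euler_gamma R - 2 * ln 2) - ln 2 : R))) /=.
  have -> : (fun n => cross_sum 1 n.+1 - ln n.+1%:R) =
     (fun n => (H (2 * n + 1) - ln n%:R) - (ln (1 * n%:R + 1) - ln n%:R)).
    apply/funext => n; rewrite cross_sum1 mul1r natr1 (_ : (2 * n.+1).-1 = 2 * n + 1)%N; last by lia.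
    ring.
  apply: (@cvgn_eq_lim _ _ (euler_gamma R + ln 2 - ln 1)); first by rewrite ln1; ring.
  by apply: cvgB; [exact: cvg_harmonic_affine|exact: cvg_ln_affine].
- rewrite divff// digamma1 opprK.
  have -> : (fun n => cross_sum 2 n - ln n%:R) =
     (fun n => 2 * (H n - ln n%:R) - (H (2 * n + 0) - ln n%:R)).
    by apply/funext => n; rewrite cross_sum2 addn0; ring.
  apply: (@cvgn_eq_lim _ _ (2 * euler_gamma R - (euler_gamma R + ln 2))); first by ring.
  apply: cvgB; last exact: cvg_harmonic_affine.
  by apply: cvgM; [exact: cvg_cst|exact: cvg_harmonic_ln].
- have D0 : 0 < d.+1%:R :> R by [].
  have -> : (fun n => cross_sum d.+3 n - ln n%:R) = (fun n =>
     (cross_sum d.+1 n.+1 - ln n.+1%:R) + (ln (1 * n%:R + 1) - ln n%:R)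
     - (2 * n%:R + d.+1%:R) / (d.+1%:R * (n%:R + d.+1%:R))).
    by apply/funext => n; rewrite cross_sum_shift// mul1r natr1; ring.
  apply: (@cvgn_eq_lim _ _ (- digamma (d.+1%:R / 2) - ln 2 + ln 1 - 2 / d.+1%:R)).
    rewrite (_ : d.+3%:R / 2 = d.+1%:R / 2 + 1); last by rewrite -2!natr1 -addrA mulrDl divff.
    rewrite digammaS ?divr_gt0// invf_div ln1; ring.
  apply: cvgB.
    apply: cvgD; last exact: cvg_ln_affine.
    have := ih d.+1 (ltnW (ltnSn _)) isT.
    by rewrite -(cvg_shiftS _ (nbhs (- digamma (d.+1%:R / 2) - ln 2 : R))).
  rewrite -(cvg_shiftS _ (nbhs (2 / d.+1%:R : R))) /=.
  have -> : (fun n => (2 * n.+1%:R + d.+1%:R) / (d.+1%:R * (n.+1%:R + d.+1%:R)) : R) =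
    (fun n => (2 + d.+1%:R * n.+1%:R^-1) * (d.+1%:R * (1 + d.+1%:R * n.+1%:R^-1))^-1).
    apply/funext => n; move: (d.+1%:R) D0 => D D0.
    have n0 : 0 < n.+1%:R :> R by [].
    move: (n.+1%:R) n0 => x x0; field; rewrite !gt_eqF//=; lra.
  apply: (@cvgn_eq_lim _ _ ((2 + d.+1%:R * 0) * (d.+1%:R * (1 + d.+1%:R * 0))^-1)).
    by rewrite !mulr0 !addr0 mulr1.
  have L : (d.+1%:R * n.+1%:R^-1 : R) @[n --> \oo] --> (d.+1%:R * 0 : R).
    by apply: cvgM; [exact: cvg_cst|exact: cvg_invSn].
  apply: cvgM; first by apply: cvgD => //; exact: cvg_cst.
  apply: cvgV; first by rewrite mulr0 addr0 mulr1 gt_eqF.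
  apply: cvgM; first exact: cvg_cst.
  by apply: cvgD => //; exact: cvg_cst.
Qed.


Lemma prod_shift_telescope (n e : nat) :
  \prod_(i < e) (n.+1%:R + i.+1%:R : R) * (n%:R + 1) = \prod_(i < e) (n%:R + i.+1%:R) * (n%:R + 1 + e%:R).
Proof.
elim: e => [|e ih]; first by rewrite !big_ord0 addr0.
by rewrite !big_ord_recr/= mulrAC ih -!natr1; ring.
Qed.

(** Product form of the dimension, whose logarithm can be compared with ln n factor by factor. *)
Lemma dim_sum_prod e n :
  dim_sum e.+1 n * e.+1`!%:R = (2 * n%:R + e.+1%:R) * \prod_(i < e) (n%:R + i.+1%:R).
Proof.
have f0 : e.+1`!%:R != 0 :> R by rewrite pnatr_eq0 -lt0n fact_gt0.
elim: n => [|n ih].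
  rewrite /dim_sum big_ord1 mulr0 add0r mul1r factS natrM; congr (_ * _).
  by rewrite fact_prod natr_prod big_add1/= big_mkord; apply: eq_bigr => i _; rewrite add0r.
have n0 : 0 <= n%:R :> R by [].
have e0 : 0 <= e%:R :> R by [].
have n1 : n%:R + 1 != 0 :> R by lra.
have := dim_sumE n (ltn0Sn e).
have -> : dim_sum e.+1 n.+1 = dim_sum e.+1 n + harm_dim e.+1 n.+1 by rewrite /dim_sum big_ord_recr.
move=> E.
have {E} E : harm_dim e.+1 n.+1 = dim_sum e.+1 n * (e.+1%:R * (2 * n%:R + e.+1%:R + 1)) / ((2 * n%:R + e.+1%:R) * (n%:R + 1)).
  rewrite E -!natr1; move: (harm_dim _ _) => h; field; lra.
apply: (mulfI n1); rewrite E [(dim_sum _ _ + _) * _]mulrDl.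
have -> : (n%:R + 1) * ((2 * n.+1%:R + e.+1%:R) * \prod_(i < e) (n.+1%:R + i.+1%:R : R)) =
  (2 * n.+1%:R + e.+1%:R) * (\prod_(i < e) (n.+1%:R + i.+1%:R) * (n%:R + 1)) by ring.
rewrite prod_shift_telescope.
have -> : dim_sum e.+1 n * (e.+1%:R * (2 * n%:R + e.+1%:R + 1)) / ((2 * n%:R + e.+1%:R) * (n%:R + 1)) * e.+1`!%:R =
  (dim_sum e.+1 n * e.+1`!%:R) * (e.+1%:R * (2 * n%:R + e.+1%:R + 1)) / ((2 * n%:R + e.+1%:R) * (n%:R + 1)) by ring.
rewrite ih; move: (\prod_(i < e) _) => p.
rewrite -!natr1; field; lra.
Qed.

Lemma dim_sum_gt0 d n : (0 < d)%N -> 0 < dim_sum d n.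
Proof. by move=> d0; rewrite /dim_sum big_ord_recl ltr_pwDl// sumr_ge0// => k _; rewrite ltW// harm_dim_gt0. Qed.

Lemma cvg_ln_dim_sum d : (0 < d)%N ->
  (ln (dim_sum d n) - d%:R * ln n%:R) @[n --> \oo] --> ln (2 / d`!%:R).
Proof.
case: d => // e _.
have f0 : 0 < e.+1`!%:R :> R by rewrite ltr0n fact_gt0.
have E : \forall n \near \oo,
  (ln (2 * n%:R + e.+1%:R) - ln n%:R) + \sum_(i < e) (ln (1 * n%:R + i.+1%:R) - ln n%:R) - ln e.+1`!%:R =
  ln (dim_sum e.+1 n) - e.+1%:R * ln n%:R.
  exists 1%N => // n /= n0; have n0' : 0 < n%:R :> R by rewrite ltr0n.
  have {1}-> : dim_sum e.+1 n = (2 * n%:R + e.+1%:R) * \prod_(i < e) (n%:R + i.+1%:R) / e.+1`!%:R.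
    by rewrite -dim_sum_prod mulfK ?gt_eqF.
  have p0 : 0 < \prod_(i < e) (n%:R + i.+1%:R : R) by apply: prodr_gt0 => i _; rewrite addr_gt0.
  have q0 : 0 < 2 * n%:R + e.+1%:R :> R by rewrite addr_gt0 ?mulr_gt0.
  rewrite ln_div ?posrE ?mulr_gt0// lnM ?posrE//.
  have -> : ln (\prod_(i < e) (n%:R + i.+1%:R : R)) = \sum_(i < e) ln (1 * n%:R + i.+1%:R).
    rewrite mul1r {p0 q0}; elim: (e) => [|m ihm]; first by rewrite !big_ord0 ln1.
    rewrite !big_ord_recr/= lnM ?posrE ?addr_gt0// ?ihm//.
    by apply: prodr_gt0 => i _; rewrite addr_gt0.
  rewrite sumrB sumr_const card_ord -mulr_natl -natr1; ring.
apply: cvg_trans (near_eq_cvg E) _.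
apply: (@cvgn_eq_lim _ _ (ln 2 + \sum_(i < e) ln 1 - ln e.+1`!%:R)).
  by rewrite ln1 big1 ?addr0 ?ln_div ?posrE.
apply: cvgB; last exact: cvg_cst.
apply: cvgD; first exact: cvg_ln_affine.
elim: (e) => [|m ihm].
  by rewrite big_ord0; under eq_fun do rewrite big_ord0; exact: cvg_cst.
rewrite big_ord_recr; under eq_fun do rewrite big_ord_recr.
by apply: cvgD => //; exact: cvg_ln_affine.
Qed.

Section log_functional.
Variable d : nat.
Hypothesis d_gt0 : (0 < d)%N.
Variables L0 Ll : {poly R} -> R.
Hypothesis L0_lin : forall a p q, L0 (a *: p + q) = a * L0 p + L0 q.
Hypothesis Ll_lin : forall a p q, Ll (a *: p + q) = a * Ll p + Ll q.
Hypothesis L0_1 : L0 1 = 1.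
Hypothesis L0_parts : forall p, L0 ((1 - 'X ^+ 2) * p^`() - d%:R * ('X * p)) = 0.
Hypothesis Ll_parts : forall p,
  Ll ((1 - 'X ^+ 2) * p^`() - d%:R * ('X * p)) = L0 ((1 + 'X) * p).
(** This bound and [Ll_ge] integrate ln z <= z - 1 against a power of 1 - t, at z = (1 - t)/c and at
    z = c/(1 - t); c is left free to be optimized. *)
Hypothesis Ll_le : forall m (c : R), 0 < c ->
  Ll ((1 - 'X) ^+ m) <= L0 ((1 - 'X) ^+ m.+1) / c + (ln c - 1) * L0 ((1 - 'X) ^+ m).
Hypothesis Ll_ge : forall m (c : R), 0 < c ->
  (1 + ln c) * L0 ((1 - 'X) ^+ m.+1) - c * L0 ((1 - 'X) ^+ m) <= Ll ((1 - 'X) ^+ m.+1).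

Let D : R := d%:R.
Let D0 : 0 < D. Proof. by rewrite /D ltr0n. Qed.
Let B m := L0 ((1 - 'X) ^+ m).
Let Bl m := Ll ((1 - 'X) ^+ m).

Let parts_power m :
  (1 - 'X ^+ 2) * ((1 - 'X) ^+ m)^`() - d%:R * ('X * (1 - 'X) ^+ m) =
  (d + m)%:R * (1 - 'X) ^+ m.+1 - (d + 2 * m)%:R * (1 - 'X) ^+ m :> {poly R}.
Proof.
rewrite deriv_exp derivB derivC derivX sub0r mulN1r -mulr_natl natrD (natrD _ d (2 * m)) natrM.
case: m => [|m]; first by rewrite /= !expr0 expr1; ring.
by rewrite !exprS; ring.
Qed.

Let BS m : (D + m%:R) * B m.+1 = (D + 2 * m%:R) * B m.
Proof.
have := L0_parts ((1 - 'X) ^+ m); rewrite parts_power (functionalB L0_lin) !(functional_nat L0_lin) => /eqP.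
by rewrite subr_eq0 (natrD _ d m) (natrD _ d (2 * m)) natrM => /eqP.
Qed.

Let BlS m : (D + m%:R) * Bl m.+1 = (D + 2 * m%:R) * Bl m + 2 * B m - B m.+1.
Proof.
have := Ll_parts ((1 - 'X) ^+ m); rewrite parts_power (functionalB Ll_lin) !(functional_nat Ll_lin).
have -> : (1 + 'X) * (1 - 'X) ^+ m = 2%:R * (1 - 'X) ^+ m - (1 - 'X) ^+ m.+1 :> {poly R} by rewrite exprS; ring.
rewrite (functionalB L0_lin) !(functional_nat L0_lin) -/(B m) -/(B m.+1) (natrD _ d m) (natrD _ d (2 * m)) natrM -/D => E.
by rewrite /Bl; move: E; lra.
Qed.

Let B_gt0 m : 0 < B m.
Proof.
elim: m => [|m ih]; first by rewrite /B expr0 L0_1.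
have m0 : 0 <= m%:R :> R by []. have p := D0.
have a : 0 < D + m%:R by lra. have b : 0 < D + 2 * m%:R by lra.
by rewrite -(pmulr_rgt0 _ a) BS mulr_gt0.
Qed.

Let ratio m := B m.+1 / B m.

Let ratioE m : ratio m = (D + 2 * m%:R) / (D + m%:R).
Proof.
have m0 : 0 <= m%:R :> R by []. have p := D0.
apply/eqP; rewrite /ratio eqr_div ?(gt_eqF (B_gt0 _))//; last by lra.
by rewrite mulrC BS.
Qed.

(** Average of ln(1 - t) for the weight (1 - t)^m, while [ratio m] is the average of 1 - t for the
    same weight. In particular [mean 0] is Ll 1. *)
Let mean m := Bl m / B m.

Let meanS m : mean m.+1 = mean m + 2 / (D + 2 * m%:R) - (D + m%:R)^-1.
Proof.
have m0 : 0 <= m%:R :> R by []. have p := D0.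
have b0 := B_gt0 m.
have E1 : B m.+1 = B m * ((D + 2 * m%:R) / (D + m%:R)) by rewrite -ratioE mulrC divfK ?gt_eqF.
have E2 : Bl m.+1 = ((D + 2 * m%:R) * Bl m + 2 * B m - B m.+1) / (D + m%:R).
  by rewrite -BlS mulrC mulKf//; lra.
by rewrite /mean E2 E1; field; lra.
Qed.

(** Jensen's inequality: c = [ratio m] is the optimal constant in [Ll_le]. The lower bound [mean_ge]
    comes from the same c in [Ll_ge]. *)
Let mean_le m : mean m <= ln (ratio m).
Proof.
have r0 : 0 < ratio m by rewrite divr_gt0.
rewrite ler_pdivrMr//; apply: le_trans (Ll_le m r0) _.
rewrite -/(B m) -/(B m.+1) (_ : B m.+1 / ratio m = B m); first lra.
by rewrite invf_div mulrCA divff ?mulr1// gt_eqF.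
Qed.

Let mean_ge m : ln (ratio m) <= mean m.+1.
Proof.
have r0 : 0 < ratio m by rewrite divr_gt0.
rewrite ler_pdivlMr//; apply: le_trans (Ll_ge m r0).
rewrite -/(B m) -/(B m.+1) (_ : ratio m * B m = B m.+1); first lra.
by rewrite divfK// gt_eqF.
Qed.

(** The weight concentrates at t = -1, where 1 - t = 2; formally, [mean m.+1] lies between the
    logarithms of consecutive ratios. *)
Let cvg_mean : mean m @[m --> \oo] --> ln 2.
Proof.
have cr : ln (ratio m) @[m --> \oo] --> ln 2.
  have E : \forall m \near \oo, (ln (2 * m%:R + D) - ln m%:R) - (ln (1 * m%:R + D) - ln m%:R) = ln (ratio m).
    exists 1%N => // m /= m0; have m0' : 0 < m%:R :> R by rewrite ltr0n.
    have p := D0.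
    rewrite ratioE ln_div ?posrE; try lra.
    rewrite mul1r (addrC D) (addrC D); ring.
  apply: cvg_trans (near_eq_cvg E) _.
  apply: (@cvgn_eq_lim _ _ (ln 2 - ln 1)); first by rewrite ln1 subr0.
  by apply: cvgB; apply: cvg_ln_affine; rewrite ?(ltW D0).
rewrite -(cvg_shiftS _ (nbhs (ln 2 : R))) /=.
apply: (@squeeze_cvgr _ _ _ _ (fun m => ln (ratio m)) (fun m => ln (ratio m.+1))) => //.
- by near=> m; rewrite mean_ge mean_le.
- by have := cr; rewrite -(cvg_shiftS _ (nbhs (ln 2 : R))).
Unshelve. all: by end_near. Qed.

Let diag k := harm_dim d k * Ll (gegen d k * gegen d k).

(** The unknown Ll 1 enters [diag] and [mean] in the same way and cancels, leaving harmonic numbers.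
    The limit of [mean] thus gives that of [diag]. *)
Let diag_mean k : diag k.+1 - mean k = 2 * H (d + k).-1 - 2 * H (2 * k + d).-1 - (2 * k%:R + D + 1)^-1.
Proof.
have p := D0.
elim: k => [|k ih].
  rewrite /diag (Ll_gegen_diag1 d_gt0 L0_lin Ll_lin L0_1 L0_parts Ll_parts) addn0 muln0 add0n.
  rewrite /mean /Bl /B expr0 L0_1 divr1 -/D; rewrite mulr0 add0r; ring.
rewrite /diag (Ll_gegen_diagS d_gt0 L0_lin Ll_lin L0_1 L0_parts Ll_parts) -/(diag _) meanS.
have k0 : 0 <= k%:R :> R by [].
have -> : (d + k.+1).-1 = (d + k).-1.+1 by lia.
have -> : (2 * k.+1 + d).-1 = (2 * k + d).-1.+2 by lia.
rewrite !harmonic_sumS.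
have -> : (d + k).-1.+1%:R = D + k%:R :> R by rewrite prednK ?addn_gt0 ?d_gt0// natrD.
have e1 : (2 * k + d).-1.+1 = (2 * k + d)%N by rewrite prednK// addn_gt0 d_gt0 orbT.
rewrite e1 -(natr1 (2 * k + d)) (natrD _ (2 * k) d) natrM -/D.
move: ih; rewrite -(natr1 k); move: (H _) (H _) (diag _) (mean _) => a b c m ih.
rewrite (_ : c + _ - (m + _ - _) = (c - m) + ((k%:R + D)^-1 - (2 * k%:R + D + 3)^-1 - (2 * k%:R + D + 1)^-1
   - 2 / (D + 2 * k%:R) + (D + k%:R)^-1)); last first.
  by rewrite /D; ring.
rewrite ih; field; lra.
Qed.

Lemma cvg_diag : diag k @[k --> \oo] --> - ln 2.
Proof.
rewrite -(cvg_shiftS _ (nbhs (- ln 2 : R))) /=.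
have -> : (fun k => diag k.+1) = (fun k => mean k + (2 * (H (1 * k + d.-1) - ln k%:R) -
  2 * (H (2 * k + d.-1) - ln k%:R) - (2 * k%:R + D + 1)^-1)).
  apply/funext => k; have /eqP := diag_mean k; rewrite subr_eq => /eqP ->.
  rewrite (_ : (d + k).-1 = 1 * k + d.-1)%N; last by lia.
  by rewrite (_ : (2 * k + d).-1 = 2 * k + d.-1)%N; [ring|lia].
apply: (@cvgn_eq_lim _ _ (ln 2 + (2 * (euler_gamma R + ln 1) - 2 * (euler_gamma R + ln 2) - 0))).
  by rewrite ln1; ring.
apply: cvgD; first exact: cvg_mean.
apply: cvgB.
  by apply: cvgB; (apply: cvgM; [exact: cvg_cst|exact: cvg_harmonic_affine]).
apply: (@squeeze_cvgr _ _ _ _ (cst 0) (fun k => k.+1%:R^-1)).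
- near=> k; have k0 : 0 <= k%:R :> R by []. have p := D0.
  by rewrite invr_ge0/= lef_pV2 ?posrE -?natr1; lra.
- exact: cvg_cst.
- exact: cvg_invSn.
Unshelve. all: by end_near. Qed.

Theorem cvg_kernel_log_energy :
  (2^-1 * (ln 2 * dim_sum d n + Ll (kernel_poly d n ^+ 2))
    + D^-1 * dim_sum d n * ln (dim_sum d n)) / dim_sum d n @[n --> \oo] --> harmonic_const R d.
Proof.
pose S k := \sum_(i < k) harm_dim d i.
(* Abel summation: the last term is the increment of 2 S_k ln k, so that adding 2 [dim_sum] ln n to
   the functional leaves a sum of h_k c_k. The boundary terms use ln 0 = 0. *)
pose c k := diag k - 2 * (cross_sum d k - ln k%:R) + 2 * (S k / harm_dim d k) * (ln k%:R - ln k.-1%:R).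
have TE n : Ll (kernel_poly d n ^+ 2) + 2 * dim_sum d n * ln n%:R = \sum_(k < n.+1) harm_dim d k * c k.
  elim: n => [|n ih].
    rewrite (Ll_kernel_poly0 d) [RHS]big_ord1 /c /diag /S /cross_sum !big_ord0 ln0//.
    by rewrite /harm_dim /= (mulr1 (1 : {poly R})) !invr1; ring.
  rewrite (_ : \sum_(k < n.+2) _ = \sum_(k < n.+1) harm_dim d k * c k + harm_dim d n.+1 * c n.+1); last by rewrite big_ord_recr.
  rewrite -ih (Ll_kernel_polyS d_gt0 L0_lin Ll_lin L0_1 L0_parts Ll_parts) -/(diag _).
  rewrite (_ : dim_sum d n.+1 = S n.+1 + harm_dim d n.+1); last by rewrite /dim_sum big_ord_recr.
  rewrite /c -/(dim_sum d n) -[S n.+1]/(dim_sum d n).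
  have h0 := harm_dim_gt0 (R := R) d_gt0 n.+1.
  move: (harm_dim d n.+1) h0 => h h0; rewrite [n.+1.-1]/=.
  by field; rewrite gt_eqF.
(* The three parts of c tend to -ln 2, to 2 psi(d/2) + 2 ln 2, and to 2/d, the last because S_k/h_k
   grows like k/d. *)
have cc : c @ \oo --> ln 2 + 2 * digamma (D / 2) + 2 / D.
  apply: (@cvgn_eq_lim _ _ (- ln 2 - 2 * (- digamma (D / 2) - ln 2) + 2 / D)); first ring.
  apply: cvgD.
    apply: cvgB; first exact: cvg_diag.
    by apply: cvgM; [exact: cvg_cst|exact: cvg_cross_sum].
  rewrite -(cvg_shiftS _ (nbhs (2 / D : R))) /=.
  have -> : (fun n => 2 * (S n.+1 / harm_dim d n.+1) * (ln n.+1%:R - ln n%:R)) =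
    (fun n => 2 / D * (((n%:R + 1) * (ln n.+1%:R - ln n%:R)) * (1 - (2 * n%:R + D + 1)^-1))).
    apply/funext => n; rewrite -[S n.+1]/(dim_sum d n) dim_sumE//.
    have h0 := harm_dim_gt0 (R := R) d_gt0 n.+1.
    move: (harm_dim d n.+1) (ln _ - ln _) h0 => h l h0.
    have n0 : 0 <= n%:R :> R by []. have p := D0.
    rewrite -/D; field; lra.
  apply: (@cvgn_eq_lim _ _ (2 / D * (1 * (1 - 0)))); first by rewrite subr0 !mulr1.
  apply: cvgM; first exact: cvg_cst.
  apply: cvgM.
    apply: (@squeeze_cvgr _ _ _ _ (cst 1) (fun n => 1 + n%:R^-1)).
    - exists 1%N => // n /= n0; have n0' : 0 < n%:R :> R by rewrite ltr0n.
      rewrite -natr1 -ln_div ?posrE ?addr_gt0//.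
      have -> : (n%:R + 1) / n%:R = 1 + n%:R^-1 :> R by rewrite mulrDl divff ?gt_eqF// mul1r.
      have i0 : 0 < n%:R^-1 :> R by rewrite invr_gt0.
      apply/andP; split.
        have : ln (1 + (- (n%:R + 1)^-1)) <= - (n%:R + 1)^-1 :> R.
          by apply: le_ln1Dx; rewrite ltrN2 invf_lt1; lra.
        have -> : 1 + - (n%:R + 1)^-1 = (1 + n%:R^-1)^-1 :> R by field; lra.
        rewrite lnV ?posrE; last lra.
        rewrite lerN2 => H1; rewrite -ler_pdivrMl ?mulr1//; lra.
      have : ln (1 + n%:R^-1) <= n%:R^-1 :> R by apply: le_ln1Dx; lra.
      have -> : 1 + n%:R^-1 = (n%:R + 1) * n%:R^-1 :> R by rewrite mulrDl divff ?gt_eqF// mul1r.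
      by move=> H1; rewrite ler_wpM2l//; lra.
    - exact: cvg_cst.
    - apply: (@cvgn_eq_lim _ _ (1 + 0)); first exact: addr0.
      by apply: cvgD; [exact: cvg_cst|exact: cvg_invn].
  apply: cvgB; first exact: cvg_cst.
  apply: (@squeeze_cvgr _ _ _ _ (cst 0) (fun k => k.+1%:R^-1)).
  - near=> k; have k0 : 0 <= k%:R :> R by []. have p := D0.
    by rewrite invr_ge0/= lef_pV2 ?posrE -?natr1; lra.
  - exact: cvg_cst.
  - exact: cvg_invSn.
have W := weighted_cesaro (fun k => @harm_dim_ge1 d k d_gt0) cc.
have Z := cvg_ln_dim_sum d_gt0.
have -> : (fun n => (2^-1 * (ln 2 * dim_sum d n + Ll (kernel_poly d n ^+ 2))
    + D^-1 * dim_sum d n * ln (dim_sum d n)) / dim_sum d n) = (fun n =>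
   2^-1 * ln 2 + 2^-1 * ((\sum_(k < n.+1) harm_dim d k * c k) / (\sum_(k < n.+1) harm_dim d k))
   + D^-1 * (ln (dim_sum d n) - d%:R * ln n%:R)).
  apply/funext => n; rewrite -TE -/(dim_sum d n).
  have n0 := dim_sum_gt0 n d_gt0. have p := D0.
  move: (dim_sum d n) (ln (dim_sum d n)) n0 => x y x0; rewrite -/D.
  by field; rewrite !gt_eqF.
apply: (@cvgn_eq_lim _ _ (2^-1 * ln 2 + 2^-1 * (ln 2 + 2 * digamma (D / 2) + 2 / D) + D^-1 * ln (2 / d`!%:R))).
  rewrite /harmonic_const -/D; have p := D0; field; lra.
apply: cvgD; first by apply: cvgD; [exact: cvg_cst|apply: cvgM => //; exact: cvg_cst].
by apply: cvgM => //; exact: cvg_cst.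
Unshelve. all: by end_near. Qed.

End log_functional.
End cross_sums.

(** * Invariance of Lebesgue measure on tuples *)

Section tuple_integral.
Context d (T : measurableType d) (R : realType).
Variable m : {sigma_finite_measure set T -> \bar R}.

Lemma tnth_tuple_cons0 n (a : T) (y : n.-tuple T) : tnth (tuple_cons (a, y)) ord0 = a.
Proof. exact: tnth0. Qed.

Lemma tnth_tuple_consS n (a : T) (y : n.-tuple T) (j : 'I_n) :
  tnth (tuple_cons (a, y)) (lift ord0 j) = tnth y j.
Proof. exact: tnthS. Qed.

Lemma measurable_tuple_consr n (a : T) : measurable_fun setT (fun y : n.-tuple T => tuple_cons (a, y)).
Proof. by apply: (measurableT_comp (@measurable_tuple_cons _ T n)); exact: measurable_pair1. Qed.

Lemma ge0_integral_tuple_cons n (f : n.+1.-tuple T -> \bar R) :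
  measurable_fun setT f -> (forall x, 0 <= f x)%E ->
  (\int[tuple_measure m n.+1]_x f x =
   \int[m]_a \int[tuple_measure m n]_y f (tuple_cons (a, y)))%E.
Proof.
move=> mf f0.
transitivity (\int[pushforward (m \x tuple_measure m n) (@tuple_cons _ T n)]_x f x)%E; first by [].
rewrite (ge0_integral_pushforward (@measurable_tuple_cons _ T n))// preimage_setT fubini_tonelli1//.
  by apply: measurableT_comp => //; exact: measurable_tuple_cons.
by move=> x; exact: f0.
Qed.

Definition box n (A : 'I_n -> set T) : set (n.-tuple T) := [set x | forall i, A i (tnth x i)].

Lemma measurable_box n (A : 'I_n -> set T) : (forall i, measurable (A i)) -> measurable (box A).
Proof.
move=> mA; rewrite (_ : box A = \bigcap_(i in [set: 'I_n]) ((fun x : n.-tuple T => tnth x i) @^-1` A i)).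
  apply: fin_bigcap_measurable => // i _; rewrite -[X in measurable X]setTI.
  exact: measurable_tnth.
by apply/seteqP; split => [x H i _|x H i]; [exact: H|exact: (H i I)].
Qed.

Lemma tuple_measure_box n (A : 'I_n -> set T) : (forall i, measurable (A i)) ->
  (tuple_measure m n (box A) = \prod_(i < n) m (A i))%E.
Proof.
elim: n A => [|n ih] A mA.
  rewrite big_ord0 /= diracE mem_set//; by move=> [].
rewrite big_ord_recl/= /cons_measure /pushforward.
rewrite (_ : _ @^-1` _ = A ord0 `*` box (fun i => A (lift ord0 i))).
  by rewrite product_measure1E ?ih//; exact: measurable_box.
apply/seteqP; split => -[a y] /=.
  move=> H; split; first by have := H ord0; rewrite tnth_tuple_cons0.
  by move=> i; have := H (lift ord0 i); rewrite tnth_tuple_consS.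
move=> [A0 H] i; have [j ->|->] := unliftP ord0 i; last by rewrite tnth_tuple_cons0.
by rewrite tnth_tuple_consS; exact: H.
Qed.

End tuple_integral.

Section translation.
Context {R : realType}.
Local Notation RT := (measurableTypeR R).
Local Notation leb := (@lebesgue_measure R).

Definition translate (c : R) (x : RT) : RT := x + c.

Lemma measurable_translate c : measurable_fun setT (translate c).
Proof. by apply: measurable_funD; [exact: measurable_id|exact: measurable_cst]. Qed.

HB.instance Definition _ c := isMeasurableFun.Build _ _ _ _ (translate c) (measurable_translate c).

Lemma lebesgue_measure_translate c A : measurable A -> leb A = pushforward leb (translate c) A.
Proof.
move=> mA; apply: (@lebesgue_measure_unique R (pushforward leb (translate c))) => // X.
move=> [[a b] _ <-] /=; rewrite /pushforward.
rewrite (_ : translate c @^-1` _ = `]a - c, b - c]%classic); last first.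
  by apply/seteqP; split => x /=; rewrite !in_itv/= /translate ltrBlDr lerBrDr.
rewrite !lebesgue_measure_itv/= !lte_fin ltrD2r.
by case: ifPn => // _; rewrite -!EFinD; congr (_%:E); ring.
Qed.

Lemma ge0_integral_translate c (f : RT -> \bar R) : measurable_fun setT f -> (forall x, 0 <= f x)%E ->
  (\int[leb]_x f (x + c)%R = \int[leb]_x f x)%E.
Proof.
move=> mf f0.
transitivity (\int[pushforward leb (translate c)]_x f x)%E.
  by rewrite (ge0_integral_pushforward (measurable_translate c))// preimage_setT.
by apply/esym/eq_measure_integral => A mA _; exact: lebesgue_measure_translate.
Qed.

End translation.

Section shear.
Context {R : realType}.
Local Notation RT := (measurableTypeR R).
Local Notation nu := (tuple_measure (@lebesgue_measure R)).

Definition tshift n (i : 'I_n) (c : R) (x : n.-tuple RT) : n.-tuple RT :=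
  [tuple (tnth x j + (if j == i then c else 0) : RT) | j < n].

Lemma tnth_tshift n (i j : 'I_n) c (x : n.-tuple RT) :
  tnth (tshift i c x) j = tnth x j + (if j == i then c else 0).
Proof. by rewrite tnth_mktuple. Qed.

Lemma measurable_shear n (i : 'I_n) (phi : n.-tuple RT -> R) : measurable_fun setT phi ->
  measurable_fun setT (fun x => tshift i (phi x) x).
Proof.
move=> mphi; apply/measurable_fun_tnthP => j.
rewrite (_ : _ \o _ = (fun x : n.-tuple RT => (tnth x j : R) + (if j == i then phi x else 0))); last first.
  by apply/funext => x; rewrite /= tnth_tshift.
apply: measurable_funD; first exact: (@measurable_tnth _ RT).
by case: (j == i) => //; exact: measurable_cst.
Qed.

Let tshift0 n (a c : R) (y : n.-tuple RT) : tshift ord0 c (tuple_cons (a : RT, y)) = tuple_cons (a + c : RT, y).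
Proof.
apply: eq_from_tnth => j; rewrite tnth_tshift.
have [k ->|->] := unliftP ord0 j; last by rewrite !tnth_tuple_cons0 eqxx.
by rewrite !tnth_tuple_consS addr0.
Qed.

Let tshiftS n (i : 'I_n) (a c : R) (y : n.-tuple RT) :
  tshift (lift ord0 i) c (tuple_cons (a : RT, y)) = tuple_cons (a : RT, tshift i c y).
Proof.
apply: eq_from_tnth => j; rewrite tnth_tshift.
have [k ->|->] := unliftP ord0 j; last by rewrite !tnth_tuple_cons0 addr0.
by rewrite !tnth_tuple_consS tnth_tshift (inj_eq (@lift_inj _ ord0)).
Qed.

(** Once the other coordinates are fixed the shear translates coordinate i by a constant. Tonelli
    isolates that coordinate when it is the first; induction on n peels off the coordinates before
    it. *)
Lemma ge0_integral_shear n (i : 'I_n) (phi : n.-tuple RT -> R) (f : n.-tuple RT -> \bar R) :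
  measurable_fun setT phi -> (forall c x, phi (tshift i c x) = phi x) ->
  measurable_fun setT f -> (forall x, 0 <= f x)%E ->
  (\int[nu n]_x f (tshift i (phi x) x) = \int[nu n]_x f x)%E.
Proof.
elim: n i phi f => [[]//|n ih] i phi f mphi phii mf f0.
have mfs : measurable_fun setT (fun x => f (tshift i (phi x) x)).
  by apply: measurableT_comp => //; exact: measurable_shear.
rewrite !ge0_integral_tuple_cons//.
have [j ij|i0] := unliftP ord0 i; last first.
  rewrite i0 in phii mfs *.
  pose psi (y : n.-tuple RT) := phi (tuple_cons (0 : RT, y)).
  have phiE (a : RT) y : phi (tuple_cons (a, y)) = psi y.
    by rewrite /psi -[RHS](phii a) tshift0 add0r.
  under eq_integral do under eq_integral do rewrite phiE tshift0.
  pose F (p : RT * n.-tuple RT) := f (tuple_cons (p.1 + psi p.2 : RT, p.2)).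
  have mF : measurable_fun setT F.
    apply: measurableT_comp => //.
    apply: (measurableT_comp (@measurable_tuple_cons _ RT n)).
    apply: measurable_fun_pair => //; apply: measurable_funD; first exact: measurable_fst.
    apply: measurableT_comp => //; apply: measurableT_comp => //.
    exact: measurable_tuple_consr.
  have mG : measurable_fun setT (fun p : RT * n.-tuple RT => f (tuple_cons p)).
    by apply: measurableT_comp => //; exact: measurable_tuple_cons.
  rewrite (@fubini_tonelli _ _ _ _ _ _ _ F)//; last by move=> x; exact: f0.
  rewrite (@fubini_tonelli _ _ _ _ _ _ _ (fun p => f (tuple_cons p)))//.
  apply: eq_integral => y _; rewrite /F/=.
  apply: (@ge0_integral_translate _ (psi y) (fun a => f (tuple_cons (a, y)))) => //.
  exact: (measurableT_comp mG (measurable_pair2 y)).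
rewrite ij in phii *.
apply: eq_integral => a _.
under eq_integral do rewrite tshiftS.
apply: (ih j (fun y => phi (tuple_cons (a, y))) (fun y => f (tuple_cons (a, y)))) => //.
- by apply: measurableT_comp => //; exact: measurable_tuple_consr.
- by move=> c x; rewrite -tshiftS phii.
- by apply: measurableT_comp => //; exact: measurable_tuple_consr.
Qed.

Definition givens n (i j : 'I_n) (c s : R) (x : n.-tuple RT) : n.-tuple RT :=
  [tuple (if k == i then c * tnth x i - s * tnth x j
          else if k == j then s * tnth x i + c * tnth x j else tnth x k : RT) | k < n].

Lemma tnth_givens n (i j k : 'I_n) c s (x : n.-tuple RT) : tnth (givens i j c s x) k =
  if k == i then c * tnth x i - s * tnth x j
  else if k == j then s * tnth x i + c * tnth x j else tnth x k.
Proof. by rewrite tnth_mktuple. Qed.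

Lemma measurable_givens n (i j : 'I_n) c s : measurable_fun setT (givens i j c s).
Proof.
have mt k : measurable_fun setT (fun x : n.-tuple RT => (tnth x k : R)) by exact: (@measurable_tnth _ RT).
have mc k (a : R) : measurable_fun setT (fun x : n.-tuple RT => a * tnth x k) by apply: measurable_funM => //; exact: measurable_cst.
apply/measurable_fun_tnthP => k.
rewrite (_ : _ \o _ = (fun x : n.-tuple RT => if k == i then c * tnth x i - s * tnth x j
  else if k == j then s * tnth x i + c * tnth x j else tnth x k)); last first.
  by apply/funext => x; rewrite /= tnth_givens.
case: (k == i); first exact: measurable_funB.
case: (k == j); first exact: measurable_funD.
exact: mt.
Qed.

(* A plane rotation is a product of three shears, unless it is a half-turn. *)
Lemma ge0_integral_givens n (i j : 'I_n) c s (f : n.-tuple RT -> \bar R) :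
  i != j -> c ^+ 2 + s ^+ 2 = 1 -> measurable_fun setT f -> (forall x, 0 <= f x)%E ->
  (\int[nu n]_x f (givens i j c s x) = \int[nu n]_x f x)%E.
Proof.
move=> ij; have ji : (j == i) = false by rewrite eq_sym (negPf ij).
have {}ij := negPf ij.
have mt k (a : R) : measurable_fun setT (fun x : n.-tuple RT => a * tnth x k).
  by apply: measurable_funM; [exact: measurable_cst|exact: (@measurable_tnth _ RT)].
have main c' s' (g : n.-tuple RT -> \bar R) : s' != 0 -> c' ^+ 2 + s' ^+ 2 = 1 ->
    measurable_fun setT g -> (forall x, 0 <= g x)%E ->
    (\int[nu n]_x g (givens i j c' s' x) = \int[nu n]_x g x)%E.
  (* For an angle th, t is -tan(th/2). Adding t x_j to x_i, then s x_i to x_j, then t x_j to x_i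
     gives the rotation. *)
  move=> s0 cs mg g0; pose t := (c' - 1) / s'.
  pose a (x : n.-tuple RT) := t * tnth x j.
  pose b (x : n.-tuple RT) := s' * tnth x i.
  rewrite -(@ge0_integral_shear n i a g)//; last first.
  - by move=> e x; rewrite /a tnth_tshift ji addr0.
  - exact: mt.
  have m1 : measurable_fun setT (fun x => g (tshift i (a x) x)).
    by apply: measurableT_comp => //; apply: measurable_shear; exact: mt.
  rewrite -(@ge0_integral_shear n j b (fun x => g (tshift i (a x) x)))//; last first.
  - by move=> e x; rewrite /b tnth_tshift ij addr0.
  - exact: mt.
  have m2 : measurable_fun setT (fun x => g (tshift i (a (tshift j (b x) x)) (tshift j (b x) x))).
    apply: (measurableT_comp m1); apply: measurable_shear; exact: mt.
  rewrite -(@ge0_integral_shear n i a (fun x => g (tshift i (a (tshift j (b x) x)) (tshift j (b x) x))))//; last first.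
  - by move=> e x; rewrite /a tnth_tshift ji addr0.
  - exact: mt.
  apply: eq_integral => x _; congr g; apply: eq_from_tnth => k.
  rewrite tnth_givens !tnth_tshift /a /b !tnth_tshift !eqxx ?ij ?ji /t !addr0.
  have [->|ki] := eqVneq k i.
    rewrite ij addr0; apply: (mulfI s0).
    have -> : s' * (c' * tnth x i - s' * tnth x j) = s' * c' * tnth x i - (1 - c' ^+ 2) * tnth x j.
      by rewrite -cs; ring.
    by field.
  by have [->|kj] := eqVneq k j; rewrite !addr0//; field.
move=> cs mf f0; have [s0|s0] := eqVneq s 0; last exact: main.
have {cs} : (c == 1) || (c == -1).
  by rewrite -sqrf_eq1 -cs s0 expr0n addr0.
case/orP => /eqP ->; rewrite s0.
  apply: eq_integral => x _; congr f; apply: eq_from_tnth => k; rewrite tnth_givens !mul0r !mul1r.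
  by have [->|_] := eqVneq k i; [rewrite subr0|have [->|//] := eqVneq k j; rewrite add0r].
(* The half-turn is the quarter-turn applied twice. *)
have cs1 : (0 : R) ^+ 2 + 1 ^+ 2 = 1 by rewrite expr0n add0r expr1n.
have mf' : measurable_fun setT (fun x => f (givens i j 0 1 x)).
  by apply: measurableT_comp => //; exact: measurable_givens.
rewrite -(main 0 1 f (oner_neq0 R) cs1 mf f0).
rewrite -(main 0 1 (fun x => f (givens i j 0 1 x)) (oner_neq0 R) cs1 mf')//.
apply: eq_integral => x _; congr f; apply: eq_from_tnth => k; rewrite !tnth_givens !eqxx ?ij ?ji.
have [_|ki] := eqVneq k i; first by ring.
by have [_|kj] := eqVneq k j; ring.
Qed.

Lemma tuple_measure_givens n (i j : 'I_n) c s (A : set (n.-tuple RT)) :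
  i != j -> c ^+ 2 + s ^+ 2 = 1 -> measurable A ->
  nu n (givens i j c s @^-1` A) = nu n A.
Proof.
move=> ij cs mA.
have mgA : measurable (givens i j c s @^-1` A).
  by rewrite -[X in measurable X]setTI; exact: measurable_givens.
have E B : measurable B -> nu n B = (\int[nu n]_x (\1_B x)%:E)%E.
  by move=> mB; rewrite integral_indic// setIT.
rewrite !E// -[RHS](@ge0_integral_givens n i j c s)//.
- exact/measurable_EFinP/measurable_indic.
Qed.

End shear.

(** * The sphere and its surface measure *)

Lemma mnormalizeE d (T : measurableType d) (R : realType) (m : {measure set T -> \bar R})
    (P : probability T R) (A : set T) : (0 < m setT < +oo)%E ->
  mnormalize m P A = (m A * (fine (m setT))^-1%:E)%E.
Proof. by move=> /andP[m0 moo]; rewrite /mnormalize (gt_eqF m0) (lt_eqF moo). Qed.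

Section sphere_geometry.
Context {R : realType} (d : nat).
Local Notation S := (sphere R d).
Local Notation RT := (measurableTypeR R).
Local Notation nu := (tuple_measure (@lebesgue_measure R) d.+1).
Local Notation mu := (sphere_measure R d).
Local Notation ball := (@unit_ball R d.+1).

Definition dotp n (x y : n.-tuple R) : R := \sum_(i < n) tnth x i * tnth y i.
Definition scoord (i : 'I_d.+1) (x : S) : R := tnth (val x) i.
Definition sdot (x y : S) : R := dotp (val x) (val y).

Lemma enorm_ge0 n (x : n.-tuple R) : 0 <= enorm x.
Proof. exact: sqrtr_ge0. Qed.

Lemma enorm_sqr n (x : n.-tuple R) : enorm x ^+ 2 = dotp x x.
Proof.
rewrite /enorm sqr_sqrtr; last by apply: sumr_ge0 => i _; exact: sqr_ge0.
by apply: eq_bigr => i _; rewrite expr2.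
Qed.

Lemma enorm_eq0 n (x : n.-tuple R) : enorm x = 0 -> forall i, tnth x i = 0.
Proof.
move=> x0 i; have := enorm_sqr x; rewrite x0 expr0n/= => /esym/eqP.
rewrite psumr_eq0 => [/allP/(_ i)|j _]; last by rewrite -expr2 sqr_ge0.
by rewrite mem_index_enum => /(_ isT); rewrite mulf_eq0 orbb => /eqP.
Qed.

Lemma edist_sqr n (x y : n.-tuple R) : Defs.edist x y ^+ 2 = dotp x x + dotp y y - 2 * dotp x y.
Proof.
rewrite /Defs.edist enorm_sqr /dotp mulr_sumr -big_split -sumrB; apply: eq_bigr => i _ /=.
by rewrite !tnth_mktuple; ring.
Qed.

Lemma enorm_val (x : S) : enorm (val x) = 1.
Proof. by apply/eqP; exact: (valP x). Qed.

Lemma sdotxx (x : S) : sdot x x = 1.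
Proof. by rewrite /sdot -enorm_sqr enorm_val expr1n. Qed.

Lemma edist_sphere (x y : S) : Defs.edist (val x) (val y) ^+ 2 = 2 - 2 * sdot x y.
Proof.
rewrite edist_sqr; have := sdotxx x; have := sdotxx y; rewrite /sdot => -> ->; ring.
Qed.

Lemma sdot_le1 (x y : S) : sdot x y <= 1.
Proof. by have := sqr_ge0 (Defs.edist (val x) (val y)); rewrite edist_sphere; lra. Qed.

Lemma sdot_geN1 (x y : S) : - 1 <= sdot x y.
Proof.
have : 0 <= \sum_(i < d.+1) (scoord i x + scoord i y) ^+ 2 by apply: sumr_ge0 => i _; exact: sqr_ge0.
have -> : \sum_(i < d.+1) (scoord i x + scoord i y) ^+ 2 = sdot x x + sdot y y + 2 * sdot x y.
  by rewrite /sdot /dotp mulr_sumr -!big_split; apply: eq_bigr => i _ /=; rewrite /scoord; ring.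
rewrite !sdotxx; lra.
Qed.

Lemma sum_scoord_sqr (x : S) : \sum_(i < d.+1) scoord i x ^+ 2 = 1.
Proof. by rewrite -(sdotxx x); apply: eq_bigr => i _; rewrite expr2. Qed.

Lemma scoord_norm (i : 'I_d.+1) (x : S) : `|scoord i x| <= 1.
Proof.
rewrite -(@ler_pXn2r _ 2) ?nnegrE// expr1n real_normK ?num_real// -(sum_scoord_sqr x).
by rewrite (bigD1 i)//= lerDl sumr_ge0// => j _; exact: sqr_ge0.
Qed.

Lemma scoord_pole i : scoord i (sphere_pole R d) = (i == ord0)%:R.
Proof. by rewrite /scoord /= tnth_mktuple. Qed.

Lemma sdot_pole (x : S) : sdot (sphere_pole R d) x = scoord ord0 x.
Proof.
have -> : sdot (sphere_pole R d) x = \sum_(i < d.+1) scoord i (sphere_pole R d) * scoord i x by [].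
rewrite (bigD1 ord0)// scoord_pole eqxx mul1r big1 => [|i /negPf i0]; first exact: addr0.
by rewrite scoord_pole i0 mul0r.
Qed.

Lemma measurable_val : measurable_fun setT (val : S -> d.+1.-tuple RT).
Proof. by move=> _ B mB; exists B. Qed.

Lemma measurable_scoord i : measurable_fun setT (scoord i).
Proof. exact: (measurableT_comp (@measurable_coord R d.+1 i) measurable_val). Qed.

Lemma to_sphereK (v : d.+1.-tuple R) : enorm v = 1 -> val (to_sphere v) = v.
Proof.
move=> v1; rewrite val_to_sphere v1 oner_eq0; apply: eq_from_tnth => i.
by rewrite tnth_mktuple divr1.
Qed.

Section volume.

Let cube (a : d.+1.-tuple R) (r : R) : set (d.+1.-tuple RT) :=
  box (fun i : 'I_d.+1 => `]tnth a i - r, tnth a i + r[%classic).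

Let measurable_cube a r : measurable (cube a r).
Proof. by apply: measurable_box => i. Qed.

Let cube_measure a r : 0 < r -> nu (cube a r) = ((2 * r) ^+ d.+1)%:E.
Proof.
move=> r0; rewrite tuple_measure_box => [|i]; last exact: measurable_itv.
have E (i : 'I_d.+1) : lebesgue_measure (`]tnth a i - r, tnth a i + r[%classic : set R) = (2 * r)%:E.
  rewrite lebesgue_measure_itv/= lte_fin ifT; last by lra.
  by rewrite -EFinD; congr (_%:E); lra.
rewrite (eq_bigr (fun=> (2 * r)%:E)) => [|i _]; last exact: E.
by rewrite -(big_morph _ EFinM (erefl _)) big_const card_ord iter_mulr_1.
Qed.

Lemma ball_lty : (nu ball < +oo)%E.
Proof.
apply: (@le_lt_trans _ _ (nu (cube [tuple 0 | _ < d.+1] 2))); last by rewrite cube_measure// ltry.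
apply: le_measure; rewrite ?inE//; first exact: measurable_unit_ball.
move=> x /= x1 i; rewrite /= in_itv/= tnth_mktuple !add0r.
have : tnth x i ^+ 2 <= 1.
  have : enorm (x : d.+1.-tuple R) ^+ 2 <= 1 by rewrite exprn_ile1// enorm_ge0.
  rewrite enorm_sqr; apply: le_trans; rewrite /dotp (bigD1 i)//= -expr2 lerDl.
  by apply: sumr_ge0 => j _; rewrite -expr2 sqr_ge0.
move=> H; have : `|tnth x i : R| <= 1.
  by rewrite -(@ler_pXn2r _ 2) ?nnegrE// expr1n real_normK ?num_real.
rewrite ler_norml => /andP[? ?]; apply/andP; split; lra.
Qed.

(** Small cubes around x/2 lie in the ball and project near x. Having positive volume, they show
    that every neighbourhood of x has positive surface measure. *)
Let cube_half (x : S) (delta : R) : 0 < delta -> exists2 r : R, 0 < r &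
  forall z, cube [tuple scoord i x / 2 | i < d.+1] r z -> ball z /\
   forall i, `|scoord i (radial z) - scoord i x| < delta.
Proof.
move=> delta0; pose D : R := d.+1%:R.
have D0 : 1 <= D by rewrite ler1n.
pose r := Num.min 1 (Num.min ((16 * D)^-1) (delta / (21 * D))).
(* The bound 1/16 on r D keeps the norm of z within 1/4 of 1/2. The numerator of the projected error
   is below r + 4 r D <= 5 r D and the norm is at least 1/4, so 21 r D <= delta suffices. *)
have r0 : 0 < r by rewrite !lt_min ltr01 invr_gt0 divr_gt0 ?mulr_gt0//; lra.
have r1 : r <= 1 by rewrite !ge_min lexx.
have r2 : r * D <= 16^-1.
  rewrite -ler_pdivlMr; last by lra.
  by rewrite -invfM ge_min ge_min lexx orbT.
have r3 : 21 * (r * D) <= delta.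
  rewrite mulrCA -ler_pdivlMr; last by apply: mulr_gt0; lra.
  by rewrite !ge_min lexx !orbT.
exists r => // z Hz.
have {}Hz i : `|tnth z i - scoord i x / 2| < r.
  have := Hz i; rewrite /= in_itv/= tnth_mktuple => /andP[? ?].
  rewrite ltr_norml; lra.
have N2 : `|enorm (z : d.+1.-tuple R) ^+ 2 - 4^-1| <= 2 * (r * D).
  have -> : enorm (z : d.+1.-tuple R) ^+ 2 - 4^-1 =
     \sum_(i < d.+1) (tnth z i - scoord i x / 2) * (tnth z i + scoord i x / 2).
    have E4 : 4^-1 = \sum_(i < d.+1) 4^-1 * scoord i x ^+ 2 by rewrite -mulr_sumr sum_scoord_sqr mulr1.
    rewrite enorm_sqr [X in _ - X]E4 /dotp -sumrB.
    by apply: eq_bigr => i _; field.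
  apply: le_trans (ler_norm_sum _ _ _) _.
  apply: (@le_trans _ _ (\sum_(i < d.+1) 2 * r)); last first.
    by rewrite sumr_const card_ord -mulr_natr -/D; lra.
  apply: ler_sum => i _; rewrite normrM mulrC ler_pM//; last exact: ltW.
  have := Hz i; have := scoord_norm i x.
  rewrite ler_norml ltr_norml ler_norml; lra.
set N := enorm (z : d.+1.-tuple R) in N2 *.
have N0 : 0 <= N by exact: enorm_ge0.
have Nhalf : `|N - 2^-1| <= 4 * (r * D).
  have E : (N - 2^-1) * (N + 2^-1) = N ^+ 2 - 4^-1 by field.
  move: N2; rewrite -E normrM [X in _ * X]gtr0_norm; last by lra.
  have : `|N - 2^-1| * 2^-1 <= `|N - 2^-1| * (N + 2^-1) by rewrite ler_wpM2l//; lra.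
  lra.
have [Nlo Nhi] : 4^-1 <= N /\ N <= 1.
  by move: Nhalf; rewrite ler_norml; lra.
split => [|i]; first exact: Nhi.
have -> : scoord i (radial z) = tnth z i / N.
  rewrite /scoord /radial val_to_sphere -/N.
  by case: eqP => [N00|_]; [rewrite N00 in Nlo; lra|rewrite tnth_mktuple].
have -> : tnth z i / N - scoord i x = ((tnth z i - scoord i x / 2) + scoord i x * (2^-1 - N)) / N.
  by field; lra.
rewrite normrM normfV (ger0_norm N0) ltr_pdivrMr; last by lra.
apply: le_lt_trans (ler_normD _ _) _.
have : `|scoord i x * (2^-1 - N)| <= 4 * (r * D).
  rewrite normrM -[leRHS]mul1r ler_pM//; first exact: scoord_norm.
  by rewrite distrC.
have : delta * 4^-1 <= delta * N by rewrite ler_wpM2l//; lra.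
have := Hz i.
have : r <= r * D by rewrite ler_peMr//; lra.
lra.
Qed.

Lemma ball_gt0 : (0 < nu ball)%E.
Proof.
have [r r0 Hr] := cube_half (sphere_pole R d) ltr01.
apply: (@lt_le_trans _ _ (nu (cube [tuple scoord i (sphere_pole R d) / 2 | i < d.+1] r))).
  by rewrite cube_measure// lte_fin exprn_gt0// mulr_gt0.
apply: le_measure; rewrite ?inE//; first exact: measurable_unit_ball.
by move=> z /Hr[].
Qed.

Let measurable_radial_pre (A : set S) : measurable A -> measurable (@radial R d @^-1` A).
Proof. by move=> mA; rewrite -[X in measurable X]setTI; exact: (@measurable_to_sphere R d). Qed.

Lemma sphere_measureE (A : set S) : measurable A ->
  mu A = ((fine (nu ball))^-1%:E * nu (@radial R d @^-1` A `&` ball))%E.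
Proof.
move=> mA; have evE : mrestr nu (@measurable_unit_ball R d.+1) setT = nu ball by exact: (congr1 nu (setTI ball)).
apply: etrans; first apply: mnormalizeE.
  by rewrite [X in (_ < X < _)%E]evE ball_gt0 ball_lty.
by rewrite [X in (fine X)]evE muleC.
Qed.

Lemma sphere_measure_cap_gt0 (x : S) (delta : R) : 0 < delta ->
  exists A : set S, [/\ measurable A, (0 < mu A)%E &
    forall y, A y -> forall i, `|scoord i y - scoord i x| < delta].
Proof.
move=> delta0; have [r r0 Hr] := cube_half x delta0.
pose A := \bigcap_(i in [set: 'I_d.+1]) [set y : S | `|scoord i y - scoord i x| < delta].
have mA : measurable A.
  apply: fin_bigcap_measurable => // i _.
  rewrite (_ : [set y | _] = scoord i @^-1` `]scoord i x - delta, scoord i x + delta[%classic).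
    by rewrite -[X in measurable X]setTI; exact: measurable_scoord.
  by apply/seteqP; split => y /=; rewrite in_itv/= ltr_distlC ltrBlDr ?ltrBlDr; lra.
exists A; split => // [|y Ay i]; last exact: Ay.
rewrite sphere_measureE// mule_gt0//.
  by rewrite lte_fin invr_gt0 fine_gt0// ball_gt0 ball_lty.
apply: (@lt_le_trans _ _ (nu (cube [tuple scoord i x / 2 | i < d.+1] r))).
  by rewrite cube_measure// lte_fin exprn_gt0// mulr_gt0.
apply: le_measure; rewrite ?inE//.
  by apply: measurableI; [exact: measurable_radial_pre|exact: measurable_unit_ball].
by move=> z /Hr[bz Hz]; split => //= i _; exact: Hz.
Qed.

Lemma tuple_measure_origin : nu [set x : d.+1.-tuple RT | enorm (x : d.+1.-tuple R) = 0] = 0%E.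
Proof.
apply/eqP; rewrite eq_le measure_ge0 andbT.
apply: (@le_trans _ _ (nu (box (fun=> [set 0 : RT])))).
  apply: le_measure; rewrite ?inE//.
  - rewrite (_ : [set x | _] = (fun x : d.+1.-tuple RT => enorm (x : d.+1.-tuple R)) @^-1` [set 0])//.
    by rewrite -[X in measurable X]setTI; exact: measurable_enorm.
  - exact: measurable_box.
  - by move=> x /= /enorm_eq0 H i; exact: H.
rewrite tuple_measure_box//= big_ord_recl.
by rewrite (_ : lebesgue_measure [set (0 : RT)] = 0%E) ?mul0e//; exact: lebesgue_measure_set1.
Qed.

End volume.

Definition sgivens (i j : 'I_d.+1) (c s : R) (x : S) : S := to_sphere (givens i j c s (val x)).

Lemma measurable_sgivens i j c s : measurable_fun setT (sgivens i j c s).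
Proof.
apply: (measurableT_comp (@measurable_to_sphere R d)).
exact: (measurableT_comp (measurable_givens i j c s) measurable_val).
Qed.

Section givens_facts.
Variables (i j : 'I_d.+1) (c s : R).
Hypotheses (ij : i != j) (cs : c ^+ 2 + s ^+ 2 = 1).

Lemma dotp_givens (x y : d.+1.-tuple R) : dotp (givens i j c s x) (givens i j c s y) = dotp x y.
Proof.
have ji : j != i by rewrite eq_sym.
rewrite /dotp (bigD1 i)//= (bigD1 j)//= [in RHS](bigD1 i)//= [in RHS](bigD1 j)//=.
have -> : \sum_(k < d.+1 | (k != i) && (k != j)) tnth (givens i j c s x) k * tnth (givens i j c s y) k =
          \sum_(k < d.+1 | (k != i) && (k != j)) tnth x k * tnth y k.
  by apply: eq_bigr => k /andP[/negPf ki /negPf kj]; rewrite !tnth_givens ki kj.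
rewrite !addrA; congr (_ + _); rewrite !tnth_givens !eqxx (negPf ji).
rewrite -[RHS]mul1r -cs; ring.
Qed.

Lemma enorm_givens (x : d.+1.-tuple R) : enorm (givens i j c s x : d.+1.-tuple R) = enorm x.
Proof.
apply/eqP; rewrite -(@eqrXn2 _ 2)// ?enorm_ge0// !enorm_sqr.
by apply/eqP; exact: dotp_givens.
Qed.

Lemma val_sgivens (x : S) : val (sgivens i j c s x) = givens i j c s (val x).
Proof. by rewrite to_sphereK// enorm_givens enorm_val. Qed.

Lemma scoord_sgivens k (x : S) : scoord k (sgivens i j c s x) =
  if k == i then c * scoord i x - s * scoord j x
  else if k == j then s * scoord i x + c * scoord j x else scoord k x.
Proof. by rewrite /scoord val_sgivens tnth_givens. Qed.

Lemma to_sphere_givens (x : d.+1.-tuple R) : enorm x != 0 ->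
  to_sphere (givens i j c s x) = sgivens i j c s (to_sphere x).
Proof.
move=> x0; apply: val_inj; apply: eq_from_tnth => k.
rewrite val_sgivens [LHS](_ : _ = tnth (givens i j c s x) k / enorm x); last first.
  by rewrite val_to_sphere enorm_givens (negPf x0) tnth_mktuple.
rewrite !tnth_givens !val_to_sphere (negPf x0) !tnth_mktuple.
by case: ifP => _; [ring|case: ifP => _; ring].
Qed.

(** Radial projection commutes with rotations away from the origin, which is sent to an arbitrary
    point; the origin, a null set, is removed before comparing volumes. *)
Lemma sphere_measure_sgivens (A : set S) : measurable A -> mu (sgivens i j c s @^-1` A) = mu A.
Proof.
move=> mA.
have mgA : measurable (sgivens i j c s @^-1` A).
  by rewrite -[X in measurable X]setTI; exact: measurable_sgivens.
have mr (B : set S) : measurable B -> measurable (@radial R d @^-1` B `&` ball).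
  move=> mB; apply: measurableI; last exact: measurable_unit_ball.
  by rewrite -[X in measurable X]setTI; exact: (@measurable_to_sphere R d).
rewrite (sphere_measureE mgA) (sphere_measureE mA).
suff -> : nu (@radial R d @^-1` (sgivens i j c s @^-1` A) `&` ball) = nu (@radial R d @^-1` A `&` ball) by [].
rewrite -[RHS](@tuple_measure_givens R d.+1 i j c s _ ij cs (mr _ mA)).
set O := [set x : d.+1.-tuple RT | enorm (x : d.+1.-tuple R) = 0].
have mO : measurable O.
  rewrite (_ : O = (fun x : d.+1.-tuple RT => enorm (x : d.+1.-tuple R)) @^-1` [set 0])//.
  by rewrite -[X in measurable X]setTI; exact: measurable_enorm.
have mg : measurable (givens i j c s @^-1` (@radial R d @^-1` A `&` ball)).
  rewrite -[X in measurable X]setTI; apply: measurable_givens => //; exact: mr.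
have drop (B : set (d.+1.-tuple RT)) : measurable B -> nu B = nu (B `\` O).
  move=> mB; rewrite -[in LHS](setDUK (_ : B `&` O `<=` B)); last exact: subIsetl.
  have mBO : measurable (B `&` O) by exact: measurableI.
  have z : nu (B `&` O) = 0%E.
    apply/eqP; rewrite eq_le measure_ge0 andbT -[X in (_ <= X)%E](@tuple_measure_origin).
    by apply: le_measure; [exact/mem_set|exact/mem_set|exact: subIsetr].
  rewrite measureU//; last by rewrite setDE setIA setIC setIA setICl set0I.
    by rewrite [X in (X + _)%E]z add0e setDIr setDv set0U.
  exact: measurableD.
rewrite (drop _ (mr _ mgA)) [RHS](drop _ mg).
suff -> : (@radial R d @^-1` (sgivens i j c s @^-1` A) `&` ball) `\` O =
  givens i j c s @^-1` (@radial R d @^-1` A `&` ball) `\` O by [].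
apply/seteqP; split => x /= [[Ax bx] x0]; split => //.
- split; last by rewrite /unit_ball/= enorm_givens.
  by rewrite /radial to_sphere_givens//; exact/eqP.
- split; last by move: bx; rewrite /unit_ball/= enorm_givens.
  by move: Ax; rewrite /radial to_sphere_givens//; exact/eqP.
Qed.

End givens_facts.

End sphere_geometry.

(** * Integrals of bounded functions *)

Section bounded_functions.
Context {d : measure_display} {T : measurableType d} {R : realType}.
Variable m : {measure set T -> \bar R}.
Implicit Types f g : T -> R.

(** Bounded measurable functions form an algebra and are integrable for a finite measure, so
    integrability follows from the shape of the integrand. *)
Definition bmeas f := measurable_fun setT f /\ exists M, forall x, `|f x| <= M.

Lemma bmeas_cst (c : R) : bmeas (fun=> c).
Proof. by split; [exact: measurable_cst|exists `|c|]. Qed.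

Lemma bmeasD f g : bmeas f -> bmeas g -> bmeas (fun x => f x + g x).
Proof.
move=> [mf [M fM]] [mg [N gN]]; split; first exact: measurable_funD.
by exists (M + N) => x; rewrite (le_trans (ler_normD _ _))// lerD.
Qed.

Lemma bmeasM f g : bmeas f -> bmeas g -> bmeas (fun x => f x * g x).
Proof.
move=> [mf [M fM]] [mg [N gN]]; split; first exact: measurable_funM.
by exists (M * N) => x; rewrite normrM ler_pM.
Qed.

Lemma bmeasZ c f : bmeas f -> bmeas (fun x => c * f x).
Proof. by apply: bmeasM; exact: bmeas_cst. Qed.

Lemma bmeasN f : bmeas f -> bmeas (fun x => - f x).
Proof. by move=> [mf [M fM]]; split; [exact: measurable_funN|exists M => x; rewrite normrN]. Qed.

Lemma bmeasB f g : bmeas f -> bmeas g -> bmeas (fun x => f x - g x).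
Proof. by move=> bf bg; apply: bmeasD => //; exact: bmeasN. Qed.

Lemma bmeasX n f : bmeas f -> bmeas (fun x => f x ^+ n).
Proof.
move=> bf; elim: n => [|n ih]; first by under eq_fun do rewrite expr0; exact: bmeas_cst.
by under eq_fun do rewrite exprS; exact: bmeasM.
Qed.

Lemma bmeas_sum I (r : seq I) (P : pred I) (F : I -> T -> R) :
  (forall i, P i -> bmeas (F i)) -> bmeas (fun x => \sum_(i <- r | P i) F i x).
Proof.
move=> bF; elim: r => [|i r ih]; first by under eq_fun do rewrite big_nil; exact: bmeas_cst.
under eq_fun do rewrite big_cons; have [Pi|_] := boolP (P i); last exact: ih.
by apply: bmeasD => //; exact: bF.
Qed.

Lemma bmeas_prod I (r : seq I) (P : pred I) (F : I -> T -> R) :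
  (forall i, P i -> bmeas (F i)) -> bmeas (fun x => \prod_(i <- r | P i) F i x).
Proof.
move=> bF; elim: r => [|i r ih]; first by under eq_fun do rewrite big_nil; exact: bmeas_cst.
under eq_fun do rewrite big_cons; have [Pi|_] := boolP (P i); last exact: ih.
by apply: bmeasM => //; exact: bF.
Qed.

Hypothesis mT : (m setT < +oo)%E.

Lemma bmeas_integrable f : bmeas f -> m.-integrable setT (EFin \o f).
Proof.
move=> [mf [M fM]]; apply: measurable_bounded_integrable => //.
exists M; split; first exact: num_real.
by move=> x Mx y _; exact: le_trans (fM y) (ltW Mx).
Qed.

Lemma integrable_bmeasM f g : bmeas f -> m.-integrable setT (EFin \o g) ->
  m.-integrable setT (EFin \o (fun x => f x * g x)).
Proof.
move=> [mf [M fM]] ig; have mg : measurable_fun setT g by apply/measurable_EFinP; exact: measurable_int ig.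
apply: (@le_integrable _ _ _ m setT measurableT _ (fun x => M%:E * (EFin \o g) x)%E).
- by apply/measurable_EFinP; exact: measurable_funM.
- move=> x _ /=; rewrite !normrM lee_fin ler_pM//.
  by rewrite (le_trans (fM x))// ler_norm.
- exact: integrableZl.
Qed.

Lemma RintD f g : m.-integrable setT (EFin \o f) -> m.-integrable setT (EFin \o g) ->
  (\int[m]_x (f x + g x) = \int[m]_x f x + \int[m]_x g x)%R.
Proof. by move=> ? ?; rewrite RintegralD. Qed.

Lemma RintB f g : m.-integrable setT (EFin \o f) -> m.-integrable setT (EFin \o g) ->
  (\int[m]_x (f x - g x) = \int[m]_x f x - \int[m]_x g x)%R.
Proof. by move=> ? ?; rewrite RintegralB. Qed.

Lemma RintZ c f : m.-integrable setT (EFin \o f) -> (\int[m]_x (c * f x) = c * \int[m]_x f x)%R.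
Proof. by move=> ?; rewrite RintegralZl. Qed.

Lemma integrable_add f g : m.-integrable setT (EFin \o f) -> m.-integrable setT (EFin \o g) ->
  m.-integrable setT (EFin \o (fun x => f x + g x)).
Proof. by move=> intf intg; exact: (integrableD measurableT intf intg). Qed.

Lemma Rint_sum I (r : seq I) (F : I -> T -> R) :
  (forall i, bmeas (F i)) -> (\int[m]_x (\sum_(i <- r) F i x) = \sum_(i <- r) \int[m]_x F i x)%R.
Proof.
move=> bF; elim: r => [|i r ih].
  rewrite big_nil; under eq_Rintegral do rewrite big_nil.
  by rewrite Rintegral_cst// mul0r.
rewrite big_cons -ih; under eq_Rintegral do rewrite big_cons.
by rewrite RintD//; apply: bmeas_integrable => //; exact: bmeas_sum.
Qed.

Lemma EFin_Rint f : m.-integrable setT (EFin \o f) -> (\int[m]_x f x)%R%:E = (\int[m]_x (f x)%:E)%E.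
Proof. by move=> i; rewrite /Rintegral fineK//; exact: integrable_fin_num. Qed.

Lemma Rint_dominated (N : set T) (f_ : nat -> T -> R) (f g : T -> R) :
  measurable N -> m N = 0%E ->
  (forall n, measurable_fun setT (f_ n)) -> measurable_fun setT f ->
  (forall x, ~ N x -> f_ n x @[n --> \oo] --> f x) ->
  m.-integrable setT (EFin \o g) -> (forall n x, ~ N x -> `|f_ n x| <= g x) ->
  (\int[m]_x f_ n x)%R @[n --> \oo] --> (\int[m]_x f x)%R.
Proof.
move=> mN N0 mf_ mf ff ig fg.
have H1 : {ae m, forall x, setT x -> (f_ n x)%:E @[n --> \oo] --> (f x)%:E}.
  exists N; split => // x /= H; apply: contrapT => Nx; apply: H => _.
  by apply: cvg_EFin; [exact: nearW|exact: ff].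
have H2 : {ae m, forall x n, setT x -> (`|(f_ n x)%:E| <= (g x)%:E)%E}.
  exists N; split => // x /= H; apply: contrapT => Nx; apply: H => n _.
  by rewrite lee_fin fg.
have [intf _ L] := @dominated_convergence _ _ _ m setT measurableT (fun n x => (f_ n x)%:E)
  (EFin \o f) (EFin \o g) (fun n => (measurable_EFinP _ _).2 (mf_ n)) ((measurable_EFinP _ _).2 mf) H1 ig H2.
by apply: fine_cvg; rewrite -/(Rintegral _ _ _) EFin_Rint//; exact: L.
Qed.

Lemma le_Rint_ae (N : set T) f g : measurable N -> m N = 0%E ->
  m.-integrable setT (EFin \o f) -> m.-integrable setT (EFin \o g) ->
  (forall x, ~ N x -> f x <= g x) -> (\int[m]_x f x <= \int[m]_x g x)%R.
Proof.
move=> mN N0 intf intg fg.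
rewrite -lee_fin !EFin_Rint//.
rewrite (negligible_integral mN measurableT intf N0) (negligible_integral mN measurableT intg N0).
have mTN : measurable (setT `\` N) by exact: measurableD.
have iS h : m.-integrable setT h -> m.-integrable (setT `\` N) h.
  by apply: integrableS => //; exact: subsetT.
apply: le_integral; [exact: mTN|exact: iS intf|exact: iS intg|].
by move=> x; rewrite inE => -[_ Nx]; rewrite lee_fin fg.
Qed.

End bounded_functions.

(** * Rotations and integration by parts on the sphere *)

Section rotations.
Context {R : realType} {d : nat}.
Local Notation S := (sphere R d).
Local Notation mu := (sphere_measure R d).
Implicit Types (x y z : S) (g h : S -> S).

Definition linear_action g := exists M : 'I_d.+1 -> 'I_d.+1 -> R,
  forall i x, scoord i (g x) = \sum_(j < d.+1) M i j * scoord j x.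

(** The properties of orthogonal maps that are used, established for products of plane rotations.
    The left inverse also acts linearly, so that composing with it preserves polynomials of bounded
    degree. *)
Definition rotation g := [/\ measurable_fun setT g,
  (forall A, measurable A -> mu (g @^-1` A) = mu A),
  linear_action g,
  (exists2 g', linear_action g' & cancel g g') &
  (forall x y, sdot (g x) (g y) = sdot x y)].

Lemma eq_scoord x y : (forall i, scoord i x = scoord i y) -> x = y.
Proof. by move=> xy; apply: val_inj; apply: eq_from_tnth => i; exact: xy. Qed.

Lemma linear_action_id : linear_action id.
Proof.
exists (fun i j => (i == j)%:R) => i x; rewrite (bigD1 i)//= eqxx mul1r big1 ?addr0// => j ji.
by rewrite eq_sym (negPf ji) mul0r.
Qed.

Lemma linear_action_comp g h : linear_action g -> linear_action h -> linear_action (g \o h).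
Proof.
move=> [M gM] [N hN]; exists (fun i k => \sum_(j < d.+1) M i j * N j k) => i x /=.
transitivity (\sum_(j < d.+1) \sum_(k < d.+1) M i j * (N j k * scoord k x)).
  by rewrite gM; apply: eq_bigr => j _; rewrite hN mulr_sumr.
rewrite exchange_big; apply: eq_bigr => k _; rewrite mulr_suml.
by apply: eq_bigr => j _; rewrite mulrA.
Qed.

Lemma rotation_id : rotation id.
Proof.
split => //; first exact: linear_action_id.
by exists id => //; exact: linear_action_id.
Qed.

Lemma rotation_comp g h : rotation g -> rotation h -> rotation (g \o h).
Proof.
move=> [mg ig lg [g' lg' gK] sg] [mh ih lh [h' lh' hK] sh]; split.
- exact: measurableT_comp mg mh.
- move=> A mA; rewrite comp_preimage ih ?ig//.
  by rewrite -[X in measurable X]setTI; exact: mg.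
- exact: linear_action_comp.
- by exists (h' \o g'); [exact: linear_action_comp|exact: can_comp].
- by move=> x y /=; rewrite sg sh.
Qed.

Lemma linear_action_sgivens (i j : 'I_d.+1) (c s : R) : i != j -> c ^+ 2 + s ^+ 2 = 1 ->
  linear_action (sgivens i j c s).
Proof.
move=> ij cs.
exists (fun k l => if k == i then c * (i == l)%:R - s * (j == l)%:R
   else if k == j then s * (i == l)%:R + c * (j == l)%:R else (k == l)%:R) => k x.
have D (a : 'I_d.+1) : \sum_(l < d.+1) (a == l)%:R * scoord l x = scoord a x.
  rewrite (bigD1 a)//= eqxx mul1r big1 ?addr0// => l la.
  by rewrite eq_sym (negPf la) mul0r.
rewrite scoord_sgivens//; case: ifP => _; last case: ifP => _; last by rewrite D.
- under eq_bigr do rewrite mulrBl -!mulrA.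
  by rewrite sumrB -!mulr_sumr !D.
- under eq_bigr do rewrite mulrDl -!mulrA.
  by rewrite big_split -!mulr_sumr !D.
Qed.

Lemma rotation_sgivens (i j : 'I_d.+1) (c s : R) : i != j -> c ^+ 2 + s ^+ 2 = 1 ->
  rotation (sgivens i j c s).
Proof.
move=> ij cs; have cs' : c ^+ 2 + (- s) ^+ 2 = 1 by rewrite sqrrN.
have ji : j != i by rewrite eq_sym.
split.
- exact: measurable_sgivens.
- exact: sphere_measure_sgivens.
- exact: linear_action_sgivens.
- exists (sgivens i j c (- s)); first exact: linear_action_sgivens.
  move=> x; apply: eq_scoord => k; rewrite !scoord_sgivens// !eqxx (negPf ji).
  case: eqP => [->|_]; last case: eqP => [->|//].
    by rewrite -[RHS]mul1r -cs; ring.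
  by rewrite -[RHS]mul1r -cs; ring.
- by move=> x y; rewrite /sdot !val_sgivens// dotp_givens.
Qed.

Lemma integral_rotation g (F : S -> \bar R) : rotation g -> measurable_fun setT F ->
  (\int[mu]_x F (g x) = \int[mu]_x F x)%E.
Proof.
move=> [mg ig _ _ _] mF.
have K (f : S -> \bar R) : measurable_fun setT f -> (forall x, 0 <= f x)%E ->
    (\int[mu]_x f (g x) = \int[mu]_x f x)%E.
  move=> mf f0; rewrite -[RHS](@eq_measure_integral _ _ _ setT mu (pushforward mu g)).
    by rewrite [RHS](ge0_integral_pushforward mg).
  by move=> A mA _; exact: ig.
rewrite integralE [RHS]integralE.
rewrite -[in RHS](K _ (measurable_funepos mF) (funepos_ge0 F)).
rewrite -[in RHS](K _ (measurable_funeneg mF) (funeneg_ge0 F)).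
by congr (_ - _)%E; apply: eq_integral => x _; rewrite ?funeposE ?funenegE.
Qed.

Lemma Rintegral_rotation g (f : S -> R) : rotation g -> measurable_fun setT f ->
  (\int[mu]_x f (g x) = \int[mu]_x f x)%R.
Proof.
move=> rg mf; rewrite /Rintegral.
by rewrite (@integral_rotation g (fun x => (f x)%:E))//; exact/measurable_EFinP.
Qed.

Lemma scoord0_pole x : scoord ord0 x = 1 -> x = sphere_pole R d.
Proof.
move=> x1; apply: eq_scoord => i; rewrite scoord_pole; case: eqP => [->//|/eqP i0].
have := sum_scoord_sqr x; rewrite (bigD1 ord0)//= x1 expr1n => /eqP.
rewrite -[X in _ == X]addr0 (inj_eq (addrI 1)) psumr_eq0 => [/allP/(_ i)|j _]; last exact: sqr_ge0.
by rewrite mem_index_enum i0 sqrf_eq0 => /(_ isT)/eqP.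
Qed.

Lemma eliminate_coord (p k : 'I_d.+1) x : p != k -> exists g, [/\ rotation g,
  scoord k (g x) = 0, 0 <= scoord p (g x) &
  forall l z, l != p -> l != k -> scoord l (g z) = scoord l z].
Proof.
move=> pk; have kp : k != p by rewrite eq_sym.
pose r2 := scoord p x ^+ 2 + scoord k x ^+ 2.
have r20 : 0 <= r2 by rewrite addr_ge0 ?sqr_ge0.
have [r0|r0] := eqVneq r2 0.
  exists id; split => //; first exact: rotation_id.
    by move/eqP: r0; rewrite paddr_eq0 ?sqr_ge0// !sqrf_eq0 => /andP[_ /eqP].
  by move/eqP: r0; rewrite paddr_eq0 ?sqr_ge0// !sqrf_eq0 => /andP[/eqP-> _].
pose r := Num.sqrt r2.
have rr : r ^+ 2 = r2 by rewrite sqr_sqrtr.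
have rn0 : r != 0 by rewrite -sqrf_eq0 rr.
have cs : (scoord p x / r) ^+ 2 + (- scoord k x / r) ^+ 2 = 1.
  by rewrite !expr_div_n sqrrN -mulrDl rr divff.
exists (sgivens p k (scoord p x / r) (- scoord k x / r)); split.
- exact: rotation_sgivens.
- by rewrite scoord_sgivens// (negPf kp) eqxx; field.
- rewrite scoord_sgivens// eqxx.
  have -> : scoord p x / r * scoord p x - - scoord k x / r * scoord k x = r2 / r.
    by rewrite /r2; field.
  by rewrite divr_ge0// sqrtr_ge0.
- by move=> l z /negPf lp /negPf lk; rewrite scoord_sgivens// lp lk.
Qed.

Lemma eliminate_coords (p : 'I_d.+1) (s : seq 'I_d.+1) x : p \notin s -> exists g, [/\ rotation g,
  (forall k, k \in s -> scoord k (g x) = 0), (s != [::] -> 0 <= scoord p (g x)) &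
  forall l z, l != p -> l \notin s -> scoord l (g z) = scoord l z].
Proof.
elim: s => [_|k s ih]; first by exists id; split => //; exact: rotation_id.
rewrite inE negb_or => /andP[pk ps]; have [g [rg g0 _ gs]] := ih ps.
have [h [rh h0 hp hs]] := eliminate_coord (g x) pk.
exists (h \o g); split => //; first exact: rotation_comp.
- move=> l; rewrite inE; case: (eqVneq l k) => [-> _ //|lk /= ls].
  have lp : l != p by apply: contraNneq ps => <-.
  by rewrite hs// g0.
- by move=> l z lp; rewrite inE negb_or => /andP[lk ls] /=; rewrite hs// gs.
Qed.

Lemma rotation_to_pole x : (0 < d)%N -> exists2 g, rotation g & g x = sphere_pole R d.
Proof.
move=> d0; have [|g [rg g0 gp _]] := @eliminate_coords ord0 [seq i <- enum 'I_d.+1 | i != ord0] x.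
  by rewrite mem_filter eqxx.
exists g => //; apply: scoord0_pole.
have : scoord ord0 (g x) ^+ 2 = 1.
  rewrite -(sum_scoord_sqr (g x)) (bigD1 ord0)//= big1 ?addr0// => i i0.
  by rewrite g0 ?expr0n// mem_filter i0 mem_enum.
have {}gp : 0 <= scoord ord0 (g x).
  apply: gp; apply/eqP => s0.
  (* As d > 0, there is a coordinate to eliminate, which makes the pivot nonnegative. *)
  have : ord_max \in [seq i <- enum 'I_d.+1 | i != ord0] by rewrite mem_filter mem_enum -val_eqE/= -lt0n d0.
  by rewrite s0.
by move=> /eqP; rewrite sqrf_eq1 => /orP[/eqP//|/eqP E]; rewrite E in gp; lra.
Qed.

Lemma rotation_normal_form x y : (0 < d)%N -> exists g, [/\ rotation g, g x = sphere_pole R d &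
  forall k : 'I_d.+1, (1 < k)%N -> scoord k (g y) = 0].
Proof.
move=> d0; have [g rg gx] := rotation_to_pole x d0.
have [|h [rh h0 _ hs]] := @eliminate_coords (inord 1) [seq i : 'I_d.+1 <- enum 'I_d.+1 | (1 < i)%N] (g y).
  by rewrite mem_filter inordK.
exists (h \o g); split; first exact: rotation_comp.
- apply: scoord0_pole => /=; rewrite hs ?gx ?scoord_pole ?eqxx//.
    by rewrite -val_eqE/= inordK.
  by rewrite mem_filter.
- by move=> k k1; apply: h0; rewrite mem_filter k1 mem_enum.
Qed.

Section integration_by_parts.
Local Notation t x := (scoord ord0 x).

Lemma bmeas_scoord i : bmeas (scoord i : S -> R).
Proof. by split; [exact: measurable_scoord|exists 1 => x; exact: scoord_norm]. Qed.

Lemma sphere_measureT : mu setT = 1%E. Proof. exact: probability_setT. Qed.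

Lemma sphere_measure_lty : (mu setT < +oo)%E.
Proof. by rewrite sphere_measureT ltry. Qed.

Variables (f f' : R -> R) (M : R).
Hypothesis df : forall u : R, -1 <= u <= 1 -> is_derive u 1 f (f' u).
Hypothesis f_le : forall u : R, -1 <= u <= 1 -> `|f u| <= M /\ `|f' u| <= M.
Hypothesis mf : measurable_fun setT (fun x : S => f (t x)).
Hypothesis mf' : measurable_fun setT (fun x : S => f' (t x)).

Let t_itv x : -1 <= t x <= 1.
Proof. by have := scoord_norm ord0 x; rewrite ler_norml. Qed.

Let M0 : 0 <= M.
Proof. by have [|+ _] := @f_le 0 _; [rewrite lerN10 ler01|exact: le_trans]. Qed.

Let bf : bmeas (fun x : S => f (t x)).
Proof. by split => //; exists M => x; have [] := f_le (t_itv x). Qed.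

Let bf' : bmeas (fun x : S => f' (t x)).
Proof. by split => //; exists M => x; have [] := f_le (t_itv x). Qed.

(* The integral of [scoord j (rot th x) * f (t (rot th x))] does not depend on *)
(* the angle [th]; this is its derivative at [0].                             *)
Lemma Rintegral_rotation_derive (j : 'I_d.+1) : j != ord0 ->
  (\int[mu]_x (t x * f (t x) - scoord j x ^+ 2 * f' (t x)) = 0)%R.
Proof.
move=> j0; have oj : ord0 != j by rewrite eq_sym.
pose rot (th : R) : S -> S := sgivens ord0 j (cos th) (sin th).
have cs th : cos th ^+ 2 + sin th ^+ 2 = 1 :> R by exact: cos2Dsin2.
pose F (x : S) := scoord j x * f (t x).
have bF : bmeas F by apply: bmeasM => //; exact: bmeas_scoord.
pose h (th : R) (x : S) := F (rot th x).
have rr th : rotation (rot th) by exact: rotation_sgivens.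
have bh th : bmeas (h th).
  have [mF [N FN]] := bF; split; last by exists N => x; exact: FN.
  by have [mr _ _ _ _] := rr th; exact: measurableT_comp mF mr.
have dh (th : R) x : is_derive th (1 : R) (h ^~ x) (t (rot th x) * f (t (rot th x)) - scoord j (rot th x) ^+ 2 * f' (t (rot th x))).
  have E : h ^~ x = (fun a : R => (sin a * t x + cos a * scoord j x) * f (cos a * t x - sin a * scoord j x)).
    by apply/funext => a; rewrite /h /F /rot !scoord_sgivens// eqxx (negPf j0) eqxx.
  have T : t (rot th x) = cos th * t x - sin th * scoord j x by rewrite scoord_sgivens// eqxx.
  have J : scoord j (rot th x) = sin th * t x + cos th * scoord j x by rewrite scoord_sgivens// (negPf j0) eqxx.
  rewrite E.
  have D1 : is_derive th 1 (fun a : R => sin a * t x + cos a * scoord j x) (cos th * t x - sin th * scoord j x).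
    by apply: is_derive_eq; rewrite /GRing.scale/=; ring.
  have D2 : is_derive th 1 (fun a : R => cos a * t x - sin a * scoord j x) (- (sin th * t x + cos th * scoord j x)).
    by apply: is_derive_eq; rewrite /GRing.scale/=; ring.
  have D3 : is_derive th 1 (fun a : R => f (cos a * t x - sin a * scoord j x))
      (- (sin th * t x + cos th * scoord j x) * f' (t (rot th x))).
    rewrite mulrC; apply: (@is_derive1_comp _ f (fun a : R => cos a * t x - sin a * scoord j x)).
    by rewrite -T; apply: df; exact: t_itv.
  apply: is_derive_eq; rewrite -J -T /GRing.scale/=; ring.
have := @differentiation_under_integral R _ S mu h setT measurableT 0 (-1) 1 _ _ _ (fun=> M + M) _ _ _.
have -> : (fun a : R => (\int[mu]_x h a x)%R) = cst (\int[mu]_x F x)%R.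
  apply/funext => a; rewrite /h (@Rintegral_rotation (rot a) F)//; exact: bF.1.
rewrite derive1_cst => H.
have R0 : rot 0 = id.
  apply/funext => x; apply: eq_scoord => k; rewrite scoord_sgivens// cos0 sin0.
  by case: eqP => [->|_]; [ring|case: eqP => [->|//]; ring].
rewrite H.
- apply: eq_Rintegral => x _; rewrite partial1of2E.
  have -> : (fun a => h a x) = h ^~ x by [].
  by rewrite derive_val R0.
- by rewrite /= in_itv/= ltrN10 ltr01.
- by move=> a _; apply: bmeas_integrable => //; exact: sphere_measure_lty.
- by move=> a x _ _; case: (dh a x).
- by move=> x; rewrite addr_ge0.
- apply: bmeas_integrable; [exact: sphere_measure_lty|exact: bmeas_cst].
- move=> a x _ _; rewrite partial1of2E derive_val.
  rewrite (le_trans (ler_normB _ _))// lerD// normrM -[leRHS]mul1r ler_pM//.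
  + exact: scoord_norm.
  + by have [] := f_le (t_itv (rot a x)).
  + by rewrite normrX exprn_ile1// scoord_norm.
  + by have [] := f_le (t_itv (rot a x)).
Qed.

(** Sum of the previous identity over the d coordinates other than the first, whose squares add up
    to 1 - t^2. *)
Lemma sphere_integration_by_parts :
  (\int[mu]_x (d%:R * (t x * f (t x)) - (1 - t x ^+ 2) * f' (t x)) = 0)%R.
Proof.
have E x : d%:R * (t x * f (t x)) - (1 - t x ^+ 2) * f' (t x) =
   \sum_(j <- enum 'I_d.+1 | j != ord0) (t x * f (t x) - scoord j x ^+ 2 * f' (t x)).
  have c : #|[pred j : 'I_d.+1 | j != ord0]| = d by have := cardC1 (@ord0 d); rewrite card_ord.
  rewrite big_enum_cond sumrB -mulr_suml sumr_const [in RHS](_ : #|_| = d)//.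
  rewrite -[X in (X - _) * f' _](sum_scoord_sqr x) (bigD1 ord0)//= addrAC subrr add0r.
  by rewrite mulr_suml mulrA mulr_natl.
under eq_Rintegral do rewrite E -big_filter.
rewrite Rint_sum; last first.
- move=> j; apply: bmeasB; apply: bmeasM => //; first exact: bmeas_scoord.
  by apply: bmeasX; exact: bmeas_scoord.
- exact: sphere_measure_lty.
rewrite big_seq big1// => j; rewrite mem_filter => /andP[j0 _].
exact: Rintegral_rotation_derive.
Qed.

End integration_by_parts.
End rotations.

(** * Logarithmic integrals on the sphere *)

Lemma ln_le_sub1 (R : realType) (x : R) : 0 < x -> ln x <= x - 1.
Proof.
move=> x0; have := @le_ln1Dx R (x - 1) _; rewrite (addrC 1) subrK; apply; lra.
Qed.

Section log_energy.
Context {R : realType}.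
Implicit Types (s u : R) (n m : nat).

(** The logarithmic kernel in terms of the inner product s, from |x - y|^2 = 2 (1 - s). *)
Definition log_sdot s : \bar R := if s == 1 then +oo%E else (- 2^-1 * (ln 2 + ln (1 - s)))%:E.

(* Bounded on [-1, 1] and increasing to [log_sdot]. *)
Definition log_trunc n s : R := - 2^-1 * (ln 2 + ln (1 - s + n.+1%:R^-1)).

Lemma log_kernelE d (x y : sphere R d) : log_kernel x y = log_sdot (sdot x y).
Proof.
have e0 : 0 <= Defs.edist (val x) (val y) by exact: enorm_ge0.
have := edist_sphere x y; rewrite /log_kernel /log_sdot; move: (Defs.edist _ _) e0 => e e0.
case: eqP => [->|/eqP s1] e2.
  have /eqP : e ^+ 2 = 0 by rewrite e2; ring.
  by rewrite sqrf_eq0 => /eqP ->; rewrite inve0.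
have s_lt1 : sdot x y < 1 by rewrite lt_neqAle s1 sdot_le1.
have {}e0 : 0 < e.
  rewrite lt_neqAle e0 andbT; apply/eqP => e00; move: e2; rewrite -e00 expr0n/=; lra.
rewrite inver gt_eqF// lne_EFin ?invr_gt0// lnV ?posrE//; congr (_%:E).
rewrite -lnM ?posrE ?subr_gt0// (_ : 2 * (1 - sdot x y) = e ^+ 2); last by rewrite e2; ring.
by rewrite lnXn// mulr2n; field.
Qed.

Lemma measurable_log_sdot : measurable_fun setT log_sdot.
Proof.
apply: measurable_fun_ifT.
- by apply: measurable_fun_eqr.
- exact: measurable_cst.
- apply/measurable_EFinP; apply: measurable_funM; first exact: measurable_cst.
  apply: measurable_funD; first exact: measurable_cst.
  apply: measurableT_comp; first exact: measurable_ln.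
  by apply: measurable_funB; first exact: measurable_cst.
Qed.

Lemma measurable_log_trunc n : measurable_fun setT (log_trunc n).
Proof.
apply: measurable_funM; first exact: measurable_cst.
apply: measurable_funD; first exact: measurable_cst.
apply: measurableT_comp; first exact: measurable_ln.
by apply: measurable_funD; [apply: measurable_funB|]; first exact: measurable_cst.
Qed.

Let invS_gt0 n : 0 < n.+1%:R^-1 :> R. Proof. by rewrite invr_gt0. Qed.

Let invS_le1 n : n.+1%:R^-1 <= 1 :> R. Proof. by rewrite invf_le1// ler1n. Qed.

Lemma cvg_log_trunc_real s : s < 1 -> ln (1 - s + n.+1%:R^-1) @[n --> \oo] --> ln (1 - s).
Proof.
move=> s1; apply: continuous_cvg; first by apply: continuous_ln; lra.
rewrite -[X in _ --> X]addr0; apply: cvgD; [exact: cvg_cst|exact: cvg_invSn].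
Qed.

Lemma cvg_log_trunc s : s <= 1 -> (log_trunc n s)%:E @[n --> \oo] --> log_sdot s.
Proof.
rewrite /log_sdot le_eqVlt => /predU1P[->|s1].
  rewrite eqxx; apply/cvgeryP/cvgryPge => A.
  near=> n; rewrite /log_trunc subrr add0r lnV ?posrE//.
  suff : 2 * A + ln 2 <= ln n.+1%:R by lra.
  rewrite -ler_expR lnK ?posrE// -natr1.
  have : expR (2 * A + ln 2) <= n%:R by near: n; exact: nbhs_infty_ger.
  lra.
rewrite lt_eqF//; apply: cvg_EFin; first exact: nearW.
apply: cvgM; first exact: cvg_cst.
by apply: cvgD; [exact: cvg_cst|exact: cvg_log_trunc_real].
Unshelve. all: by end_near. Qed.

Lemma log_trunc_homo s : s <= 1 -> {homo log_trunc ^~ s : n m / (n <= m)%N >-> n <= m}.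
Proof.
move=> s1 n m nm; have n0 := invS_gt0 n; have m0 := invS_gt0 m.
have : ln (1 - s + m.+1%:R^-1) <= ln (1 - s + n.+1%:R^-1).
  have nm' : m.+1%:R^-1 <= n.+1%:R^-1 :> R by rewrite lef_pV2 ?posrE// ler_nat.
  move: (m.+1%:R^-1 : R) (n.+1%:R^-1 : R) m0 n0 nm' => a b a0 b0 ab.
  by rewrite ler_ln ?posrE; lra.
rewrite /log_trunc; lra.
Qed.

Lemma log_trunc_ge n s : -1 <= s <= 1 -> - ln 6 <= log_trunc n s.
Proof.
move=> s1; have n0 := invS_gt0 n; have n1 := invS_le1 n.
rewrite /log_trunc; move: (n.+1%:R^-1 : R) n0 n1 => a a0 a1.
have : ln (1 - s + a) <= ln 3 by rewrite ler_ln ?posrE//; lra.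
have : ln 6 = ln 2 + ln 3 :> R by rewrite -lnM ?posrE//; congr ln; ring.
have : 0 <= ln 2 :> R by rewrite ln_ge0//; lra.
have : 0 <= ln 3 :> R by rewrite ln_ge0//; lra.
lra.
Qed.

Lemma log_trunc_bound n : exists M, forall s, -1 <= s <= 1 -> `|log_trunc n s| <= M.
Proof.
exists (Num.max (ln 6) (log_trunc n 1)) => s s1.
rewrite ler_norml; apply/andP; split.
  rewrite lerNl; apply: (@le_trans _ _ (ln 6)); last by rewrite le_max lexx.
  by rewrite lerNl log_trunc_ge.
rewrite le_max; apply/orP; right; rewrite /log_trunc.
have n0 := invS_gt0 n; move: (n.+1%:R^-1 : R) n0 => a a0.
have : ln (1 - 1 + a) <= ln (1 - s + a) by rewrite ler_ln ?posrE//; lra.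
lra.
Qed.

Lemma lnB_trunc_bounds n u : -1 <= u <= 1 -> (- n%:R <= ln (1 - u + n.+1%:R^-1)) /\ (ln (1 - u + n.+1%:R^-1) <= 2).
Proof.
move=> u1; have n0 := invS_gt0 n; have n1 := invS_le1 n.
set w := 1 - u + n.+1%:R^-1.
have [w0 w3 wn] : [/\ 0 < w, w <= 3 & n.+1%:R^-1 <= w].
  by rewrite /w; move: (n.+1%:R^-1 : R) n0 n1 => a a0 a1; split; lra.
split.
  have : ln w^-1 <= w^-1 - 1.
    by apply: ln_le_sub1; rewrite invr_gt0.
  have : w^-1 <= n.+1%:R.
    by rewrite -[leRHS]invrK lef_pV2 ?posrE.
  rewrite lnV ?posrE// -natr1; lra.
by have := ln_le_sub1 w0; lra.
Qed.

End log_energy.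

Lemma horner_bound (R : realType) (p : {poly R}) : exists M, forall u : R, -1 <= u <= 1 -> `|p.[u]| <= M.
Proof.
exists (\sum_(i < size p) `|p`_i|) => u u1; rewrite horner_coef.
apply: le_trans (ler_norm_sum _ _ _) _; apply: ler_sum => i _.
by rewrite normrM ler_piMr// normrX exprn_ile1// ler_norml.
Qed.

Lemma measurable_horner (R : realType) (p : {poly R}) : measurable_fun setT (horner p).
Proof. by apply: continuous_measurable_fun => x; exact: continuous_horner. Qed.

Lemma is_derive_horner (R : realType) (p : {poly R}) (u : R) : is_derive u 1 (horner p) p^`().[u].
Proof.
by apply: DeriveDef; [exact: derivable_horner|rewrite derivE derive1E].
Qed.

Section zonal_functionals.
Context {R : realType} (d : nat).
Local Notation S := (sphere R d).
Local Notation mu := (sphere_measure R d).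
Local Notation t x := (scoord ord0 x).
Implicit Types (p q : {poly R}) (x y : S).

Definition zonal_int p : R := (\int[mu]_x p.[t x])%R.
Definition zonal_log_int p : R := (\int[mu]_x (p.[t x] * ln (1 - t x)))%R.

Lemma Rintegral_sphere_cst (c : R) : (\int[mu]_x c = c)%R.
Proof.
rewrite Rintegral_cst//.
by rewrite (congr1 fine (@sphere_measureT R d)) mulr1.
Qed.

Let muoo := @sphere_measure_lty R d.
Let mt := @measurable_scoord R d ord0.
Let t_itv x : -1 <= t x <= 1.
Proof. by have := scoord_norm ord0 x; rewrite ler_norml. Qed.

Lemma bmeas_zonal (f : R -> R) (M : R) : measurable_fun setT f -> (forall u, -1 <= u <= 1 -> `|f u| <= M) ->
  bmeas (fun x => f (t x)).
Proof.
move=> mf fM; split; first exact: measurableT_comp mf mt.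
by exists M => x; exact: fM.
Qed.

Lemma bmeas_horner p : bmeas (fun x => p.[t x]).
Proof. by have [M pM] := horner_bound p; apply: bmeas_zonal pM; exact: measurable_horner. Qed.

Lemma zonal_int_lin a p q : zonal_int (a *: p + q) = a * zonal_int p + zonal_int q.
Proof.
rewrite /zonal_int; under eq_Rintegral do rewrite hornerD hornerZ.
rewrite RintD ?RintZ//; try exact: bmeas_integrable muoo _ (bmeas_horner _).
by apply: bmeas_integrable => //; apply: bmeasZ; exact: bmeas_horner.
Qed.

Lemma zonal_int1 : zonal_int 1 = 1.
Proof.
rewrite /zonal_int; under eq_Rintegral do rewrite hornerC.
by rewrite Rintegral_sphere_cst.
Qed.

Lemma zonal_int_parts p : zonal_int ((1 - 'X ^+ 2) * p^`() - d%:R * ('X * p)) = 0.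
Proof.
have [M pM] := horner_bound p; have [N pN] := horner_bound p^`().
have P : (\int[mu]_x (d%:R * (t x * p.[t x]) - (1 - t x ^+ 2) * p^`().[t x]) = 0)%R.
  apply: (@sphere_integration_by_parts R d (horner p) (horner p^`()) (Num.max M N)).
  - by move=> u u1; rewrite !le_max pM// pN// orbT.
  - by case: (bmeas_horner p).
  - by case: (bmeas_horner p^`()).
apply: oppr_inj; rewrite oppr0 -[RHS]P.
have -> : (\int[mu]_x (d%:R * (t x * p.[t x]) - (1 - t x ^+ 2) * p^`().[t x]))%R =
   - zonal_int ((1 - 'X ^+ 2) * p^`() - d%:R * ('X * p)).
  rewrite -[RHS]mulN1r -RintZ; last by apply: bmeas_integrable => //; exact: bmeas_horner.
  by apply: eq_Rintegral => x _; rewrite -polyC_natr !hornerE; ring.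
by [].
Qed.

Let e n : R := n.+1%:R^-1.
Let e0 n : 0 < e n. Proof. by rewrite invr_gt0. Qed.
Let w n x := 1 - t x + e n.
Let w0 n x : 0 < w n x. Proof. by have := t_itv x; have := e0 n; rewrite /w; lra. Qed.
Let bmeas_lnw n : bmeas (fun x => ln (w n x)).
Proof.
apply: (@bmeas_zonal (fun u => ln (1 - u + e n)) (n%:R + 2)).
  apply: measurableT_comp; first exact: measurable_ln.
  by apply: measurable_funD; [apply: measurable_funB|]; first exact: measurable_cst.
move=> u u1; have [] := lnB_trunc_bounds n u1.
have : 0 <= n%:R :> R by []. rewrite ler_norml /e; lra.
Qed.

Let invw_le n u : -1 <= u <= 1 -> `|(1 - u + e n)^-1| <= n.+1%:R.
Proof.
move=> u1; have := e0 n; move=> en; rewrite gtr0_norm ?invr_gt0; last by lra.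
by rewrite -[leRHS]invrK lef_pV2 ?posrE -/(e n); lra.
Qed.

Let bmeas_invw n : bmeas (fun x => (w n x)^-1).
Proof.
split; last by exists n.+1%:R => x; exact: invw_le.
rewrite (_ : (fun x => _) = (fun x => (w n x) `^ (-1))); last first.
  by apply/funext => x; rewrite powR_inv1// ltW.
apply: (@measurableT_comp _ _ _ _ _ _ (@powR R ^~ (-1))); first exact: measurable_powR.
by apply: measurable_funD; [apply: measurable_funB|]; first exact: measurable_cst.
Qed.

(** Integration by parts for p(u) ln(1 - u + 1/(n + 1)), smooth and bounded on [-1, 1]; the
    logarithmic identity is its limit. *)
Lemma zonal_parts_trunc n p :
  (\int[mu]_x (((1 - 'X ^+ 2) * p^`() - d%:R * ('X * p)).[t x] * ln (w n x)))%R =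
  (\int[mu]_x ((1 - t x ^+ 2) * p.[t x] * (w n x)^-1))%R.
Proof.
have [M pM] := horner_bound p; have [N pN] := horner_bound p^`().
pose f u := p.[u] * ln (1 - u + e n).
pose f' u := p^`().[u] * ln (1 - u + e n) - p.[u] * (1 - u + e n)^-1.
have bf : bmeas (fun x => f (t x)) by apply: bmeasM; [exact: bmeas_horner|exact: bmeas_lnw].
have bf' : bmeas (fun x => f' (t x)).
  by apply: bmeasB; apply: bmeasM; (exact: bmeas_horner || exact: bmeas_lnw || exact: bmeas_invw).
have bt : bmeas (fun x : S => t x) by exact: bmeas_scoord.
have bt2 : bmeas (fun x : S => 1 - t x ^+ 2) by apply: bmeasB; [exact: bmeas_cst|exact: bmeasX].
have P : (\int[mu]_x (d%:R * (t x * f (t x)) - (1 - t x ^+ 2) * f' (t x)) = 0)%R.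
  apply: (@sphere_integration_by_parts R d f f' (Num.max (M * (n%:R + 2)) (N * (n%:R + 2) + M * n.+1%:R))).
  - move=> u u1; have := e0 n => en.
    have D1 := is_derive_horner p u.
    have D2 : is_derive u 1 (fun u : R => ln (1 - u + e n)) (- (1 - u + e n)^-1).
      rewrite -mulrN1; apply: (@is_derive1_comp _ (@ln R) (fun u : R => 1 - u + e n)).
        by apply: is_derive1_ln; lra.
      by apply: is_derive_eq; rewrite /GRing.scale/=; ring.
    by apply: is_derive_eq; rewrite /f' /GRing.scale/=; ring.
  - move=> u u1.
    have L : `|ln (1 - u + e n)| <= n%:R + 2.
      have [] := lnB_trunc_bounds n u1; have : 0 <= n%:R :> R by [].
      rewrite ler_norml /e; lra.
    split; rewrite le_max; apply/orP.
      by left; rewrite /f normrM ler_pM// pM.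
    right; rewrite /f' (le_trans (ler_normB _ _))// lerD// normrM ler_pM//; by [exact: pN|exact: pM|exact: invw_le].
  - by case: bf.
  - by case: bf'.
have B1 : bmeas (fun x => ((1 - 'X ^+ 2) * p^`() - d%:R * ('X * p)).[t x] * ln (w n x)).
  by apply: bmeasM; [exact: bmeas_horner|exact: bmeas_lnw].
have B2 : bmeas (fun x => (1 - t x ^+ 2) * p.[t x] * (w n x)^-1).
  by apply: bmeasM; [apply: bmeasM => //; exact: bmeas_horner|exact: bmeas_invw].
apply/esym/eqP; rewrite -subr_eq0 -RintB; try exact: bmeas_integrable muoo _ _.
rewrite -[X in _ == X]P; apply/eqP/eq_Rintegral => x _.
rewrite -polyC_natr !hornerE/= /f /f' -/(w n x); ring.
Qed.

Hypothesis d_gt0 : (0 < d)%N.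

(* Writing [w] for [1 - t + n.+1%:R^-1], one has [- ln w <= 1 - t * ln w], and *)
(* integration by parts bounds the integral of [t * ln w] uniformly in [n].   *)
Lemma Rintegral_log_trunc_le n : (\int[mu]_x log_trunc n (t x) <= 3)%R.
Proof.
have := zonal_parts_trunc n 1.
have -> : (\int[mu]_x (((1 - 'X ^+ 2) * (1 : {poly R})^`() - d%:R * ('X * 1)).[t x] * ln (w n x)))%R =
    - d%:R * (\int[mu]_x (t x * ln (w n x)))%R.
  rewrite -RintZ; last first.
    by apply: bmeas_integrable => //; apply: bmeasM => //; exact: bmeas_scoord.
  apply: eq_Rintegral => x _; rewrite derivC mulr0 mulr1 -polyC_natr !hornerE/=; ring.
have : (\int[mu]_x ((1 - t x ^+ 2) * (1 : {poly R}).[t x] * (w n x)^-1) <= \int[mu]_x 2)%R.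
  apply: (@le_Rint_ae _ _ _ _ set0); rewrite ?measure0//.
  - apply: bmeas_integrable => //; apply: bmeasM => //; apply: bmeasM; last exact: bmeas_horner.
    by apply: bmeasB; [exact: bmeas_cst|apply: bmeasX; exact: bmeas_scoord].
  - by apply: bmeas_integrable => //; exact: bmeas_cst.
  - move=> x _; rewrite hornerC mulr1 ler_pdivrMr//.
    have := t_itv x; have := e0 n; rewrite /w; nra.
rewrite Rintegral_sphere_cst => H1 H2.
have : (\int[mu]_x (- ln (w n x)) <= \int[mu]_x (1 - t x * ln (w n x)))%R.
  apply: (@le_Rint_ae _ _ _ _ set0); rewrite ?measure0//.
  - by apply: bmeas_integrable => //; exact: bmeasN.
  - apply: bmeas_integrable => //; apply: bmeasB; first exact: bmeas_cst.
    by apply: bmeasM => //; exact: bmeas_scoord.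
  - move=> x _.
    have : ln (w n x)^-1 <= (w n x)^-1.
      by apply: ltW; apply: ln_sublinear; rewrite invr_gt0.
    rewrite lnV ?posrE// => H.
    have : (1 - t x) * - ln (w n x) <= (1 - t x) * (w n x)^-1.
      by rewrite ler_wpM2l//; have := t_itv x; lra.
    have : (1 - t x) * (w n x)^-1 <= 1.
      by rewrite ler_pdivrMr// mul1r /w; have := e0 n; lra.
    lra.
rewrite RintB; last 2 first.
- by apply: bmeas_integrable => //; exact: bmeas_cst.
- by apply: bmeas_integrable => //; apply: bmeasM => //; exact: bmeas_scoord.
rewrite Rintegral_sphere_cst => H3.
have -> : (\int[mu]_x log_trunc n (t x))%R = - 2^-1 * ln 2 + 2^-1 * (\int[mu]_x (- ln (w n x)))%R.
  rewrite -RintZ; last by apply: bmeas_integrable => //; exact: bmeasN.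
  rewrite -[X in X + _](_ : \int[mu]_x (- 2^-1 * ln 2) = _)%R; last first.
    by rewrite Rintegral_sphere_cst.
  rewrite -RintD; last 2 first.
  - by apply: bmeas_integrable => //; exact: bmeas_cst.
  - by apply: bmeas_integrable => //; apply: bmeasZ; exact: bmeasN.
  by apply: eq_Rintegral => x _; rewrite /log_trunc -/(e n) -/(w n x); ring.
have l2 : 0 <= ln 2 :> R by rewrite ln_ge0//; lra.
have D1 : 1 <= d%:R :> R by rewrite ler1n.
move: H2 H1 H3; set I1 := (\int[mu]_x _)%R; set I2 := (\int[mu]_x _)%R.
set I3 := (\int[mu]_x _)%R => H2 H1 H3.
have : - I1 <= 2.
  have H4 : d%:R * - I1 <= 2 by rewrite mulrN -mulNr H2.
  have [I10|I10] := leP 0 (- I1); last by lra.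
  by apply: le_trans H4; rewrite ler_peMl.
lra.
Qed.

(** The shift by ln 6 makes the truncations nonnegative, so monotone convergence and the uniform
    bound on their integrals give integrability of the logarithm. *)
Let G n x : \bar R := (log_trunc n (t x) + ln 6)%:E.
Let Goo x : \bar R := (log_sdot (t x) + (ln 6)%:E)%E.

Let mG n : measurable_fun setT (G n).
Proof.
apply/measurable_EFinP; apply: measurable_funD; last exact: measurable_cst.
exact: measurableT_comp (measurable_log_trunc n) mt.
Qed.

Let G0 n x : (0 <= G n x)%E.
Proof. by rewrite lee_fin; have := log_trunc_ge n (t_itv x); lra. Qed.

Let cvgG x : G n x @[n --> \oo] --> Goo x.
Proof.
rewrite /Goo /G; under eq_fun do rewrite EFinD.
apply: cvgeD; [|by apply: cvg_log_trunc; have /andP[] := t_itv x|exact: cvg_cst].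
by rewrite /log_sdot; case: ifP.
Qed.

Let mGoo : measurable_fun setT Goo.
Proof. exact: (@emeasurable_fun_cvg _ _ _ _ G Goo mG (fun x _ => @cvgG x)). Qed.

Let Goo0 x : (0 <= Goo x)%E.
Proof. by apply: (cvge_ge _ (@cvgG x)); exact: nearW. Qed.

Let int_Goo : (\int[mu]_x Goo x < +oo)%E.
Proof.
have := @cvg_monotone_convergence _ _ _ mu setT measurableT G mG (fun n x _ => G0 n x) _.
have -> : (fun x => limn (G ^~ x)) = Goo by apply/funext => x; apply/cvg_lim => //; exact: cvgG.
move=> H; apply: (@le_lt_trans _ _ (3 + ln 6)%:E); last exact: ltry.
have bL n : bmeas (fun x => log_trunc n (t x)).
  by have [M lM] := @log_trunc_bound R n; apply: (@bmeas_zonal (log_trunc n) M) => //; exact: measurable_log_trunc.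
apply: (cvge_le _ (H _)).
  apply: nearW => n; rewrite -EFin_Rint; last first.
    by apply: bmeas_integrable => //; apply: bmeasD => //; exact: bmeas_cst.
  rewrite RintD; last 2 first.
  - exact: bmeas_integrable.
  - by apply: bmeas_integrable => //; exact: bmeas_cst.
  by rewrite lee_fin lerD ?Rintegral_log_trunc_le// Rintegral_sphere_cst.
move=> x _ n m nm; rewrite lee_fin lerD2r log_trunc_homo//.
by have /andP[] := t_itv x.
Qed.

Let integrable_Goo : mu.-integrable setT Goo.
Proof.
apply/integrableP; split => //.
have -> : (\int[mu]_x `|Goo x| = \int[mu]_x Goo x)%E by apply: eq_integral => x _; rewrite gee0_abs.
exact: int_Goo.
Qed.

Lemma measurable_pole_level : measurable [set x : S | t x = 1].
Proof.
rewrite (_ : [set x | _] = scoord ord0 @^-1` [set 1])//.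
by rewrite -[X in measurable X]setTI; exact: mt.
Qed.

(** [Goo] is integrable, hence finite almost everywhere, and it is infinite on this set. *)
Lemma sphere_measure_pole_level : mu [set x : S | t x = 1] = 0%E.
Proof.
have [N [mN N0 HN]] := integrable_ae measurableT integrable_Goo.
apply/eqP; rewrite eq_le measure_ge0 andbT -N0 le_measure ?inE//.
  exact: measurable_pole_level.
move=> x /= x1; apply: HN => /= /(_ I).
by rewrite /Goo /log_sdot x1 eqxx.
Qed.

Let lt1 x : ~ [set x : S | t x = 1] x -> 0 < 1 - t x.
Proof.
move=> /= x1; rewrite subr_gt0 lt_neqAle; apply/andP; split; first exact/eqP.
by have /andP[] := t_itv x.
Qed.

Let mln : measurable_fun setT (fun x : S => ln (1 - t x)).
Proof.
apply: measurableT_comp; first exact: measurable_ln.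
by apply: measurable_funB; first exact: measurable_cst.
Qed.

Lemma integrable_lnB : mu.-integrable setT (EFin \o (fun x : S => ln (1 - t x))).
Proof.
pose h x : \bar R := (2%:E * Goo x + (3 * ln 2)%:E)%E.
have l2 : 0 <= ln 2 :> R by rewrite ln_ge0//; lra.
have l6 : 0 <= ln 6 :> R by rewrite ln_ge0//; lra.
apply: (@le_integrable _ _ _ mu setT measurableT _ h).
- exact/measurable_EFinP.
- move=> x _; rewrite [leRHS]gee0_abs; last first.
    by rewrite /h adde_ge0 ?mule_ge0//; rewrite lee_fin; lra.
  rewrite /h /Goo /log_sdot /=; case: eqP => [->|x1].
    by rewrite addye// gt0_muley ?lte_fin// addye// leey.
  rewrite lee_fin.
  have := lt1 x1; have := t_itv x => x2 x3.
  have : ln (1 - t x) <= ln 2 by rewrite ler_ln ?posrE//; lra.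
  rewrite ler_norml; lra.
- apply: integrableD => //; first by apply: (@integrableZl _ _ _ mu setT measurableT 2 Goo).
  by apply: (@bmeas_integrable _ _ _ mu muoo (fun=> 3 * ln 2)); exact: bmeas_cst.
Qed.

Lemma integral_log_kernel x : (\int[mu]_y log_kernel x y = (- 2^-1 * (ln 2 + zonal_log_int 1))%:E)%E.
Proof.
have [g rg gx] := rotation_to_pole x d_gt0.
have sg : forall x y, sdot (g x) (g y) = sdot x y by case: rg.
transitivity (\int[mu]_y log_sdot (t (g y)))%E.
  by apply: eq_integral => y _; rewrite log_kernelE -sg gx sdot_pole.
have mls : measurable_fun setT (fun x => log_sdot (t x)).
  exact: (measurableT_comp (@measurable_log_sdot R) mt).
rewrite (@integral_rotation _ _ g (fun x => log_sdot (t x)))//.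
rewrite (@ae_eq_integral _ _ _ mu setT (fun x => (- 2^-1 * (ln 2 + ln (1 - t x)))%:E)) //.
- rewrite -EFin_Rint; last first.
    apply: (@integrable_bmeasM _ _ _ mu (fun=> - 2^-1)); first exact: bmeas_cst.
    apply: (@integrable_add _ _ _ mu (fun=> ln 2)); last exact: integrable_lnB.
    by apply: (@bmeas_integrable _ _ _ mu muoo (fun=> ln 2)); exact: bmeas_cst.
  rewrite RintZ; last first.
    apply: (@integrable_add _ _ _ mu (fun=> ln 2)); last exact: integrable_lnB.
    by apply: (@bmeas_integrable _ _ _ mu muoo (fun=> ln 2)); exact: bmeas_cst.
  rewrite RintD; last 2 first.
  - by apply: (@bmeas_integrable _ _ _ mu muoo (fun=> ln 2)); exact: bmeas_cst.
  - exact: integrable_lnB.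
  rewrite Rintegral_sphere_cst; congr (_ * (_ + _))%:E.
  by apply: eq_Rintegral => y _; rewrite hornerC mul1r.
- apply/measurable_EFinP; apply: measurable_funM; first exact: measurable_cst.
  by apply: measurable_funD; first exact: measurable_cst.
- exists [set x : S | t x = 1]; split.
  + exact: measurable_pole_level.
  + exact: sphere_measure_pole_level.
  + move=> y /= H; apply: contrapT => y1; apply: H => _.
    by rewrite /log_sdot; case: eqP.
Qed.

Lemma V_logE : V_log R d = (- 2^-1 * (ln 2 + zonal_log_int 1))%:E.
Proof.
rewrite /V_log (eq_integral (fun=> (- 2^-1 * (ln 2 + zonal_log_int 1))%:E)); last first.
  by move=> x _; exact: integral_log_kernel.
rewrite integral_cst//; apply: etrans; first exact: (congr1 (fun z => (- 2^-1 * (ln 2 + zonal_log_int 1))%:E * z)%E (@sphere_measureT R d)).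
by rewrite mule1.
Qed.

Let integrable_pln p : mu.-integrable setT (EFin \o (fun x : S => p.[t x] * ln (1 - t x))).
Proof. apply: integrable_bmeasM => //; [exact: bmeas_horner|exact: integrable_lnB]. Qed.

Lemma zonal_log_int_lin a p q : zonal_log_int (a *: p + q) = a * zonal_log_int p + zonal_log_int q.
Proof.
rewrite /zonal_log_int -RintZ// -RintD//; last first.
  by apply: integrable_bmeasM => //; exact: bmeas_cst.
by apply: eq_Rintegral => x _; rewrite hornerD hornerZ; ring.
Qed.

(** Dominated convergence in [zonal_parts_trunc]: (1 - t^2)/(1 - t + 1/(n + 1)) is bounded by 2 and
    tends to 1 + t off the null set t = 1. *)
Lemma zonal_log_int_parts p :
  zonal_log_int ((1 - 'X ^+ 2) * p^`() - d%:R * ('X * p)) = zonal_int ((1 + 'X) * p).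
Proof.
set q := (1 - 'X ^+ 2) * p^`() - d%:R * ('X * p).
pose N := [set x : S | t x = 1].
have lim1 : (\int[mu]_x (q.[t x] * ln (w n x)))%R @[n --> \oo] --> zonal_log_int q.
  have [M qM] := horner_bound q.
  apply: (@Rint_dominated _ _ _ mu N _ _ (fun x => M * (`|ln (1 - t x)| + 2))).
  - exact: measurable_pole_level.
  - exact: sphere_measure_pole_level.
  - by move=> n; apply: measurable_funM; [case: (bmeas_horner q)|case: (bmeas_lnw n)].
  - by apply: measurable_funM => //; case: (bmeas_horner q).
  - move=> x /lt1 x1; apply: cvgM; first exact: cvg_cst.
    by apply: cvg_log_trunc_real; lra.
  - apply: (@integrable_bmeasM _ _ _ mu (fun=> M)); first exact: bmeas_cst.
    apply: (@integrable_add _ _ _ mu (fun x => `|ln (1 - t x)|)); last first.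
      by apply: (@bmeas_integrable _ _ _ mu muoo (fun=> 2)); exact: bmeas_cst.
    by have := integrable_abse integrable_lnB.
  - move=> n x /lt1 x1; rewrite normrM ler_pM//; first exact: qM.
    have := e0 n => en; have := w0 n x => wn0.
    have : ln (1 - t x) <= ln (w n x) by rewrite ler_ln ?posrE// /w; lra.
    have [] := lnB_trunc_bounds n (t_itv x); rewrite -/(e n) -/(w n x) => _ H1 H2.
    have : - `|ln (1 - t x)| <= ln (1 - t x) by rewrite lerNl -normrN ler_norm.
    have := normr_ge0 (ln (1 - t x)); rewrite ler_norml; lra.
have lim2 : (\int[mu]_x ((1 - t x ^+ 2) * p.[t x] * (w n x)^-1))%R @[n --> \oo] --> zonal_int ((1 + 'X) * p).
  have [M pM] := horner_bound p.
  have bq := bmeas_horner ((1 + 'X) * p).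
  apply: (@Rint_dominated _ _ _ mu N _ _ (fun x => 2 * M)).
  - exact: measurable_pole_level.
  - exact: sphere_measure_pole_level.
  - move=> n; have [mi _] := bmeas_invw n.
    apply: measurable_funM => //; apply: measurable_funM; last by case: (bmeas_horner p).
    by apply: measurable_funB; [exact: measurable_cst|apply: measurable_funX; exact: mt].
  - by case: bq.
  - move=> x /lt1 x1.
    apply: (@cvgn_eq_lim _ _ ((1 - t x ^+ 2) * p.[t x] * (1 - t x)^-1)).
      by rewrite !hornerE; field; lra.
    apply: cvgM; first exact: cvg_cst.
    apply: cvgV; first by rewrite gt_eqF.
    by rewrite -[X in _ --> X]addr0; apply: cvgD; [exact: cvg_cst|exact: cvg_invSn].
  - by apply: (@bmeas_integrable _ _ _ mu muoo (fun=> 2 * M)); exact: bmeas_cst.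
  - move=> n x /lt1 x1; rewrite mulrAC normrM ler_pM//; last exact: pM.
    have := w0 n x => wn0; have := t_itv x => x2; have := e0 n => en.
    rewrite ger0_norm; last by apply: divr_ge0; [nra|lra].
    rewrite ler_pdivrMr//; rewrite /w; nra.
have E : (fun n => \int[mu]_x (q.[t x] * ln (w n x)))%R =
  (fun n => \int[mu]_x ((1 - t x ^+ 2) * p.[t x] * (w n x)^-1))%R.
  by apply/funext => n; exact: zonal_parts_trunc.
rewrite E in lim1.
exact: (cvg_unique _ lim1 lim2).
Qed.

Lemma zonal_log_int_le m (c : R) : 0 < c ->
  zonal_log_int ((1 - 'X) ^+ m) <= zonal_int ((1 - 'X) ^+ m.+1) / c + (ln c - 1) * zonal_int ((1 - 'X) ^+ m).
Proof.
move=> c0; have -> : zonal_int ((1 - 'X) ^+ m.+1) / c + (ln c - 1) * zonal_int ((1 - 'X) ^+ m) =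
  zonal_int (c^-1 *: (1 - 'X) ^+ m.+1 + (ln c - 1) *: (1 - 'X) ^+ m).
  rewrite zonal_int_lin -[X in _ = _ + zonal_int X]addr0 zonal_int_lin.
  have -> : zonal_int 0 = 0 by rewrite /zonal_int; under eq_Rintegral do rewrite horner0; rewrite Rintegral_sphere_cst.
  by rewrite addr0 mulrC.
apply: (@le_Rint_ae _ _ _ _ [set x : S | t x = 1]).
- exact: measurable_pole_level.
- exact: sphere_measure_pole_level.
- exact: integrable_pln.
- by apply: bmeas_integrable => //; exact: bmeas_horner.
- move=> x /lt1 x1; rewrite !hornerE.
  have : ln ((1 - t x) / c) <= (1 - t x) / c - 1.
    by apply: ln_le_sub1; rewrite divr_gt0.
  rewrite lnM ?posrE ?invr_gt0// lnV ?posrE// => H.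
  rewrite exprS.
  have : (1 - t x) ^+ m * ln (1 - t x) <= (1 - t x) ^+ m * ((1 - t x) / c - 1 + ln c).
    by rewrite ler_wpM2l ?exprn_ge0 ?(ltW x1)//; lra.
  move: ((1 - t x) ^+ m) => a; lra.
Qed.

Lemma zonal_log_int_ge m (c : R) : 0 < c ->
  (1 + ln c) * zonal_int ((1 - 'X) ^+ m.+1) - c * zonal_int ((1 - 'X) ^+ m) <= zonal_log_int ((1 - 'X) ^+ m.+1).
Proof.
move=> c0; have -> : (1 + ln c) * zonal_int ((1 - 'X) ^+ m.+1) - c * zonal_int ((1 - 'X) ^+ m) =
  zonal_int ((1 + ln c) *: (1 - 'X) ^+ m.+1 + (- c) *: (1 - 'X) ^+ m).
  rewrite zonal_int_lin -[X in _ = _ + zonal_int X]addr0 zonal_int_lin.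
  have -> : zonal_int 0 = 0 by rewrite /zonal_int; under eq_Rintegral do rewrite horner0; rewrite Rintegral_sphere_cst.
  by rewrite addr0 mulNr.
apply: (@le_Rint_ae _ _ _ _ [set x : S | t x = 1]).
- exact: measurable_pole_level.
- exact: sphere_measure_pole_level.
- by apply: bmeas_integrable => //; exact: bmeas_horner.
- exact: integrable_pln.
- move=> x /lt1 x1; rewrite !hornerE.
  have : ln (c / (1 - t x)) <= c / (1 - t x) - 1.
    by apply: ln_le_sub1; rewrite divr_gt0.
  rewrite lnM ?posrE ?invr_gt0// lnV ?posrE// => H.
  rewrite exprS.
  have x1' : (1 - t x) * (1 + ln c - c / (1 - t x)) <= (1 - t x) * ln (1 - t x).
    by rewrite ler_wpM2l ?(ltW x1)//; lra.
  have : (1 - t x) ^+ m * ((1 - t x) * (1 + ln c - c / (1 - t x))) <= (1 - t x) ^+ m * ((1 - t x) * ln (1 - t x)).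
    by rewrite ler_wpM2l ?exprn_ge0 ?(ltW x1).
  have -> : (1 - t x) * (1 + ln c - c / (1 - t x)) = (1 - t x) * (1 + ln c) - c by field; lra.
  move: ((1 - t x) ^+ m) => a; lra.
Qed.

End zonal_functionals.

(** * Polynomials on the sphere *)

Section sphere_polynomials.
Import -(notations) mpoly.
Context {R : realType} {d : nat}.
Local Notation S := (sphere R d).
Local Notation mu := (sphere_measure R d).
Local Notation V := (@sphere_poly R d).
Implicit Types (f g : S -> R) (x y : S) (L : nat).

Lemma sphere_poly_cst L c : V L (fun=> c).
Proof.
exists (mpolyC d.+1 c) => [|x]; last by rewrite mevalC.
by rewrite msuppC; case: eqP => //= _; rewrite mdeg0.
Qed.

Lemma sphere_poly_scoord i : V 1 (scoord i).
Proof.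
exists (mpolyX R (mnm1 i)) => [|x]; last by rewrite mevalXU.
by rewrite msuppX/= mdeg1.
Qed.

Lemma sphere_polyD L f g : V L f -> V L g -> V L (fun x => f x + g x).
Proof.
move=> [p pL fp] [q qL gq]; exists (p + q) => [|x]; last by rewrite mevalD fp gq.
apply/allP => m /msuppD_le; rewrite mem_cat => /orP[] mp.
  exact: (allP pL).
exact: (allP qL).
Qed.

Lemma sphere_polyZ L c f : V L f -> V L (fun x => c * f x).
Proof.
move=> [p pL fp]; exists (c *: p) => [|x]; last by rewrite mevalZ fp.
by apply/allP => m /msuppZ_le; exact: (allP pL).
Qed.

Lemma sphere_polyM L L' f g : V L f -> V L' g -> V (L + L') (fun x => f x * g x).
Proof.
move=> [p pL fp] [q qL gq]; exists (p * q) => [|x]; last by rewrite mevalM fp gq.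
apply/allP => m /msuppM_le /allpairsP[[m1 m2] /= [m1p m2q ->]].
by rewrite mdegD leq_add//; [exact: (allP pL)|exact: (allP qL)].
Qed.

Lemma sphere_poly_le L L' f : (L <= L')%N -> V L f -> V L' f.
Proof.
move=> LL' [p pL fp]; exists p => //; apply/allP => m mp.
by apply: leq_trans LL'; exact: (allP pL).
Qed.

Lemma sphere_poly_sum L I (r : seq I) (P : pred I) (F : I -> S -> R) : (forall i, P i -> V L (F i)) ->
  V L (fun x => \sum_(i <- r | P i) F i x).
Proof.
move=> VF; elim: r => [|i r ih]; first by under eq_fun do rewrite big_nil; exact: sphere_poly_cst.
under eq_fun do rewrite big_cons; have [Pi|_] := boolP (P i) => //.
by apply: sphere_polyD => //; exact: VF.
Qed.

Lemma sphere_polyX L f n : V L f -> V (L * n) (fun x => f x ^+ n).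
Proof.
move=> Vf; elim: n => [|n ih]; first by under eq_fun do rewrite expr0; exact: sphere_poly_cst.
by under eq_fun do rewrite exprS; rewrite mulnS; exact: sphere_polyM.
Qed.

Lemma sphere_poly_prod I (r : seq I) (F : I -> S -> R) (D : I -> nat) : (forall i, V (D i) (F i)) ->
  V (\sum_(i <- r) D i) (fun x => \prod_(i <- r) F i x).
Proof.
move=> VF; elim: r => [|i r ih].
  have -> : (fun x => \prod_(i <- [::]) F i x) = fun=> 1 by apply/funext => x; rewrite big_nil.
  exact: sphere_poly_cst.
have -> : (fun x => \prod_(i <- i :: r) F i x) = fun x => F i x * \prod_(i <- r) F i x.
  by apply/funext => x; rewrite big_cons.
by rewrite big_cons; exact: sphere_polyM.
Qed.

Definition monomial (m : 'I_d.+1 -> nat) x : R := \prod_(i < d.+1) scoord i x ^+ m i.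

Lemma sphere_poly_monomial m : V (\sum_(i < d.+1) m i) (monomial m).
Proof.
by apply: sphere_poly_prod => i; rewrite -[X in V X]mul1n; exact: sphere_polyX (sphere_poly_scoord i).
Qed.

(** Exponents are encoded as finite functions with values at most L, which gives a finite index set
    independent of f. *)
Lemma sphere_poly_monomials L f : V L f -> exists c : {ffun 'I_d.+1 -> 'I_L.+1} -> R,
  forall x, f x = \sum_(m : {ffun 'I_d.+1 -> 'I_L.+1} | (\sum_(i < d.+1) m i <= L)%N) c m * monomial (fun i => m i) x.
Proof.
move=> [p pL fp].
pose D (m : multinom d.+1) : {ffun 'I_d.+1 -> 'I_L.+1} := [ffun i => inord (m i)].
have DE m : m \in msupp p -> forall i, (D m i : nat) = m i.
  move=> mp i; rewrite ffunE inordK// ltnS; have := allP pL _ mp; apply: leq_trans.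
  by rewrite mdegE (bigD1 i)//= leq_addr.
exists (fun F => \sum_(m <- msupp p | D m == F) mcoeff m p) => x.
rewrite fp mevalE.
under [RHS]eq_bigr do rewrite mulr_suml.
rewrite (exchange_big_dep xpredT)//= big_seq [RHS]big_seq; apply: eq_bigr => m mp.
rewrite (bigD1 (D m)) /=; last first.
  rewrite eqxx andbT; have := allP pL _ mp; rewrite mdegE; apply: leq_trans.
  by apply: leq_sum => i _; rewrite DE.
rewrite [X in _ + X]big1 ?addr0; last by move=> F /= /andP[/andP[_ /eqP <-]]; rewrite eqxx.
by congr (_ * _); apply: eq_bigr => i _; rewrite DE.
Qed.

Lemma sphere_poly_ind (P : (S -> R) -> Prop) : (forall c, P (fun=> c)) -> (forall i, P (scoord i)) ->
  (forall f g, P f -> P g -> P (fun x => f x + g x)) -> (forall f g, P f -> P g -> P (fun x => f x * g x)) ->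
  forall L f, V L f -> P f.
Proof.
move=> Pc Ps PD PM L f /sphere_poly_monomials[c fc].
have -> : f = fun x => \sum_(m : {ffun 'I_d.+1 -> 'I_L.+1} | (\sum_(i < d.+1) m i <= L)%N) c m * monomial (fun i => m i) x.
  by apply/funext => x; exact: fc.
elim: (index_enum _) => [|m r ih]; first by under eq_fun do rewrite big_nil; exact: Pc.
under eq_fun do rewrite big_cons; case: (boolP (\sum_(i < d.+1) m i <= L)%N) => _ //.
apply: (PD) => //; apply: (PM); first exact: Pc.
rewrite /monomial; elim: (index_enum _) => [|i s ihs]; first by under eq_fun do rewrite big_nil; exact: Pc.
under eq_fun do rewrite big_cons; apply: (PM) => //.
elim: (nat_of_ord (m i)) => [|k ihk]; first by under eq_fun do rewrite expr0; exact: Pc.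
by under eq_fun do rewrite exprS; apply: (PM).
Qed.

Lemma sphere_poly_bmeas L f : V L f -> bmeas f.
Proof.
by apply: sphere_poly_ind; [exact: bmeas_cst|exact: bmeas_scoord|exact: bmeasD|exact: bmeasM].
Qed.

Lemma sphere_poly_linear_action (g : S -> S) L f : linear_action g -> V L f -> V L (fun x => f (g x)).
Proof.
move=> [M gM] /sphere_poly_monomials[c fc].
under eq_fun do rewrite fc.
have Vg i : V 1 (fun x => scoord i (g x)).
  under eq_fun do rewrite gM.
  by apply: sphere_poly_sum => j _; apply: sphere_polyZ; exact: sphere_poly_scoord.
apply: sphere_poly_sum => m mL; apply: sphere_polyZ; apply: sphere_poly_le mL _.
by apply: sphere_poly_prod => i; rewrite -[X in V X]mul1n; exact: sphere_polyX (Vg i).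
Qed.

(** Being bounded and Lipschitz for the largest coordinate difference is stable under sums and
    products. *)
Lemma sphere_poly_continuous L f : V L f -> forall x (eps : R), 0 < eps -> exists2 delta : R, 0 < delta &
  forall y, (forall i, `|scoord i y - scoord i x| < delta) -> `|f y - f x| < eps.
Proof.
pose P f := (exists2 B : R, 0 <= B & forall x, `|f x| <= B) /\
  (exists2 M : R, 0 <= M & forall (x y : S) (e : R), (forall i, `|scoord i y - scoord i x| < e) -> `|f y - f x| <= M * e).
have PV : forall L f, V L f -> P f.
  apply: sphere_poly_ind.
  - move=> c; split; first by exists `|c|.
    by exists 0 => // x y e _; rewrite subrr normr0 mul0r.
  - move=> i; split; first by exists 1 => // x; exact: scoord_norm.
    by exists 1 => // x y e H; rewrite mul1r ltW.
  - move=> g h [[B B0 gB] [M M0 gM]] [[C C0 hC] [N N0 hN]]; split.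
      by exists (B + C); [exact: addr_ge0|move=> x; rewrite (le_trans (ler_normD _ _))// lerD].
    exists (M + N); first exact: addr_ge0.
    move=> x y e H; rewrite opprD addrACA mulrDl (le_trans (ler_normD _ _))// lerD ?gM ?hN//.
  - move=> g h [[B B0 gB] [M M0 gM]] [[C C0 hC] [N N0 hN]]; split.
      by exists (B * C); [exact: mulr_ge0|move=> x; rewrite normrM ler_pM].
    exists (M * C + B * N); first by rewrite addr_ge0// mulr_ge0.
    move=> x y e H.
    have -> : g y * h y - g x * h x = (g y - g x) * h y + g x * (h y - h x) by ring.
    rewrite (le_trans (ler_normD _ _))// !normrM mulrDl lerD//.
      by rewrite mulrAC ler_pM// gM.
    by rewrite -mulrA ler_pM// hN.
move=> /PV[_ [M M0 fM]] x eps eps0; exists (eps / (M + 1)); first by rewrite divr_gt0// ltr_wpDl.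
move=> y /fM H; apply: le_lt_trans H _.
by rewrite mulrCA -[ltRHS]mulr1 ltr_pM2l// ltr_pdivrMr ?ltr_wpDl// mul1r ltrDl.
Qed.

(** If f(x) is nonzero, |f| stays above |f(x)|/2 on a neighbourhood of x of positive measure, and
    Markov's inequality for f^2 is contradicted. *)
Lemma sphere_poly_definite L f : V L f -> (\int[mu]_x (f x * f x))%R = 0 -> forall x, f x = 0.
Proof.
move=> Vf f0 x; apply/eqP; apply: contraT => fx.
have e0 : 0 < `|f x| / 2 by rewrite divr_gt0// normr_gt0.
have [delta delta0 Hd] := sphere_poly_continuous Vf x e0.
have [A [mA A0 HA]] := sphere_measure_cap_gt0 x delta0.
have [mf _] := sphere_poly_bmeas Vf.
have bff : bmeas (fun y => f y * f y) by apply: bmeasM; exact: sphere_poly_bmeas Vf.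
have mff := bff.1.
have a0 : 0 < (`|f x| / 2) ^+ 2 by rewrite exprn_gt0.
have := le_integral_abse mu measurableT ((measurable_EFinP _ _).2 mff) a0.
have -> : (\int[mu]_y `|(f y * f y)%:E|)%E = 0%E.
  rewrite (eq_integral (fun y => (f y * f y)%:E)); last first.
    by move=> y _; rewrite gee0_abs// lee_fin -expr2 sqr_ge0.
  by rewrite -EFin_Rint ?f0//; apply: bmeas_integrable => //; exact: sphere_measure_lty.
apply: contraLR => _; rewrite -ltNge mule_gt0 ?lte_fin//.
apply: lt_le_trans A0 _; apply: le_measure; rewrite ?inE//.
  apply: measurableI => //.
  rewrite (_ : [set y | _] = (fun y => f y * f y) @^-1` `[(`|f x| / 2) ^+ 2, +oo[%classic).
    by rewrite -[X in measurable X]setTI; exact: mff.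
  by apply/seteqP; split => y /=; rewrite in_itv/= andbT lee_fin [`|f y * f y|]ger0_norm -?expr2 ?sqr_ge0.
move=> y Ay; split => //=; rewrite lee_fin normrM -expr2 ler_pXn2r ?nnegrE//.
have := Hd y (HA y Ay).
have := ler_normB (f y) (f y - f x); rewrite opprB addrCA subrr addr0; lra.
Qed.

Definition in_span (bs : seq (S -> R)) f :=
  exists c : nat -> R, forall x, f x = \sum_(i < size bs) c i * nth (fun=> 0) bs i x.

Lemma in_spanD bs f g : in_span bs f -> in_span bs g -> in_span bs (fun x => f x + g x).
Proof.
move=> [c fc] [e ge]; exists (fun i => c i + e i) => x; rewrite fc ge -big_split.
by apply: eq_bigr => i _ /=; rewrite mulrDl.
Qed.

Lemma in_spanZ bs c f : in_span bs f -> in_span bs (fun x => c * f x).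
Proof.
move=> [e fe]; exists (fun i => c * e i) => x; rewrite fe mulr_sumr.
by apply: eq_bigr => i _; rewrite mulrA.
Qed.

Lemma in_span_sum bs I (r : seq I) (P : pred I) (F : I -> S -> R) : (forall i, P i -> in_span bs (F i)) ->
  in_span bs (fun x => \sum_(i <- r | P i) F i x).
Proof.
move=> sF; elim: r => [|i r ih].
  by under eq_fun do rewrite big_nil; exists (fun=> 0) => x; rewrite big1// => i _; rewrite mul0r.
under eq_fun do rewrite big_cons; have [Pi|_] := boolP (P i) => //.
by apply: in_spanD => //; exact: sF.
Qed.

Lemma in_span_rcons bs f g : in_span bs f -> in_span (rcons bs g) f.
Proof.
move=> [c fc]; exists (fun i => if (i < size bs)%N then c i else 0) => x.
rewrite size_rcons big_ord_recr/= ltnn mul0r addr0 fc; apply: eq_bigr => i _.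
by rewrite ltn_ord nth_rcons ltn_ord.
Qed.

Lemma in_span_last bs g : in_span (rcons bs g) g.
Proof.
exists (fun i => (i == size bs)%:R) => x.
rewrite size_rcons big_ord_recr/= eqxx mul1r nth_rcons ltnn eqxx big1 ?add0r// => i _.
by rewrite ltn_eqF// mul0r.
Qed.

Definition orthonormal (bs : seq (S -> R)) := forall i j, (i < size bs)%N -> (j < size bs)%N ->
  (\int[mu]_x (nth (fun=> 0) bs i x * nth (fun=> 0) bs j x))%R = (i == j)%:R.

Let muoo := @sphere_measure_lty R d.

Lemma gram_schmidt L (I : eqType) (s : seq I) (F : I -> S -> R) : (forall i, i \in s -> V L (F i)) ->
  exists bs, [/\ forall i, (i < size bs)%N -> V L (nth (fun=> 0) bs i), orthonormal bs &
    forall i, i \in s -> in_span bs (F i)].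
Proof.
elim: s => [_|k s ih VF]; first by exists [::].
have [|bs [Vb ob sb]] := ih; first by move=> i si; apply: VF; rewrite inE si orbT.
have VFk : V L (F k) by apply: VF; rewrite mem_head.
pose b i := nth (fun=> 0 : R) bs i.
have Vb' i : V L (b i).
  have [|ib] := ltnP i (size bs); first exact: Vb.
  by rewrite /b nth_default//; exact: sphere_poly_cst.
have bb i : bmeas (b i) by exact: sphere_poly_bmeas.
pose a i := (\int[mu]_x (F k x * b i x))%R.
pose p x := \sum_(i < size bs) a i * b i x.
pose r x := F k x + (-1) * p x.
have Vp : V L p by apply: sphere_poly_sum => i _; exact: sphere_polyZ.
have Vr : V L r by apply: sphere_polyD => //; exact: sphere_polyZ.
have br : bmeas r := sphere_poly_bmeas Vr.
have bF : bmeas (F k) := sphere_poly_bmeas VFk.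
have sp : in_span bs p by apply: in_span_sum => i _; apply: in_spanZ; exists (fun j : nat => (j == i)%:R) => x;
  rewrite (bigD1 i)//= eqxx mul1r big1 ?addr0// => j ji; rewrite (negPf (_ : (j : nat) != i)) ?mul0r.
have rb j : (j < size bs)%N -> (\int[mu]_x (r x * b j x))%R = 0.
  move=> jb.
  have E : (\int[mu]_x (r x * b j x))%R = a j - \sum_(i < size bs) a i * (\int[mu]_x (b i x * b j x))%R.
    transitivity (a j - (\int[mu]_x \sum_(i < size bs) (a i * (b i x * b j x)))%R).
      rewrite -RintB; last 2 first.
      - by apply: bmeas_integrable => //; exact: bmeasM.
      - apply: bmeas_integrable => //; apply: bmeas_sum => i _; apply: bmeasZ; exact: bmeasM.
      apply: eq_Rintegral => x _; rewrite /r /p mulrDl mulN1r mulNr mulr_suml; congr (_ - _).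
      by apply: eq_bigr => i _; rewrite mulrA.
    rewrite Rint_sum//; last by move=> i; apply: bmeasZ; exact: bmeasM.
    congr (_ - _); apply: eq_bigr => i _; rewrite RintZ//.
    by apply: bmeas_integrable => //; exact: bmeasM.
  rewrite E (bigD1 (Ordinal jb))//= ob// eqxx mulr1 big1 ?addr0 ?subrr// => i ij.
  by rewrite ob// (negPf (_ : (i : nat) != j)) ?mulr0.
have FkE x : F k x = p x + r x by rewrite /r; ring.
(* A residual of norm 0 vanishes everywhere by definiteness and is dropped: the family need not be
   free. *)
have [r0|r0] := eqVneq (\int[mu]_x (r x * r x))%R 0.
  exists bs; split => // i; rewrite inE => /predU1P[->|]; last exact: sb.
  have {}r0 := sphere_poly_definite Vr r0.
  by rewrite (_ : F k = p)//; apply/funext => x; rewrite FkE r0 addr0.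
have rr0 : 0 < (\int[mu]_x (r x * r x))%R.
  by rewrite lt_neqAle eq_sym r0 Rintegral_ge0// => x _; rewrite -expr2 sqr_ge0.
set N := (\int[mu]_x (r x * r x))%R in rr0.
pose g x := (Num.sqrt N)^-1 * r x.
have sN0 : 0 < Num.sqrt N by rewrite sqrtr_gt0.
have Vg : V L g by exact: sphere_polyZ.
exists (rcons bs g); split.
- move=> i _; rewrite nth_rcons; case: ifP => ib; first exact: Vb.
  by case: ifP => _ //; exact: sphere_poly_cst.
- have gb j : (j < size bs)%N -> (\int[mu]_x (g x * b j x))%R = 0.
    move=> jb; transitivity ((Num.sqrt N)^-1 * (\int[mu]_x (r x * b j x)))%R; last by rewrite rb// mulr0.
    rewrite -RintZ; last by apply: bmeas_integrable => //; exact: bmeasM.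
    by apply: eq_Rintegral => x _; rewrite /g mulrA.
  move=> i j; rewrite !size_rcons !ltnS !nth_rcons leq_eqVlt => /predU1P[->|ib];
    rewrite leq_eqVlt => /predU1P[->|jb]; rewrite ?ltnn ?eqxx.
  + transitivity (N^-1 * N)%R; last by rewrite mulVf ?gt_eqF.
    rewrite -RintZ; last by apply: bmeas_integrable => //; exact: bmeasM.
    apply: eq_Rintegral => x _; rewrite /g mulrACA -invfM -expr2 sqr_sqrtr//; exact: ltW.
  + by rewrite jb gb// gtn_eqF.
  + rewrite ib ltn_eqF//; under eq_Rintegral do rewrite mulrC.
    by rewrite gb.
  + by rewrite ib jb ob.
- move=> i; rewrite inE => /predU1P[->|si]; last by apply: in_span_rcons; exact: sb.
  have -> : F k = fun x => p x + Num.sqrt N * g x.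
    by apply/funext => x; rewrite FkE /g mulrA divff ?mul1r// gt_eqF.
  by apply: in_spanD; [exact: in_span_rcons|apply: in_spanZ; exact: in_span_last].
Qed.

Lemma orthonormal_basis_exists L : exists n (b : 'I_n -> S -> R), [/\ forall i, V L (b i),
  forall i j, (\int[mu]_x (b i x * b j x))%R = (i == j)%:R &
  forall f, V L f -> exists c : 'I_n -> R, forall x, f x = \sum_(i < n) c i * b i x].
Proof.
have [|bs [Vb ob sb]] := @gram_schmidt L {ffun 'I_d.+1 -> 'I_L.+1}
   [seq m : {ffun 'I_d.+1 -> 'I_L.+1} <- enum {ffun 'I_d.+1 -> 'I_L.+1} | (\sum_(i < d.+1) m i <= L)%N]
   (fun m => monomial (fun i => m i)).
  move=> m; rewrite mem_filter => /andP[mL _].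
  exact: sphere_poly_le mL (sphere_poly_monomial _).
exists (size bs), (fun i : 'I_(size bs) => nth (fun=> 0) bs i); split.
- by move=> i; exact: Vb.
- by move=> i j; rewrite ob.
- move=> f /sphere_poly_monomials[c fc].
  have [e fe] : in_span bs f.
    rewrite (funext fc); apply: in_span_sum => m mL; apply: in_spanZ; apply: sb.
    by rewrite mem_filter mL mem_enum.
  by exists (fun i => e i).
Qed.

End sphere_polynomials.

(** * The reproducing kernel *)

Section reproducing_kernel.
Context {R : realType} (d : nat).
Local Notation S := (sphere R d).
Local Notation mu := (sphere_measure R d).
Local Notation V := (@sphere_poly R d).
Implicit Types (f : S -> R) (x y : S) (L : nat).

Let muoo := @sphere_measure_lty R d.

(** The change of coordinates matrices multiply to the identity, which bounds one size by the
    other. *)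
Lemma has_dim_unique (W : set (S -> R)) n m : has_dim W n -> has_dim W m -> n = m.
Proof.
have le k l : has_dim W k -> has_dim W l -> (k <= l)%N.
  move=> [b [bW bfree]] [e [eW _]].
  have ib i : W (b i).
    apply/bW; exists (fun j => (j == i)%:R) => x.
    by rewrite (bigD1 i)//= eqxx mul1r big1 ?addr0// => j /negPf->; rewrite mul0r.
  have ie i : W (e i).
    by apply/eW; exists (fun j => (j == i)%:R) => x;
       rewrite (bigD1 i)//= eqxx mul1r big1 ?addr0// => j /negPf->; rewrite mul0r.
  have [A bA] := choice (fun i => (eW (b i)).1 (ib i)).
  have [B eB] := choice (fun i => (bW (e i)).1 (ie i)).
  apply: (@mulmx1_min R k l (\matrix_(i, j) A i j) (\matrix_(i, j) B i j)).
  apply/matrixP => i j; rewrite !mxE; under eq_bigr do rewrite !mxE.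
  apply/eqP; rewrite -subr_eq0; apply/eqP; move: j.
  apply: bfree => x; under eq_bigr do rewrite mulrBl.
  rewrite sumrB [X in _ - X](bigD1 i)//= eqxx mul1r [X in _ - (_ + X)]big1 ?addr0; last first.
    by move=> j /negPf ji; rewrite eq_sym ji mul0r.
  rewrite bA; apply/eqP; rewrite subr_eq0; apply/eqP.
  under eq_bigr do rewrite mulr_suml.
  rewrite exchange_big; apply: eq_bigr => j _; rewrite eB mulr_sumr.
  by apply: eq_bigr => l' _; rewrite mulrA.
by move=> hn hm; apply/eqP; rewrite eqn_leq !le.
Qed.

Lemma orthonormal_basis L : exists b : 'I_(sphere_poly_dim R d L) -> S -> R, [/\ forall i, V L (b i),
  forall i j, (\int[mu]_x (b i x * b j x))%R = (i == j)%:R &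
  forall f, V L f -> exists c, forall x, f x = \sum_i c i * b i x].
Proof.
have [n [b [Vb ob sb]]] := @orthonormal_basis_exists R d L.
have bb i : bmeas (b i) by exact: sphere_poly_bmeas (Vb i).
have dimV : has_dim (V L) n.
  exists b; split => [f|c c0 j].
    split => [/sb//|[c fc]].
    rewrite (funext fc); apply: sphere_poly_sum => i _; exact: sphere_polyZ.
  have : (\int[mu]_x ((\sum_(i < n) c i * b i x) * b j x))%R = 0.
    under eq_Rintegral do rewrite c0 mul0r.
    by rewrite Rintegral_sphere_cst.
  under eq_Rintegral do rewrite mulr_suml.
  rewrite Rint_sum//; last by move=> i; apply: bmeasM => //; exact: bmeasZ.
  rewrite (eq_bigr (fun i => c i * (i == j)%:R)) => [|i _]; last first.
    rewrite -ob -RintZ; last by apply: bmeas_integrable => //; exact: bmeasM.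
    by apply: eq_Rintegral => x _; rewrite mulrA.
  rewrite (bigD1 j)//= eqxx mulr1 big1 ?addr0// => i /negPf->; exact: mulr0.
have E : sphere_poly_dim R d L = n.
  apply: (has_dim_unique _ dimV).
  exact: (@xgetPex _ 0%N [set n | has_dim (V L) n] (ex_intro _ n dimV)).
by rewrite E; exists b.
Qed.

(** Reproducing K x with K', and K' y with K, gives the same integral. With K' = K this is
    symmetry. *)
Lemma is_reproducing_kernel_unique L (K K' : S -> S -> R) :
  is_reproducing_kernel (V L) K -> is_reproducing_kernel (V L) K' -> forall x y, K x y = K' y x.
Proof.
move=> [VK rK] [VK' rK'] x y.
rewrite (rK' _ (VK x)) (rK _ (VK' y)).
by apply: eq_Rintegral => z _; rewrite mulrC.
Qed.

Lemma sphere_kernel_basis_reproducing L : is_reproducing_kernel (V L) (sphere_kernel L) /\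
  exists b : 'I_(sphere_poly_dim R d L) -> S -> R, [/\ forall i, V L (b i),
  forall i j, (\int[mu]_x (b i x * b j x))%R = (i == j)%:R &
  forall x y, sphere_kernel L x y = \sum_i b i x * b i y].
Proof.
have [b [Vb ob sb]] := orthonormal_basis L.
have bb i : bmeas (b i) by exact: sphere_poly_bmeas (Vb i).
have rK : is_reproducing_kernel (V L) (fun x y => \sum_i b i x * b i y).
  split => [x|f /sb[c fc] x].
    by apply: sphere_poly_sum => i _; exact: sphere_polyZ.
  have fb j : (\int[mu]_y (f y * b j y))%R = c j.
    under eq_Rintegral do rewrite fc mulr_suml.
    rewrite Rint_sum//; last by move=> i; apply: bmeasM => //; exact: bmeasZ.
    rewrite (eq_bigr (fun i => c i * (i == j)%:R)) => [|i _]; last first.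
      rewrite -ob -RintZ; last by apply: bmeas_integrable => //; exact: bmeasM.
      by apply: eq_Rintegral => y _; rewrite mulrA.
    by rewrite (bigD1 j)//= eqxx mulr1 big1 ?addr0// => i /negPf->; exact: mulr0.
  have bf : bmeas f by rewrite (funext fc); apply: bmeas_sum => i _; exact: bmeasZ.
  under eq_Rintegral do rewrite mulr_sumr.
  rewrite Rint_sum//; last by move=> i; apply: bmeasM => //; exact: bmeasZ.
  rewrite fc; apply: eq_bigr => i _; rewrite -fb mulrC -RintZ; last first.
    by apply: bmeas_integrable => //; exact: bmeasM.
  by apply: eq_Rintegral => y _; ring.
have rK' : is_reproducing_kernel (V L) (sphere_kernel L).
  exact: (@xgetPex _ (fun _ _ => 0) [set K | is_reproducing_kernel (V L) K] (ex_intro _ _ rK)).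
split => //; exists b; split => // x y; rewrite (is_reproducing_kernel_unique rK' rK).
by apply: eq_bigr => i _; rewrite mulrC.
Qed.

Section zonal.
Variable L : nat.
Local Notation K := (@sphere_kernel R d L).

Let reproK : is_reproducing_kernel (V L) K.
Proof. by have [] := sphere_kernel_basis_reproducing L. Qed.

Lemma sphere_kernelC x y : K x y = K y x.
Proof. exact: is_reproducing_kernel_unique reproK reproK x y. Qed.

(** The rotated kernel reproduces the same space, because f composed with the inverse rotation is
    still a polynomial of degree at most L. *)
Lemma sphere_kernel_rotation g x y : rotation g -> K (g x) (g y) = K x y.
Proof.
move=> rg; have [mg _ lg [g' lg' gK] _] := rg.
have [VK rK] := reproK.
rewrite sphere_kernelC; apply/esym.
apply: (@is_reproducing_kernel_unique L K (fun x y => K (g x) (g y)) reproK).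
split => [z|f Vf z]; first exact: sphere_poly_linear_action (VK (g z)).
have Vf' : V L (fun x => f (g' x)) by exact: sphere_poly_linear_action Vf.
rewrite -{1}(gK z) (rK _ Vf' (g z)).
have [mf _] := sphere_poly_bmeas Vf'; have [mK _] := sphere_poly_bmeas (VK (g z)).
rewrite -(@Rintegral_rotation _ _ g (fun y => f (g' y) * K (g z) y))//.
  by apply: eq_Rintegral => u _; rewrite gK.
exact: measurable_funM.
Qed.

Hypothesis d_gt0 : (0 < d)%N.
Let one : 'I_d.+1 := inord 1.
Let one0 : one != ord0. Proof. by rewrite -val_eqE/= inordK. Qed.

Definition planar y := forall k : 'I_d.+1, (1 < k)%N -> scoord k y = 0.

Lemma planar_norm y : planar y -> scoord ord0 y ^+ 2 + scoord one y ^+ 2 = 1.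
Proof.
move=> py; rewrite -[RHS](sum_scoord_sqr y) (bigD1 ord0)//= (bigD1 one)//= big1 ?addr0// => i /andP[i0 i1].
rewrite py ?expr0n//; move: i0 i1; rewrite -!val_eqE/= inordK//.
by case: (i : nat) => [|[|]].
Qed.

Lemma planar_monomial m y : planar y -> monomial m y =
  scoord ord0 y ^+ m ord0 * scoord one y ^+ m one * \prod_(i < d.+1 | (i != ord0) && (i != one)) 0 ^+ m i.
Proof.
move=> py; rewrite /monomial (bigD1 ord0)//= (bigD1 one)//= mulrA; congr (_ * _).
apply: eq_bigr => i /andP[i0 i1]; rewrite py//; move: i0 i1; rewrite -!val_eqE/= inordK//.
by case: (i : nat) => [|[|]].
Qed.

(* For a pair (pole, y) with y planar, exchanging the two points amounts to    *)
(* changing the sign of the second coordinate of y. Hence only the even part  *)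
(* of the kernel matters, and it is a polynomial in the first coordinate.     *)
Lemma sphere_poly_planar_even L' f : V L' f -> exists2 q : {poly R}, (size q <= L'.+1)%N &
  forall y y', planar y -> planar y' -> scoord ord0 y' = scoord ord0 y -> scoord one y' = - scoord one y ->
  f y + f y' = q.[scoord ord0 y].
Proof.
move=> /sphere_poly_monomials[c fc].
pose D (m : {ffun 'I_d.+1 -> 'I_L'.+1}) : R := \prod_(i < d.+1 | (i != ord0) && (i != one)) 0 ^+ m i.
pose q (m : {ffun 'I_d.+1 -> 'I_L'.+1}) : {poly R} :=
  (c m * D m * (1 + (-1) ^+ m one)) *: ('X^(m ord0) * (1 - 'X^2) ^+ (m one)./2).
exists (\sum_(m : {ffun 'I_d.+1 -> 'I_L'.+1} | (\sum_(i < d.+1) m i <= L')%N) q m).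
  rewrite (leq_trans (size_sum _ _ _))//; apply/bigmax_leqP => m mL.
  rewrite (leq_trans (size_scale_leq _ _))//.
  have s1 : (size ((1 - 'X^2 : {poly R}) ^+ (m one)./2)%R <= (m one)./2.*2.+1)%N.
    have s2 : (size (1 - 'X^2 : {poly R})%R <= 3)%N.
      by rewrite (leq_trans (size_polyD _ _))// size_polyN size_polyXn size_poly1.
    rewrite (leq_trans (size_poly_exp_leq _ _))//.
    by move: s2; case: (size _) => [|[|[|[|]]]]//= _; lia.
  rewrite (leq_trans (size_polyMleq _ _))// size_polyXn addSn/=.
  have : (m ord0 + m one <= L')%N.
    by apply: leq_trans mL; rewrite (bigD1 ord0)//= (bigD1 one)//= addnA leq_addr.
  have : ((m one)./2.*2 <= m one)%N by rewrite -[leqRHS](odd_double_half (m one)) leq_addl.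
  move: s1; move: (size _) (_./2.*2) => a b s1 h1 h2.
  by rewrite -ltnS in s1 *; apply: leq_trans (_ : m ord0 + b.+1 <= _)%N; rewrite ?leq_add2l// addnS ltnS (leq_trans _ h2)// leq_add2l.
move=> y y' py py' y0 y1; rewrite !fc -big_split horner_sum; apply: eq_bigr => m _ /=.
rewrite !planar_monomial// y0 y1 -/(D m) /q !hornerE/= [(- scoord one y) ^+ _]exprNn.
have [mo|me] := boolP (odd (m one)).
  have -> : (-1) ^+ m one = -1 :> R by rewrite -signr_odd mo expr1.
  ring.
have -> : scoord one y ^+ m one = (1 - scoord ord0 y ^+ 2) ^+ (m one)./2.
  have <- : scoord one y ^+ 2 = 1 - scoord ord0 y ^+ 2 by rewrite -(planar_norm py); ring.
  by rewrite -exprM mul2n -[in LHS](odd_double_half (m one)) (negPf me).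
rewrite -signr_odd (negPf me) expr0; ring.
Qed.

(** A rotation brings the pair to (pole, y) with y planar. A second one sends y to the pole and the
    pole to the mirror image of y, so K(pole, .) agrees at both points and equals half the
    polynomial of [sphere_poly_planar_even]. *)
Lemma sphere_kernel_zonal : exists2 q : {poly R}, (size q <= L.+1)%N & forall x y, K x y = q.[sdot x y].
Proof.
have [VK _] := reproK.
have [q sq qE] := sphere_poly_planar_even (VK (sphere_pole R d)).
exists (2^-1 *: q); first by rewrite (leq_trans (size_scale_leq _ _)).
move=> x y; have [g [rg gx gy]] := rotation_normal_form x y d_gt0.
rewrite -(sphere_kernel_rotation x y rg) gx.
have -> : sdot x y = scoord ord0 (g y) by have [_ _ _ _ <-] := rg; rewrite gx sdot_pole.
move: (g y) gy => {}y py.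
have cs : scoord ord0 y ^+ 2 + (- scoord one y) ^+ 2 = 1 by rewrite sqrrN planar_norm.
have o1 : ord0 != one by rewrite eq_sym.
pose h : S -> S := sgivens ord0 one (scoord ord0 y) (- scoord one y).
have rh : rotation h by exact: rotation_sgivens.
have hy : h y = sphere_pole R d.
  apply: scoord0_pole; rewrite scoord_sgivens// eqxx -cs; ring.
have p0 : scoord ord0 (sphere_pole R d) = 1 by rewrite scoord_pole eqxx.
have ho : scoord one (sphere_pole R d) = 0 by rewrite scoord_pole (negPf one0).
have E : K (sphere_pole R d) y = K (sphere_pole R d) (h (sphere_pole R d)).
  by rewrite sphere_kernelC -(sphere_kernel_rotation _ _ rh) hy.
have := qE y (h (sphere_pole R d)) py _ _ _; rewrite -E.
have -> : K (sphere_pole R d) y + K (sphere_pole R d) y = 2 * K (sphere_pole R d) y by ring.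
rewrite hornerZ => <-; first by field.
- move=> k k1; have k0 : k != ord0 by rewrite -val_eqE/= -lt0n ltnW.
  have ko : k != one by rewrite -val_eqE/= inordK// gtn_eqF.
  by rewrite scoord_sgivens// (negPf k0) (negPf ko) scoord_pole (negPf k0).
- rewrite scoord_sgivens// eqxx ho p0; ring.
- rewrite scoord_sgivens// (negPf one0) eqxx ho p0; ring.
Qed.

Lemma sphere_poly_zonal (p : {poly R}) : (size p <= L.+1)%N -> V L (fun x => p.[scoord ord0 x]).
Proof.
move=> sp; under eq_fun do rewrite horner_coef.
apply: sphere_poly_sum => i _; apply: sphere_polyZ; apply: (@sphere_poly_le _ _ (1 * i)).
  by rewrite mul1n -ltnS (leq_trans (ltn_ord i)).
exact: sphere_polyX (sphere_poly_scoord _).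
Qed.

(** The reproducing property at the pole, tested on the zonal polynomials p_k, is the hypothesis of
    [kernel_poly_unique]. *)
Lemma sphere_kernelE x y : K x y = (kernel_poly d L).[sdot x y].
Proof.
have [q sq KE] := sphere_kernel_zonal; rewrite KE; congr (_.[_]).
apply: (@kernel_poly_unique R d d_gt0 (@zonal_int R d) (@zonal_int_lin R d) (@zonal_int1 R d) (@zonal_int_parts R d)) => // k kL.
have [_ rK] := reproK.
have Vg : V L (fun x => (gegen d k).[scoord ord0 x]).
  by apply: sphere_poly_zonal; rewrite (leq_trans (size_gegen _ _)).
have := rK _ Vg (sphere_pole R d).
rewrite scoord_pole eqxx horner_gegen// => ->.
by apply: eq_Rintegral => z _; rewrite hornerM KE sdot_pole.
Qed.

(** Trace of the projection: the integral of K(x,x), computed from an orthonormal basis and from the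
    constant diagonal of K. *)
Lemma sphere_poly_dimE : (sphere_poly_dim R d L)%:R = dim_sum d L :> R.
Proof.
have [_ [b [Vb ob KE]]] := sphere_kernel_basis_reproducing L.
have bb i : bmeas (b i) by exact: sphere_poly_bmeas (Vb i).
have : (\int[mu]_x K x x)%R = dim_sum d L.
  under eq_Rintegral do rewrite sphere_kernelE sdotxx horner_kernel_poly//.
  exact: Rintegral_sphere_cst.
under eq_Rintegral do rewrite KE.
rewrite Rint_sum//; last by move=> i; exact: bmeasM.
move=> <-; rewrite (eq_bigr (fun=> 1)) => [|i _]; last by rewrite ob eqxx.
by rewrite sumr_const card_ord.
Qed.

End zonal.
End reproducing_kernel.

(** * Products and pairs of coordinates under a power measure *)

Section bounded_fubini.
Context {d1 d2 : measure_display} {T1 : measurableType d1} {T2 : measurableType d2} {R : realType}.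
Variables (m1 : {sigma_finite_measure set T1 -> \bar R}) (m2 : {sigma_finite_measure set T2 -> \bar R}).
Hypotheses (m1T : (m1 setT < +oo)%E) (m2T : (m2 setT < +oo)%E).
Variable f : T1 * T2 -> R.
Hypothesis bf : bmeas f.

Lemma bmeas_section1 x : bmeas (fun y => f (x, y)).
Proof.
have [mf [M fM]] := bf; split; last by exists M.
by apply: measurableT_comp mf _; exact: measurable_pair1.
Qed.

Lemma bmeas_section2 y : bmeas (fun x => f (x, y)).
Proof.
have [mf [M fM]] := bf; split; last by exists M.
by apply: measurableT_comp mf _; exact: measurable_pair2.
Qed.

Lemma product_measure_lty : ((m1 \x m2) setT < +oo)%E.
Proof. by rewrite -setXTT product_measure1E// lte_mul_pinfty// ge0_fin_numE. Qed.

Let intf : (m1 \x m2)%E.-integrable setT (EFin \o f).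
Proof. exact: bmeas_integrable product_measure_lty _ bf. Qed.

Lemma bmeas_Rint1 : bmeas (fun x => \int[m2]_y f (x, y))%R.
Proof.
have [mf [M fM]] := bf; split.
  by apply: measurableT_comp; [exact: fine_measurable|exact: (measurable_fubini_F intf)].
exists (M * fine (m2 setT)) => x; rewrite ler_norml -mulNr -!Rintegral_cst//.
by apply/andP; split; apply: (@le_Rint_ae _ _ _ _ set0); rewrite ?measure0//;
  try (by apply: bmeas_integrable => //; exact: bmeas_cst); try exact: bmeas_integrable m2T _ (bmeas_section1 x);
  move=> y _; have := fM (x, y); rewrite ler_norml => /andP[].
Qed.

Lemma Rint_product : (\int[m1]_x \int[m2]_y f (x, y) = \int[(m1 \x m2)%E]_z f z)%R.
Proof.
apply: EFin_inj; rewrite EFin_Rint; last exact: bmeas_integrable bmeas_Rint1.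
rewrite EFin_Rint// -(integral12_prod_meas1 intf); apply: eq_integral => x _.
by rewrite EFin_Rint//; exact: bmeas_integrable m2T _ (bmeas_section1 x).
Qed.

End bounded_fubini.

Lemma Rint_fubini {d1 d2 : measure_display} {T1 : measurableType d1} {T2 : measurableType d2} {R : realType}
    (m1 : {sigma_finite_measure set T1 -> \bar R}) (m2 : {sigma_finite_measure set T2 -> \bar R}) (f : T1 * T2 -> R) :
  (m1 setT < +oo)%E -> (m2 setT < +oo)%E -> bmeas f ->
  (\int[m1]_x \int[m2]_y f (x, y) = \int[m2]_y \int[m1]_x f (x, y))%R.
Proof.
move=> m1T m2T bf.
have bf' : bmeas (f \o (fun p : T2 * T1 => (p.2, p.1))).
  have [mf [M fM]] := bf; split; last by exists M => p; exact: fM.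
  by apply: measurableT_comp mf _; exact: measurable_swap.
have intf := bmeas_integrable (product_measure_lty m1T m2T) bf.
apply: EFin_inj; rewrite EFin_Rint; last exact: bmeas_integrable m1T _ (bmeas_Rint1 m1T m2T bf).
rewrite [RHS]EFin_Rint; last exact: bmeas_integrable m2T _ (bmeas_Rint1 m2T m1T bf').
transitivity (\int[m1]_x \int[m2]_y (f (x, y))%:E)%E.
  by apply: eq_integral => x _; rewrite EFin_Rint//; exact: bmeas_integrable m2T _ (bmeas_section1 bf x).
rewrite (Fubini intf); apply: eq_integral => y _.
by rewrite EFin_Rint//; exact: bmeas_integrable m1T _ (bmeas_section2 bf y).
Qed.

Section tuple_products.
Context {d : measure_display} {T : measurableType d} {R : realType}.
Variable m : probability T R.
Local Notation mn := (tuple_measure m).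

Let mT : (m setT < +oo)%E. Proof. by rewrite probability_setT ltry. Qed.

Lemma tuple_measureT n : mn n setT = 1%E.
Proof.
rewrite (_ : setT = box (fun _ : 'I_n => [set: T])); last by apply/seteqP; split.
rewrite tuple_measure_box// big1// => i _; exact: probability_setT.
Qed.

Let mnT n : (mn n setT < +oo)%E. Proof. by rewrite tuple_measureT ltry. Qed.

Lemma Rint_tuple_cst n (c : R) : (\int[mn n]_x c = c)%R.
Proof. by rewrite Rintegral_cst// (congr1 fine (tuple_measureT n)) mulr1. Qed.

Lemma Rint_tuple_cons n (f : n.+1.-tuple T -> R) : bmeas f ->
  (\int[mn n.+1]_x f x = \int[m]_a \int[mn n]_y f (tuple_cons (a, y)))%R.
Proof.
move=> bf; have [mf [M fM]] := bf.
have bfc : bmeas (f \o @tuple_cons _ T n).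
  split; last by exists M => p; exact: fM.
  by apply: measurableT_comp mf _; exact: measurable_tuple_cons.
rewrite (Rint_product mT (mnT n) bfc).
rewrite /Rintegral; congr fine.
transitivity (\int[pushforward (m \x mn n)%E (@tuple_cons _ T n)]_x (f x)%:E)%E; first by [].
rewrite (integral_pushforward (@measurable_tuple_cons _ T n))//.
  exact/measurable_EFinP.
rewrite preimage_setT; exact: bmeas_integrable (product_measure_lty mT (mnT n)) _ bfc.
Qed.

Lemma bmeas_tnth n (i : 'I_n) (g : T -> R) : bmeas g -> bmeas (fun x : n.-tuple T => g (tnth x i)).
Proof.
move=> [mg [M gM]]; split; last by exists M => x; exact: gM.
by apply: measurableT_comp mg _; exact: measurable_tnth.
Qed.

Lemma bmeas_tnth2 n (i j : 'I_n) (F : T * T -> R) : bmeas F ->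
  bmeas (fun x : n.-tuple T => F (tnth x i, tnth x j)).
Proof.
move=> [mF [M FM]]; split; last by exists M => x; exact: FM.
apply: measurableT_comp mF _.
by apply/measurable_fun_pairP; split; exact: measurable_tnth.
Qed.

Lemma Rint_tuple_prod n (g : 'I_n -> T -> R) : (forall k, bmeas (g k)) ->
  (\int[mn n]_x (\prod_(k < n) g k (tnth x k)) = \prod_(k < n) \int[m]_a g k a)%R.
Proof.
elim: n g => [|n ih] g bg.
  under eq_Rintegral do rewrite big_ord0.
  by rewrite big_ord0 Rint_tuple_cst.
rewrite Rint_tuple_cons; last by apply: bmeas_prod => k _; exact: bmeas_tnth.
rewrite big_ord_recl -ih; last by move=> k; exact: bg.
have bP : bmeas (fun y : n.-tuple T => \prod_(k < n) g (lift ord0 k) (tnth y k)).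
  by apply: bmeas_prod => k _; exact: bmeas_tnth.
transitivity (\int[m]_a ((\int[mn n]_y \prod_(k < n) g (lift ord0 k) (tnth y k)) * g ord0 a))%R.
  apply: eq_Rintegral => a _; rewrite mulrC -RintZ; last exact: bmeas_integrable (mnT n) _ bP.
  apply: eq_Rintegral => y _; rewrite big_ord_recl tnth_tuple_cons0; congr (_ * _).
  by apply: eq_bigr => k _; rewrite tnth_tuple_consS.
by rewrite RintZ; [rewrite mulrC|exact: bmeas_integrable mT _ (bg ord0)].
Qed.

Lemma Rint_tuple_prod1 n (j : 'I_n) (h : T -> R) (g : 'I_n -> T -> R) : bmeas h -> (forall k, bmeas (g k)) ->
  (\int[mn n]_x (h (tnth x j) * \prod_(k < n) g k (tnth x k)) =
   (\prod_(k < n | k != j) \int[m]_a g k a) * \int[m]_a (h a * g j a))%R.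
Proof.
move=> bh bg; pose g' k := if k == j then fun a => h a * g j a else g k.
have bg' k : bmeas (g' k) by rewrite /g'; case: ifP => _ //; exact: bmeasM.
transitivity (\int[mn n]_x (\prod_(k < n) g' k (tnth x k)))%R.
  apply: eq_Rintegral => x _; rewrite (bigD1 j)//= [in RHS](bigD1 j)//= /g' eqxx mulrA; congr (_ * _).
  by apply: eq_bigr => k /negPf ->.
rewrite Rint_tuple_prod// (bigD1 j)//= mulrC /g' eqxx; congr (_ * _).
by apply: eq_bigr => k /negPf ->.
Qed.

Let prod_lift0 n (P : pred 'I_n) (G : 'I_n.+1 -> R) (Q : pred 'I_n.+1) :
  Q ord0 = false -> (forall k, Q (lift ord0 k) = P k) ->
  \prod_(k < n.+1 | Q k) G k = \prod_(k < n | P k) G (lift ord0 k).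
Proof.
move=> Q0 QP; rewrite big_mkcond big_ord_recl Q0 /= mul1r [RHS]big_mkcond.
by apply: eq_bigr => k _; rewrite QP.
Qed.

(** Coordinates other than i and j integrate out as independent factors. A swap by Fubini reduces to
    i < j, and induction peels off the first coordinate. *)
Lemma Rint_tuple_prod2 n (i j : 'I_n) (F : T * T -> R) (g : 'I_n -> T -> R) : i != j ->
  bmeas F -> (forall k, bmeas (g k)) ->
  (\int[mn n]_x (F (tnth x i, tnth x j) * \prod_(k < n) g k (tnth x k)) =
   (\prod_(k < n | (k != i) && (k != j)) \int[m]_a g k a) *
   \int[m]_a \int[m]_b (F (a, b) * (g i a * g j b)))%R.
Proof.
have bFg (F' : T * T -> R) (g1 g2 : T -> R) : bmeas F' -> bmeas g1 -> bmeas g2 ->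
    bmeas (fun p : T * T => F' p * (g1 p.1 * g2 p.2)).
  move=> bF [mg1 [M1 gM1]] [mg2 [M2 gM2]]; apply: bmeasM => //; apply: bmeasM.
    by split; [exact: measurableT_comp mg1 measurable_fst|exists M1].
  by split; [exact: measurableT_comp mg2 measurable_snd|exists M2].
suff H n' (i' j' : 'I_n') F' g' : (i' < j')%N -> bmeas F' -> (forall k, bmeas (g' k)) ->
  (\int[mn n']_x (F' (tnth x i', tnth x j') * \prod_(k < n') g' k (tnth x k)) =
   (\prod_(k < n' | (k != i') && (k != j')) \int[m]_a g' k a) *
   \int[m]_a \int[m]_b (F' (a, b) * (g' i' a * g' j' b)))%R.
  move=> ij bF bg; have [ltij|] := ltnP i j; first exact: H.
  rewrite leq_eqVlt => /predU1P[/val_inj ji|ltji]; first by rewrite ji eqxx in ij.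
  have bF' : bmeas (F \o (fun p : T * T => (p.2, p.1))).
    have [mF [M FM]] := bF; split; last by exists M => p; exact: FM.
    by apply: measurableT_comp mF _; exact: measurable_swap.
  rewrite (H _ _ _ _ _ ltji bF' bg); congr (_ * _).
    by apply: eq_bigl => k; rewrite andbC.
  rewrite (@Rint_fubini _ _ _ _ _ m m (fun p => F (p.2, p.1) * (g j p.1 * g i p.2)) mT mT); last first.
    exact: (bFg (F \o (fun p : T * T => (p.2, p.1)))).
  apply: eq_Rintegral => a _; apply: eq_Rintegral => b _ /=; ring.
elim: n' i' j' g' => [|p ih] i' j' g'; first by case: i'.
move=> ij bF bg; rewrite Rint_tuple_cons; last first.
  apply: bmeasM; first exact: bmeas_tnth2.
  by apply: bmeas_prod => k _; exact: bmeas_tnth.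
case: (unliftP ord0 j') ij => [{}j ->|->]; last by rewrite ltn0.
case: (unliftP ord0 i') => [{}i -> ij|-> _].
  have {}ij : (i < j)%N by [].
  have bP : bmeas (fun y : p.-tuple T => F' (tnth y i, tnth y j) * \prod_(k < p) g' (lift ord0 k) (tnth y k)).
    apply: bmeasM; first exact: bmeas_tnth2.
    by apply: bmeas_prod => k _; exact: bmeas_tnth.
  transitivity (\int[m]_a ((\int[mn p]_y (F' (tnth y i, tnth y j) * \prod_(k < p) g' (lift ord0 k) (tnth y k))) * g' ord0 a))%R.
    apply: eq_Rintegral => a _; rewrite mulrC -RintZ; last exact: bmeas_integrable (mnT p) _ bP.
    apply: eq_Rintegral => y _; rewrite big_ord_recl tnth_tuple_cons0 !tnth_tuple_consS mulrCA; congr (_ * (_ * _)).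
    by apply: eq_bigr => k _; rewrite tnth_tuple_consS.
  rewrite RintZ; last exact: bmeas_integrable mT _ (bg ord0).
  rewrite (ih _ _ (fun k => g' (lift ord0 k)) ij bF)// mulrAC; congr (_ * _).
  rewrite [RHS]big_mkcond big_ord_recl [RHS]mulrC [in LHS]big_mkcond; congr (_ * _).
transitivity (\int[m]_a ((\prod_(k < p | k != j) \int[m]_c g' (lift ord0 k) c) *
    \int[m]_b (F' (a, b) * (g' ord0 a * g' (lift ord0 j) b))))%R.
  apply: eq_Rintegral => a _.
  have bFa := bmeas_section1 bF a.
  transitivity (g' ord0 a * \int[mn p]_y (F' (a, tnth y j) * \prod_(k < p) g' (lift ord0 k) (tnth y k)))%R.
    rewrite -RintZ; last first.
      apply: (bmeas_integrable (mnT p)); apply: bmeasM; first exact: (@bmeas_tnth p j (fun b => F' (a, b)) bFa).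
      by apply: bmeas_prod => k _; exact: bmeas_tnth.
    apply: eq_Rintegral => y _; rewrite big_ord_recl tnth_tuple_cons0 tnth_tuple_consS mulrCA; congr (_ * (_ * _)).
    by apply: eq_bigr => k _; rewrite tnth_tuple_consS.
  rewrite (@Rint_tuple_prod1 p j (fun b => F' (a, b)) (fun k => g' (lift ord0 k)))// mulrCA; congr (_ * _).
  rewrite -RintZ; last by apply: bmeas_integrable mT _ _; exact: bmeasM.
  by apply: eq_Rintegral => b _; ring.
rewrite RintZ; last first.
  apply: (bmeas_integrable mT).
  exact: (@bmeas_Rint1 _ _ _ _ _ m m mT mT (fun q : T * T => F' q * (g' ord0 q.1 * g' (lift ord0 j) q.2)) (bFg _ _ _ bF (bg _) (bg _))).
congr (_ * _); apply/esym; apply: prod_lift0 => [|k]; first by rewrite eqxx.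
by rewrite (inj_eq lift_inj).
Qed.

End tuple_products.

(** * Two-point function of a determinantal density *)

Section determinantal.
Import fingroup perm.
Context {d : measure_display} {T : measurableType d} {R : realType}.
Variable m : probability T R.
Variables (n : nat) (b : 'I_n -> T -> R).
Hypothesis bb : forall i, bmeas (b i).
Hypothesis ob : forall i j, (\int[m]_x (b i x * b j x))%R = (i == j)%:R.
Local Notation mn := (tuple_measure m n).
Implicit Types (s t : {perm 'I_n}) (i j k : 'I_n).

Let mT : (m setT < +oo)%E. Proof. by rewrite probability_setT ltry. Qed.
Let mnT : (mn setT < +oo)%E. Proof. by rewrite tuple_measureT ltry. Qed.

Let K x y := \sum_(i < n) b i x * b i y.

(** The kernel matrix is B B^T with B = (b_j(x_i)), so the determinant is a square and expands over
    pairs of permutations. *)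
Lemma det_kernel (x : n.-tuple T) : \det (\matrix_(i, j) K (tnth x i) (tnth x j)) =
  \sum_(s : 'S_n) \sum_(t : 'S_n) ((-1) ^+ s * (-1) ^+ t) * \prod_(k < n) (b (s k) (tnth x k) * b (t k) (tnth x k)).
Proof.
have -> : \matrix_(i, j) K (tnth x i) (tnth x j) =
   (\matrix_(i, j) b j (tnth x i)) *m (\matrix_(i, j) b j (tnth x i))^T.
  by apply/matrixP => i j; rewrite !mxE; apply: eq_bigr => k _; rewrite !mxE.
rewrite det_mulmx det_tr /determinant mulr_suml; apply: eq_bigr => s _.
rewrite mulr_sumr; apply: eq_bigr => t _; rewrite mulrACA -big_split; congr (_ * _).
by apply: eq_bigr => k _; rewrite !mxE.
Qed.

Lemma perm_agree_off2 i j s t : i != j -> (forall k, k != i -> k != j -> s k = t k) ->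
  t = s \/ t = (tperm i j * s)%g.
Proof.
move=> ij st.
have preim k : k = i \/ k = j -> t k = s i \/ t k = s j.
  move=> kij; set l := s^-1%g (t k); have tl : s l = t k by rewrite permKV.
  have [li|li] := eqVneq l i; first by left; rewrite -tl li.
  have [lj|lj] := eqVneq l j; first by right; rewrite -tl lj.
  have lk : l = k by apply: (@perm_inj _ t); rewrite -tl st.
  by case: kij => kk; move: li lj; rewrite lk kk eqxx.
have off (u : {perm 'I_n}) : (forall k, k != i -> k != j -> u k = s k) -> t i = u i -> t j = u j -> t = u.
  move=> us ti tj; apply/permP => k.
  have [->//|ki] := eqVneq k i; have [->//|kj] := eqVneq k j.
  by rewrite us// st.
have tij : t i != t j by rewrite (inj_eq perm_inj).
case: (preim i (or_introl erefl)) => ti; case: (preim j (or_intror erefl)) => tj; move: tij; rewrite ti tj ?eqxx// => _.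
  by left; apply: off.
right; apply: off; rewrite ?permM ?tpermL ?tpermR// => k ki kj.
by rewrite permM tpermD// eq_sym.
Qed.

(** Only t = s and t = s with its values at i and j exchanged survive, with opposite signs. *)
Lemma sum_perm_agree_off2 i j s (J : 'I_n -> 'I_n -> R) : i != j ->
  \sum_(t : 'S_n) ((-1) ^+ s * (-1) ^+ t) * ((\prod_(k < n | (k != i) && (k != j)) (s k == t k)%:R) * J (t i) (t j)) =
  J (s i) (s j) - J (s j) (s i).
Proof.
move=> ij; have ts : (tperm i j * s)%g != s.
  apply/eqP => /permP/(_ i); rewrite permM tpermL => /perm_inj ji.
  by rewrite ji eqxx in ij.
rewrite (bigD1 s)//= (bigD1 (tperm i j * s)%g)//= [X in _ + (_ + X)]big1 ?addr0; last first.
  move=> t /andP[tns tnts]; have [/forallP a|] := boolP [forall k, (k != i) && (k != j) ==> (s k == t k)].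
    have [||E] := @perm_agree_off2 i j s t ij; first by move=> k ki kj; apply/eqP; have := a k; rewrite ki kj.
      by move=> E; rewrite E eqxx in tns.
    by rewrite E eqxx in tnts.
  rewrite negb_forall => /existsP[k]; rewrite negb_imply => /andP[kij /negPf skt].
  by rewrite (bigD1 k)//= skt !mul0r mulr0.
rewrite odd_permM odd_tperm ij -signr_addb addbb expr0 mul1r; congr (_ + _).
  by rewrite big1 ?mul1r// => k _; rewrite eqxx.
rewrite -signr_addb addbCA addbb addbF expr1 mulN1r !permM tpermL tpermR big1 ?mul1r// => k /andP[ki kj].
by rewrite permM tpermD ?eqxx// eq_sym.
Qed.

Variable F : T * T -> R.
Hypothesis bF : bmeas F.

Let J i i' j j' := (\int[m]_x \int[m]_y (F (x, y) * ((b i x * b i' x) * (b j y * b j' y))))%R.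

Let bJ i i' j j' : bmeas (fun p : T * T => F p * ((b i p.1 * b i' p.1) * (b j p.2 * b j' p.2))).
Proof.
have b1 k : bmeas (fun p : T * T => b k p.1).
  by have [mb [M bM]] := bb k; split; [exact: measurableT_comp mb measurable_fst|exists M].
have b2 k : bmeas (fun p : T * T => b k p.2).
  by have [mb [M bM]] := bb k; split; [exact: measurableT_comp mb measurable_snd|exists M].
by apply: bmeasM => //; apply: bmeasM; exact: bmeasM.
Qed.

Let G i j := J i i j j - J i j j i.

(** Orthonormality turns each coordinate other than i and j into a Kronecker symbol forcing s and t
    to agree there. *)
Lemma Rint_pair_det_kernel i j : i != j ->
  (\int[mn]_x (F (tnth x i, tnth x j) * \det (\matrix_(i, j) K (tnth x i) (tnth x j))))%R =
  \sum_(s : 'S_n) G (s i) (s j).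
Proof.
move=> ij.
have bst s t : bmeas (fun x : n.-tuple T => F (tnth x i, tnth x j) * \prod_(k < n) (b (s k) (tnth x k) * b (t k) (tnth x k))).
  apply: bmeasM; first exact: bmeas_tnth2.
  by apply: bmeas_prod => k _; apply: bmeasM; exact: bmeas_tnth.
transitivity (\int[mn]_x (\sum_(s : 'S_n) \sum_(t : 'S_n) ((-1) ^+ s * (-1) ^+ t) *
    (F (tnth x i, tnth x j) * \prod_(k < n) (b (s k) (tnth x k) * b (t k) (tnth x k)))))%R.
  apply: eq_Rintegral => x _; rewrite det_kernel mulr_sumr; apply: eq_bigr => s _.
  by rewrite mulr_sumr; apply: eq_bigr => t _; rewrite mulrCA.
rewrite Rint_sum//; last by move=> s; apply: bmeas_sum => t _; exact: bmeasZ.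
apply: eq_bigr => s _; rewrite Rint_sum//; last by move=> t; exact: bmeasZ.
apply: etrans (@sum_perm_agree_off2 i j s (fun k l => J (s i) k (s j) l) ij).
apply: eq_bigr => t _; rewrite RintZ; last exact: bmeas_integrable mnT _ (bst s t).
congr (_ * _); rewrite (@Rint_tuple_prod2 _ _ _ m n i j F (fun k x => b (s k) x * b (t k) x))//; last first.
  by move=> k; exact: bmeasM.
by congr (_ * _); apply: eq_bigr => k _; exact: ob.
Qed.

Lemma Rint_pairs_det_kernel :
  (\int[mn]_x ((\sum_(p : 'I_n * 'I_n | p.1 != p.2) F (tnth x p.1, tnth x p.2)) *
     (n`!%:R^-1 * \det (\matrix_(i, j) K (tnth x i) (tnth x j)))) =
   \int[m]_x \int[m]_y (F (x, y) * (K x x * K y y - K x y ^+ 2)))%R.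
Proof.
have bK (i j : 'I_n) : bmeas (fun x : n.-tuple T => K (tnth x i) (tnth x j)).
  by apply: bmeas_sum => k _; apply: bmeasM; exact: bmeas_tnth.
have bdet : bmeas (fun x : n.-tuple T => \det (\matrix_(i, j) K (tnth x i) (tnth x j))).
  apply: bmeas_sum => s _; apply: bmeasZ; apply: bmeas_prod => k _.
  by under eq_fun do rewrite mxE; exact: bK.
transitivity (n`!%:R^-1 * \sum_(p : 'I_n * 'I_n | p.1 != p.2) \sum_(s : 'S_n) G (s p.1) (s p.2)).
  transitivity (\int[mn]_x (n`!%:R^-1 * \sum_(p <- [seq p <- index_enum _ | p.1 != p.2])
      (F (tnth x p.1, tnth x p.2) * \det (\matrix_(i, j) K (tnth x i) (tnth x j)))))%R.
    by apply: eq_Rintegral => x _; rewrite big_filter mulrCA mulr_suml.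
  have bp p : bmeas (fun x : n.-tuple T => F (tnth x p.1, tnth x p.2) * \det (\matrix_(i, j) K (tnth x i) (tnth x j))).
    by apply: bmeasM => //; exact: bmeas_tnth2.
  rewrite RintZ; last by apply: (bmeas_integrable mnT); exact: bmeas_sum.
  rewrite Rint_sum// big_filter; congr (_ * _); apply: eq_bigr => p pij.
  exact: Rint_pair_det_kernel.
(* Relabelling pairs by s makes the sum independent of s, so n! cancels; pairs with equal entries
   may be added because [G i i] = 0. *)
rewrite exchange_big (eq_bigr (fun=> \sum_(p : 'I_n * 'I_n) G p.1 p.2)) => [|s _]; last first.
  rewrite (reindex (fun p : 'I_n * 'I_n => (s^-1%g p.1, s^-1%g p.2))) /=; last first.
    exists (fun p => (s p.1, s p.2)) => -[a c] _ /=; first by rewrite !permKV.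
    by rewrite !permK.
  under eq_bigl do rewrite (inj_eq perm_inj).
  under eq_bigr do rewrite !permKV.
  rewrite [RHS](bigID (fun p => p.1 != p.2))/= [X in _ = _ + X]big1 ?addr0// => -[a c] /=.
  by rewrite negbK => /eqP ->; rewrite /G subrr.
rewrite sumr_const card_Sn -[X in _ * X]mulr_natl mulKf; last by rewrite pnatr_eq0 -lt0n fact_gt0.
have bG1 i i' j j' : bmeas (fun x => \int[m]_y (F (x, y) * ((b i x * b i' x) * (b j y * b j' y))))%R.
  exact: (bmeas_Rint1 mT mT (bJ i i' j j')).
have GE p : G p.1 p.2 = (\int[m]_x \int[m]_y
    (F (x, y) * (b p.1 x * b p.1 x * (b p.2 y * b p.2 y) - b p.1 x * b p.2 x * (b p.2 y * b p.1 y))))%R.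
  rewrite /G /J -RintB; [|exact: bmeas_integrable mT _ (bG1 _ _ _ _)..].
  apply: eq_Rintegral => x _.
  rewrite -RintB; [|exact: bmeas_integrable mT _ (bmeas_section1 (bJ _ _ _ _) x)..].
  by apply: eq_Rintegral => y _; rewrite mulrBr.
have bGp p : bmeas (fun q : T * T => F q * (b p.1 q.1 * b p.1 q.1 * (b p.2 q.2 * b p.2 q.2) - b p.1 q.1 * b p.2 q.1 * (b p.2 q.2 * b p.1 q.2))).
  by under eq_fun do rewrite mulrBr; apply: bmeasB; exact: bJ.
rewrite (eq_bigr _ (fun p _ => GE p)) -Rint_sum//; last by move=> p; exact: (bmeas_Rint1 mT mT (bGp p)).
apply: eq_Rintegral => x _; rewrite -Rint_sum//; last by move=> p; exact: (bmeas_section1 (bGp p) x).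
apply: eq_Rintegral => y _; rewrite -mulr_sumr; congr (_ * _).
rewrite sumrB; congr (_ - _).
  by rewrite /K mulr_suml -(pair_bigA _ (fun i j => b i x * b i x * (b j y * b j y)))/=; apply: eq_bigr => i _; rewrite mulr_sumr.
rewrite expr2 /K mulr_suml -(pair_bigA _ (fun i j => b i x * b j x * (b j y * b i y)))/=; apply: eq_bigr => i _; rewrite mulr_sumr.
by apply: eq_bigr => j _; ring.
Qed.

End determinantal.

(** * Expected energy of the harmonic ensemble *)

Import HBNNSimple.
(** On indicators this is the assumption; simple functions increasing to f and dominated convergence
    on both sides extend it. *)
Lemma Rint_density {d : measure_display} {T : measurableType d} {R : realType}
    (m nu : {measure set T -> \bar R}) (g f : T -> R) :
  (m setT < +oo)%E -> (nu setT < +oo)%E -> bmeas g ->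
  (forall A, measurable A -> nu A = (\int[m]_(x in A) (g x)%:E)%E) ->
  bmeas f -> (forall x, 0 <= f x) -> (\int[nu]_x f x = \int[m]_x (f x * g x))%R.
Proof.
move=> mT nuT bg nuE bf f0; have [mf [M fM]] := bf.
have mEf : measurable_fun setT (EFin \o f) by exact/measurable_EFinP.
pose h := nnsfun_approx measurableT mEf.
have hf x : h k x @[k --> \oo] --> f x.
  have := @cvg_nnsfun_approx _ _ _ setT measurableT _ mEf (fun x _ => f0 x) x I.
  by move/fine_cvg.
have hle k x : h k x <= f x.
  rewrite -lee_fin; have := @le_approx _ _ _ setT (EFin \o f) k x (fun x _ => f0 x) I.
  by rewrite /h nnsfun_approxE.
have bh k : bmeas (h k).
  by split => //; exists M => x; rewrite ger0_norm// (le_trans (hle k x))// (le_trans (ler_norm _)).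
have bind A : measurable A -> bmeas (\1_A : T -> R).
  move=> mA; split; first exact: measurable_indic.
  by exists 1 => x; rewrite indicE; case: (_ \in _); rewrite ?normr1 ?normr0.
have indE A : measurable A -> (\int[nu]_x \1_A x = \int[m]_x (\1_A x * g x))%R.
  move=> mA; rewrite /Rintegral integral_indic// setIT nuE// integral_mkcond; congr fine.
  apply: eq_integral => x _; rewrite patchE indicE.
  by case: ifP; rewrite ?mul1r ?mul0r.
have hE k : (\int[nu]_x h k x = \int[m]_x (h k x * g x))%R.
  have mpre (c : R) : measurable (h k @^-1` [set c]).
    by rewrite -[X in measurable X]setTI; exact: measurable_funP.
  under eq_Rintegral do rewrite fimfunEord.
  rewrite Rint_sum//; last by move=> i; apply: bmeasZ; exact: bind.
  under [RHS]eq_Rintegral do rewrite fimfunEord mulr_suml.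
  rewrite [RHS]Rint_sum//; last by move=> i; apply: bmeasM => //; apply: bmeasZ; exact: bind.
  apply: eq_bigr => i _.
  rewrite RintZ; last by apply: (bmeas_integrable nuT); exact: bind.
  rewrite indE// -RintZ; last by apply: (bmeas_integrable mT); apply: bmeasM => //; exact: bind.
  by apply: eq_Rintegral => x _; rewrite mulrA.
have l1 : (\int[nu]_x h k x)%R @[k --> \oo] --> (\int[nu]_x f x)%R.
  apply: (@Rint_dominated _ _ _ nu set0 h f f) => //.
  - exact: bmeas_integrable.
  - by move=> k x _; rewrite ger0_norm.
have [mg [C gC]] := bg.
have l2 : (\int[m]_x (h k x * g x))%R @[k --> \oo] --> (\int[m]_x (f x * g x))%R.
  apply: (@Rint_dominated _ _ _ m set0 (fun k x => h k x * g x) (fun x => f x * g x) (fun x => M * C)) => //.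
  - by move=> k; apply: measurable_funM.
  - exact: measurable_funM.
  - by move=> x _; apply: cvgM; [exact: hf|exact: cvg_cst].
  - by apply: (bmeas_integrable mT); exact: bmeas_cst.
  - move=> k x _; rewrite normrM ler_pM//.
    by rewrite ger0_norm// (le_trans (hle k x))// (le_trans (ler_norm _)).
rewrite (funext hE) in l1.
exact: (cvg_unique _ l1 l2).
Qed.

Section harmonic_expectation.
Context {R : realType} (d : nat).
Hypothesis d_gt0 : (0 < d)%N.
Variable L : nat.
Local Notation S := (sphere R d).
Local Notation mu := (sphere_measure R d).
Local Notation N := (sphere_poly_dim R d L).
Local Notation n := (dim_sum d L : R).
Local Notation q := (kernel_poly d L : {poly R}).
Local Notation t x := (scoord ord0 x).
Variable P : probability (N.-tuple S) R.
Hypothesis hP : harmonic_ensemble P.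

Let muoo := @sphere_measure_lty R d.
Let Poo : (P setT < +oo)%E. Proof. by rewrite probability_setT ltry. Qed.
Let mnoo : (tuple_measure mu N setT < +oo)%E.
Proof. by rewrite (tuple_measureT mu) ltry. Qed.

Lemma measurable_sdot : measurable_fun setT (fun p : S * S => sdot p.1 p.2).
Proof.
apply: measurable_sum => i; apply: measurable_funM.
  exact: measurableT_comp (measurable_scoord i) measurable_fst.
exact: measurableT_comp (measurable_scoord i) measurable_snd.
Qed.

(** Two-point intensity K(x,x) K(y,y) - K(x,y)^2 as a polynomial in the inner product. *)
Let r : {poly R} := (n ^+ 2) *: 1 - q ^+ 2.

Let rE (x y : S) : (sphere_kernel L x x * sphere_kernel L y y - sphere_kernel L x y ^+ 2) = r.[sdot x y].
Proof.
by rewrite !sphere_kernelE// !sdotxx horner_kernel_poly// /r !hornerE/= -expr2.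
Qed.

Lemma harmonic_expectation_pairs (phi : R -> R) (M : R) : measurable_fun setT phi ->
  (forall u, -1 <= u <= 1 -> 0 <= phi u <= M) ->
  (\int[P]_x (\sum_(p : 'I_N * 'I_N | p.1 != p.2) phi (sdot (tnth x p.1) (tnth x p.2))) =
   \int[mu]_x (phi (t x) * r.[t x]))%R.
Proof.
move=> mphi phiM.
have sd (x y : S) : -1 <= sdot x y <= 1 by rewrite sdot_geN1 sdot_le1.
have [_ [b [Vb ob KE]]] := @sphere_kernel_basis_reproducing R d L.
have bb i : bmeas (b i) by exact: sphere_poly_bmeas (Vb i).
pose F (p : S * S) := phi (sdot p.1 p.2).
have bF : bmeas F.
  split; first exact: measurableT_comp mphi measurable_sdot.
  by exists M => p; have /andP[? ?] := phiM _ (sd p.1 p.2); rewrite ger0_norm.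
have KM x : (\matrix_(i, j) sphere_kernel L (tnth x i) (tnth x j)) =
   (\matrix_(i, j) \sum_(k < N) b k (tnth x i) * b k (tnth x j)) :> 'M[R]_N.
  by apply/matrixP => i j; rewrite !mxE KE.
have bD : bmeas (@harmonic_density R d L).
  rewrite /harmonic_density; apply: bmeasZ; apply: bmeas_sum => s _; apply: bmeasZ; apply: bmeas_prod => k _.
  under eq_fun do rewrite mxE KE.
  by apply: bmeas_sum => l _; apply: bmeasM; exact: bmeas_tnth.
rewrite (@Rint_density _ _ _ (tuple_measure mu N) P (@harmonic_density R d L))//; last 2 first.
- by apply: bmeas_sum => p _; exact: (bmeas_tnth2 p.1 p.2 bF).
- by move=> x; apply: sumr_ge0 => p _; have /andP[] := phiM _ (sd (tnth x p.1) (tnth x p.2)).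
transitivity (\int[mu]_x \int[mu]_y (F (x, y) * (sphere_kernel L x x * sphere_kernel L y y - sphere_kernel L x y ^+ 2)))%R.
  have H := @Rint_pairs_det_kernel _ _ _ mu N b bb ob F bF.
  rewrite /= in H.
  under [RHS]eq_Rintegral => x _ do under eq_Rintegral => y _ do rewrite !KE.
  rewrite -H; apply: eq_Rintegral => x _; rewrite /harmonic_density.
  by rewrite KM.
transitivity (\int[mu]_x (\int[mu]_y (phi (t y) * r.[t y])))%R; last exact: Rintegral_sphere_cst.
apply: eq_Rintegral => x _.
have [g rg gx] := rotation_to_pole x d_gt0.
have mpr : measurable_fun setT (fun y : S => phi (t y) * r.[t y]).
  apply: measurable_funM; last by case: (bmeas_horner d r).
  exact: measurableT_comp mphi (measurable_scoord _).
rewrite -(@Rintegral_rotation _ _ g (fun y => phi (t y) * r.[t y]))//.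
apply: eq_Rintegral => y _; rewrite rE /F /=.
have [_ _ _ _ sg] := rg.
by rewrite -sg gx sdot_pole.
Qed.

(** Reproducing property of K(e, .) applied to itself at the pole e. *)
Let zonal_int_q2 : zonal_int d (q ^+ 2) = n.
Proof.
have [[VK rK] _] := @sphere_kernel_basis_reproducing R d L.
have := rK _ (VK (sphere_pole R d)) (sphere_pole R d).
rewrite sphere_kernelE// sdotxx horner_kernel_poly// => ->.
by apply: eq_Rintegral => x _; rewrite sphere_kernelE// sdot_pole hornerE expr2.
Qed.

Let zonal_int_r : zonal_int d r = n ^+ 2 - n.
Proof.
by rewrite /r (functionalB (@zonal_int_lin R d)) (functionalZ (@zonal_int_lin R d)) zonal_int1 zonal_int_q2 mulr1.
Qed.

Let zonal_log_int_r : zonal_log_int d r = n ^+ 2 * zonal_log_int d 1 - zonal_log_int d (q ^+ 2).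
Proof.
by rewrite /r (functionalB (zonal_log_int_lin d_gt0)) (functionalZ (zonal_log_int_lin d_gt0)).
Qed.

(** Counts the ordered pairs by taking the expectation of a constant. *)
Let pairs_cst : \sum_(p : 'I_N * 'I_N | p.1 != p.2) ln 6 = ln 6 * (n ^+ 2 - n) :> R.
Proof.
have l6 : 0 <= ln 6 :> R by rewrite ln_ge0//; lra.
have := @harmonic_expectation_pairs (fun=> ln 6) (ln 6) _ _.
rewrite Rintegral_cst// (congr1 fine (@probability_setT _ _ _ P)) mulr1 => -> //; last by move=> u _; rewrite l6 lexx.
rewrite -zonal_int_r /zonal_int -RintZ//; apply: bmeas_integrable => //; exact: bmeas_horner.
Qed.

Let Z k : R := (\int[mu]_x (log_trunc k (t x) * r.[t x]))%R.

Let t_itv (x : S) : -1 <= t x <= 1.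
Proof. by have := scoord_norm ord0 x; rewrite ler_norml. Qed.

Let bL k : bmeas (fun x : S => log_trunc k (t x)).
Proof.
have [M lM] := @log_trunc_bound R k.
by apply: (@bmeas_zonal _ _ (log_trunc k) M) => //; exact: measurable_log_trunc.
Qed.

(** Truncated energy, shifted by ln 6 for each pair so as to be nonnegative and increasing in k. *)
Let h k (x : N.-tuple S) : R :=
  \sum_(p : 'I_N * 'I_N | p.1 != p.2) (log_trunc k (sdot (tnth x p.1) (tnth x p.2)) + ln 6).

Let Rint_h k : (\int[P]_x h k x)%R = Z k + ln 6 * (n ^+ 2 - n).
Proof.
have [M lM] := @log_trunc_bound R k.
rewrite (@harmonic_expectation_pairs (fun u => log_trunc k u + ln 6) (M + ln 6)).
- rewrite -zonal_int_r /zonal_int -RintZ; last by apply: bmeas_integrable => //; exact: bmeas_horner.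
  rewrite -RintD; last 2 first.
  + by apply: bmeas_integrable => //; apply: bmeasM => //; exact: bmeas_horner.
  + by apply: bmeas_integrable => //; apply: bmeasZ; exact: bmeas_horner.
  by apply: eq_Rintegral => x _; rewrite mulrDl.
- by apply: measurable_funD; [exact: measurable_log_trunc|exact: measurable_cst].
- move=> u u1; have := log_trunc_ge k u1; have := lM u u1; rewrite ler_norml; lra.
Qed.

Let cvgZ : Z k @[k --> \oo] --> n ^+ 2 * (- 2^-1 * (ln 2 + zonal_log_int d 1)) + 2^-1 * (ln 2 * n + zonal_log_int d (q ^+ 2)).
Proof.
have il : mu.-integrable setT (EFin \o (fun x : S => ln 2 + ln (1 - t x))).
  apply: integrable_add; last exact: integrable_lnB.
  by apply: (bmeas_integrable muoo); exact: bmeas_cst.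
have ipl : mu.-integrable setT (EFin \o (fun x : S => r.[t x] * ln (1 - t x))).
  by apply: integrable_bmeasM; [exact: bmeas_horner|exact: integrable_lnB].
apply: (@cvgn_eq_lim _ _ (\int[mu]_x (- 2^-1 * (ln 2 + ln (1 - t x)) * r.[t x]))%R).
  transitivity (- 2^-1 * (ln 2 * zonal_int d r + zonal_log_int d r)); last by rewrite zonal_int_r zonal_log_int_r; field.
  rewrite /zonal_int /zonal_log_int -RintZ; last by apply: bmeas_integrable => //; exact: bmeas_horner.
  rewrite -RintD//; last by apply: (bmeas_integrable muoo); apply: bmeasZ; exact: bmeas_horner.
  rewrite -RintZ; last first.
    by apply: integrable_add => //; apply: (bmeas_integrable muoo); apply: bmeasZ; exact: bmeas_horner.
  by apply: eq_Rintegral => x _; ring.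
have [M rM] := horner_bound r.
have mr : measurable_fun setT (fun x : S => r.[t x]) by case: (bmeas_horner d r).
have mln : measurable_fun setT (fun x : S => ln (1 - t x)).
  by have /integrableP[/measurable_EFinP] := @integrable_lnB R d d_gt0.
apply: (@Rint_dominated _ _ _ mu [set x : S | t x = 1] _ _ (fun x => M * (2^-1 * (`|ln (1 - t x)| + (ln 2 + 2))))).
- exact: measurable_pole_level.
- exact: sphere_measure_pole_level.
- by move=> k; apply: measurable_funM => //; case: (bL k).
- apply: measurable_funM => //; apply: measurable_funM; first exact: measurable_cst.
  by apply: measurable_funD; first exact: measurable_cst.
- move=> x /= x1; apply: cvgM; last exact: cvg_cst.
  have t1 : t x < 1 by rewrite lt_neqAle; apply/andP; split; [exact/eqP|have /andP[] := t_itv x].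
  apply: cvgM; first exact: cvg_cst.
  by apply: cvgD; [exact: cvg_cst|exact: cvg_log_trunc_real].
- apply: (@integrable_bmeasM _ _ _ mu (fun=> M)); first exact: bmeas_cst.
  apply: (@integrable_bmeasM _ _ _ mu (fun=> 2^-1)); first exact: bmeas_cst.
  apply: (@integrable_add _ _ _ mu (fun x => `|ln (1 - t x)|)); last first.
    by apply: (bmeas_integrable muoo); exact: bmeas_cst.
  by have := integrable_abse (@integrable_lnB R d d_gt0).
- move=> k x /= x1; rewrite mulrC normrM ler_pM//; first exact: rM.
  have t1 : t x < 1 by rewrite lt_neqAle; apply/andP; split; [exact/eqP|have /andP[] := t_itv x].
  have l2 : 0 <= ln 2 :> R by rewrite ln_ge0//; lra.
  have k0 : 0 < k.+1%:R^-1 :> R by rewrite invr_gt0.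
  have [_] := lnB_trunc_bounds k (t_itv x); rewrite /log_trunc.
  have : ln (1 - t x) <= ln (1 - t x + k.+1%:R^-1).
    by move: (k.+1%:R^-1 : R) k0 => a a0; rewrite ler_ln ?posrE; lra.
  move: (ln (1 - t x + _)) (ln (1 - t x)) => a c ca a2.
  have := ler_norm (- c); have := normr_ge0 c; rewrite normrN ler_norml; lra.
Qed.

Let H (x : N.-tuple S) : \bar R :=
  (\sum_(p : 'I_N * 'I_N | p.1 != p.2) (log_sdot (sdot (tnth x p.1) (tnth x p.2)) + (ln 6)%:E))%E.

Let HE x : H x = (log_energy x + (ln 6 * (n ^+ 2 - n))%:E)%E.
Proof.
rewrite /H big_split /=; congr (_ + _)%E; last by rewrite -pairs_cst sumEFin.
by apply: eq_bigr => p _; rewrite log_kernelE.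
Qed.

Let cvgh x : (h k x)%:E @[k --> \oo] --> H x.
Proof.
rewrite /h /H; under eq_fun do rewrite -sumEFin.
have st : forall p : 'I_N * 'I_N, sdot (tnth x p.1) (tnth x p.2) <= 1 by move=> p; exact: sdot_le1.
have stN : forall p : 'I_N * 'I_N, -1 <= sdot (tnth x p.1) (tnth x p.2) by move=> p; exact: sdot_geN1.
apply: cvg_nnesum => p _.
  by apply: nearW => k; rewrite lee_fin; have := @log_trunc_ge R k _ (introT andP (conj (stN p) (st p))); lra.
under eq_fun do rewrite EFinD.
apply: cvgeD; [|exact: cvg_log_trunc|exact: cvg_cst].
by rewrite /log_sdot; case: ifP.
Qed.

Let h0 k x : 0 <= h k x.
Proof.
apply: sumr_ge0 => p _; have : -1 <= sdot (tnth x p.1) (tnth x p.2) <= 1 by rewrite sdot_geN1 sdot_le1.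
by move/(@log_trunc_ge R k); lra.
Qed.

Let bh k : bmeas (h k).
Proof.
apply: bmeas_sum => p _.
have [M lM] := @log_trunc_bound R k.
apply: (bmeas_tnth2 p.1 p.2 (F := fun p => log_trunc k (sdot p.1 p.2) + ln 6)).
apply: bmeasD; last exact: bmeas_cst.
split; first exact: measurableT_comp (measurable_log_trunc k) measurable_sdot.
by exists M => u; apply: lM; rewrite sdot_geN1 sdot_le1.
Qed.

Let mh k : measurable_fun setT (EFin \o h k).
Proof. by apply/measurable_EFinP; case: (bh k). Qed.

Let mH : measurable_fun setT H.
Proof. exact: (@emeasurable_fun_cvg _ _ _ _ (fun k => EFin \o h k) H mh (fun x _ => @cvgh x)). Qed.

Let H0 x : (0 <= H x)%E.
Proof. by apply: (cvge_ge _ (@cvgh x)); apply: nearW => k; rewrite lee_fin. Qed.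

(** Monotone convergence under [P] on one side, dominated convergence of the one-variable integrals
    [Z k] on the other. *)
Let int_H : (\int[P]_x H x = (n ^+ 2 * (- 2^-1 * (ln 2 + zonal_log_int d 1)) +
  2^-1 * (ln 2 * n + zonal_log_int d (q ^+ 2)) + ln 6 * (n ^+ 2 - n))%:E)%E.
Proof.
have mono : forall x, setT x -> {homo (fun k => (h k x)%:E) : k l / (k <= l)%N >-> (k <= l)%E}.
  move=> x _ k l kl; rewrite lee_fin; apply: ler_sum => p _; rewrite lerD2r.
  by apply: log_trunc_homo => //; exact: sdot_le1.
have := @cvg_monotone_convergence _ _ _ P setT measurableT (fun k => EFin \o h k) mh _ mono.
have -> : (fun x => limn (fun k => (EFin \o h k) x)) = H by apply/funext => x; apply/cvg_lim => //; exact: cvgh.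
move=> C; have {C} := C (fun k x _ => h0 k x).
have -> : (fun k => \int[P]_x (EFin \o h k) x)%E = fun k => (Z k + ln 6 * (n ^+ 2 - n))%:E.
  by apply/funext => k; rewrite -Rint_h EFin_Rint//; exact: bmeas_integrable.
move=> C; apply: (cvg_unique _ C) => //.
apply: cvg_EFin; first exact: nearW.
by apply: cvgD; [exact: cvgZ|exact: cvg_cst].
Qed.

Lemma harmonic_expectation : (\int[P]_x log_energy x = (n ^+ 2)%:E * V_log R d +
  (2^-1 * (ln 2 * n + zonal_log_int d (q ^+ 2)))%:E)%E.
Proof.
have iH : P.-integrable setT H.
  apply/integrableP; split => //.
  have -> : (\int[P]_x `|H x| = \int[P]_x H x)%E by apply: eq_integral => x _; rewrite gee0_abs.
  by rewrite int_H ltry.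
have ic : P.-integrable setT (fun=> (ln 6 * (n ^+ 2 - n))%:E).
  by apply: (bmeas_integrable Poo); exact: bmeas_cst.
transitivity (\int[P]_x (H x - (ln 6 * (n ^+ 2 - n))%:E))%E.
  by apply: eq_integral => x _; rewrite HE addeK.
have int_c : (\int[P]_x (ln 6 * (n ^+ 2 - n))%:E = (ln 6 * (n ^+ 2 - n))%:E)%E.
  rewrite integral_cst//; apply: etrans (mule1 _).
  exact: (congr1 (fun z => (ln 6 * (n ^+ 2 - n))%:E * z)%E (probability_setT P)).
rewrite integralB// int_H int_c V_logE// -EFinM -EFinD. congr (_%:E); ring.
Qed.

End harmonic_expectation.

Theorem corollary3 (R : realType) :
  (forall (d : nat), (0 < d)%N ->
   forall P : (forall L, probability ((sphere_poly_dim R d L).-tuple (sphere R d)) R),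
   (forall L, harmonic_ensemble (P L)) ->
   let n := fun L => (sphere_poly_dim R d L)%:R : R in
   exists2 e : nat -> R, e =o_\oo n &
   forall L,
     (\int[P L]_x log_energy x =
      (n L ^+ 2)%:E * V_log R d
      + (- (d%:R^-1 * n L * ln (n L)) + harmonic_const R d * n L + e L)%:E)%E)
  /\ (harmonic_const R 2 = 2^-1 + ln 2 - euler_gamma R
      /\ `| harmonic_const R 2 - (61 / 10 ^+ 2 + 59 / 10 ^+ 4) | < 2^-1 / 10 ^+ 4).
Proof.
split; last by split; [exact: harmonic_const2|exact: harmonic_const2_approx].
move=> d d0 P hP n.
have nE L : n L = dim_sum d L by exact: sphere_poly_dimE.
have n0 L : 0 < n L by rewrite nE dim_sum_gt0.
(* The remainder is forced by [harmonic_expectation]; divided by n it is the sequence of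
   [cvg_kernel_log_energy] minus its limit. *)
exists (fun L => 2^-1 * (ln 2 * n L + zonal_log_int d (kernel_poly d L ^+ 2)) +
   d%:R^-1 * n L * ln (n L) - harmonic_const R d * n L); last first.
  by move=> L; rewrite harmonic_expectation// -nE; congr (_ + _%:E)%E; ring.
have C := @cvg_kernel_log_energy R d d0 (zonal_int d) (zonal_log_int d) (@zonal_int_lin R d)
  (zonal_log_int_lin d0) (@zonal_int1 R d) (@zonal_int_parts R d) (zonal_log_int_parts d0)
  (zonal_log_int_le d0) (zonal_log_int_ge d0).
apply/eqoP => eps eps0; move/cvgrPdist_le : C => /(_ eps eps0).
apply: filterS => L; rewrite -nE => H.
rewrite -ler_pdivrMr ?normr_gt0 ?gt_eqF// -normf_div distrC in H *.
apply: le_trans H; rewrite le_eqVlt; apply/orP; left; apply/eqP; congr (`|_|).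
by field; rewrite gt_eqF ?n0//= pnatr_eq0 -lt0n.
Qed.
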